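(* Let $(K,\Omega+\Theta)$ and $(K_i,\Omega_i+\Theta_i)$, $i=1,2$, be 2-shifted symplectic Lie groups. Let $(\mathcal{H}_1,(\Phi_1,\Phi),\sigma_1+\eta_1)$ be a lagrangian morphism into $K_1\times K$ and $(\mathcal{H}_2,(\Psi_2,\Psi),\sigma_2+\eta_2)$ a lagrangian morphism into $K_2\times\overline{K}$, where $\mathcal{H}_i\rightrightarrows N_i$. If $\Phi:\mathcal{H}_1\to K$ and $\Psi:\mathcal{H}_2\to K$ are transverse maps, then $$\Big(\mathcal{H}_1\times_K\mathcal{H}_2,\ (\Phi_1,\Psi_2),\ (\mathrm{pr}_1^*\sigma_1+\mathrm{pr}_2^*\sigma_2)+(\mathrm{pr}_1^*\eta_1+\mathrm{pr}_2^*\eta_2)\Big)$$ is a lagrangian morphism into $K_1\times K_2$.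
   Context: Everything is real and $C^\infty$. For a Lie groupoid $\mathcal{H}\rightrightarrows N$, $\mathtt{s},\mathtt{t}$ are source and target, $\mathtt{m}:\mathcal{H}_{(2)}=\{(g,h):\mathtt{s}(g)=\mathtt{t}(h)\}\to\mathcal{H}$ the multiplication, $\epsilon:N\to\mathcal{H}$ the unit map. 2-shifted symplectic Lie group: a Lie group $K$ with $\Omega\in\Omega^2(K\times K)$, whose pullbacks along $k\mapsto(1,k)$ and $k\mapsto(k,1)$ vanish, and $\Theta\in\Omega^3(K)$, such that $\delta\Omega=0$, $\delta\Theta=\mathrm{pr}_1^*\Theta+\mathrm{pr}_2^*\Theta-\mathtt{m}^*\Theta=-d\Omega$, $d\Theta=0$, where $\delta\Omega=(k_2,k_3)^*\Omega-(k_1k_2,k_3)^*\Omega+(k_1,k_2k_3)^*\Omega-(k_1,k_2)^*\Omega$ on $K^3$, and such that the symmetric form $\langle u,v\rangle=-\Omega_{(1,1)}((u,0),(0,v))+\Omega_{(1,1)}((0,u),(v,0))$ on $\mathfrak{k}=\mathrm{Lie}(K)$ is nondegenerate. $\overline{K}$ denotes $K$ with $-(\Omega+\Theta)$; products of 2-shifted symplectic groups carry the sum of the pulled back forms. A lagrangian morphism $(\mathcal{H},\Phi,\sigma+\eta)$ into $(K,\Omega+\Theta)$, $\mathcal{H}\rightrightarrows N$, is a Lie groupoid morphism $\Phi:\mathcal{H}\to K$ with $\sigma\in\Omega^2(\mathcal{H})$, $\epsilon^*\sigma=0$, and a closed $\eta\in\Omega^3(N)$ satisfying $\mathrm{pr}_1^*\sigma+\mathrm{pr}_2^*\sigma-\mathtt{m}^*\sigma=\Phi^*\Omega$,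 $\mathtt{s}^*\eta-\mathtt{t}^*\eta-d\sigma=\Phi^*\Theta$, $\dim\mathcal{H}-2\dim N=\frac12\dim K$, and $\ker(\sigma)_h\cap\ker(T\Phi)_h\cap\ker(T\mathtt{s})_h\cap\ker(T\mathtt{t})_h=\{0\}$ for all $h\in\mathcal{H}$. $\mathcal{H}_1\times_K\mathcal{H}_2=\{(h_1,h_2):\Phi(h_1)=\Psi(h_2)\}$ is the fibred product groupoid over $N_1\times N_2$, with componentwise structure maps; it is a Lie groupoid under transversality. *)

(* Defs.v *)
From HB Require Import structures.
From mathcomp Require Import all_boot all_order all_algebra.
From mathcomp Require Import all_classical all_reals all_analysis.

Set Implicit Arguments.
Unset Strict Implicit.
Unset Printing Implicit Defensive.

Import Order.TTheory GRing.Theory Num.Theory.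
Import numFieldNormedType.Exports.

Local Open Scope classical_set_scope.
Local Open Scope ring_scope.

Section EuclideanSmoothness.
Variables (R : realType) (n : nat) (W : normedModType R).
Implicit Types (U : set 'rV[R]_n) (f : 'rV[R]_n -> W).

Fixpoint Ck_on (k : nat) U f : Prop :=
  if k is k'.+1 then
    (forall x, U x -> differentiable f x) /\
    (forall v : 'rV[R]_n, Ck_on k' U (fun x => 'D_v f x))
  else forall x, U x -> {for x, continuous f}.

(* meant for open [U] *)
Definition smooth_on U f : Prop := forall k, Ck_on k U f.

End EuclideanSmoothness.

(*  A manifold is a subset [carrier] of an ambient topological space, with the
    subspace topology; structure maps are total functions on the ambient space
    of which only the restriction to the carrier matters.  The atlas is the
    family of the charts [chart_at x], [x] in the carrier, and [chart_at x] is
    used to identify the tangent space at [x] with R^dim, as [mdim]-row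
    vectors.  The records only hold data; the axioms are in the predicates
    [is_manifold], [is_lie_groupoid], etc. *)

(* [cdom] is an open set of the ambient space: as a chart of the subset [A],
   the actual domain is [A `&` cdom]. *)
Record chart (R : realType) (T : topologicalType) (n : nat) := Chart {
  cdom : set T;
  cmap : T -> 'rV[R]_n;
  cinv : 'rV[R]_n -> T }.

Definition chart_img (R : realType) (T : topologicalType) (n : nat)
    (A : set T) (c : chart R T n) : set 'rV[R]_n :=
  cmap c @` (A `&` cdom c).

Record is_chart (R : realType) (T : topologicalType) (n : nat)
    (A : set T) (c : chart R T n) : Prop := IsChart {
  chart_dom_open : open (cdom c);
  chart_img_open : open (chart_img A c);
  chart_continuous : {within A `&` cdom c, continuous (cmap c)};
  chart_inv_continuous : {within chart_img A c, continuous (cinv c)};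
  chart_cancel : forall x, A x -> cdom c x -> cinv c (cmap c x) = x }.

Record premanifold (R : realType) := Premanifold {
  mspace :> topologicalType;
  carrier : set mspace;
  mdim : nat;
  chart_at : mspace -> chart R mspace mdim }.

Definition tangent (R : realType) (M : premanifold R) := 'rV[R]_(mdim M).

Definition coord_pt (R : realType) (M : premanifold R) (x : M) : 'rV[R]_(mdim M) :=
  cmap (chart_at x) x.

Definition coord_img (R : realType) (M : premanifold R) (x : M) :
    set 'rV[R]_(mdim M) :=
  chart_img (@carrier R M) (chart_at x).

Record is_manifold (R : realType) (M : premanifold R) : Prop := IsManifold {
  mfd_hausdorff : hausdorff_space (set_type (@carrier R M));
  mfd_second_countable : @second_countable (set_type (@carrier R M));
  mfd_chart : forall x : M, carrier x -> is_chart (@carrier R M) (chart_at x);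
  mfd_mem_chart : forall x : M, carrier x -> cdom (chart_at x) x;
  mfd_transition : forall x y : M, carrier x -> carrier y ->
    smooth_on
      (cmap (chart_at x) @`
         (@carrier R M `&` (cdom (chart_at x) `&` cdom (chart_at y))))
      (fun u => cmap (chart_at y) (cinv (chart_at x) u)) }.

Section Maps.
Variable R : realType.
Implicit Types M N L : premanifold R.

Definition local_rep M N (f : M -> N) (x : M) :
    'rV[R]_(mdim M) -> 'rV[R]_(mdim N) :=
  fun u => cmap (chart_at (f x)) (f (cinv (chart_at x) u)).

Definition smooth_map M N (f : M -> N) : Prop :=
  forall x : M, carrier x ->
    carrier (f x) /\
    exists U : set 'rV[R]_(mdim M),
      [/\ open U,
          U (coord_pt x),
          U `<=` coord_img x,
          (forall u, U u -> cdom (chart_at (f x)) (f (cinv (chart_at x) u)))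
        & smooth_on U (local_rep f x)].

Definition tmap M N (f : M -> N) (x : M) : tangent M -> tangent N :=
  'd (local_rep f x) (coord_pt x).

Definition submersion M N (f : M -> N) : Prop :=
  smooth_map f /\
  forall x : M, carrier x -> forall w, exists v, tmap f x v = w.

Definition transverse M1 M2 L (f : M1 -> L) (g : M2 -> L) : Prop :=
  forall (x : M1) (y : M2), carrier x -> carrier y -> f x = g y ->
  forall w : tangent L, exists v1 v2, tmap f x v1 + tmap g y v2 = w.

Definition euclidean_open (n : nat) (V : set 'rV[R]_n) : premanifold R :=
  @Premanifold R 'rV[R]_n V n (fun=> Chart setT id id).

Definition open_restr M (O : set M) : premanifold R :=
  @Premanifold R M (@carrier R M `&` O) (mdim M) (@chart_at R M).

Definition prod_chart (T1 T2 : topologicalType) (n1 n2 : nat)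
    (c1 : chart R T1 n1) (c2 : chart R T2 n2) : chart R (T1 * T2)%type (n1 + n2) :=
  Chart (cdom c1 `*` cdom c2)
        (fun p => row_mx (cmap c1 p.1) (cmap c2 p.2))
        (fun u => (cinv c1 (lsubmx u), cinv c2 (rsubmx u))).

Definition prod_mfd M N : premanifold R :=
  @Premanifold R (M * N)%type (@carrier R M `*` @carrier R N) (mdim M + mdim N)
    (fun p => prod_chart (chart_at p.1) (chart_at p.2)).

(* Charts of an embedded submanifold [S] of [M]: diffeomorphisms between an
   open subset of [S] and an open subset of R^d, where a map defined on [S] is
   smooth when it is locally the restriction of a smooth map defined on an open
   subset of [M]. *)
Definition is_sub_chart M (S : set M) (d : nat) (c : chart R M d) : Prop :=
  [/\ is_chart S c,
      @smooth_map (open_restr (cdom c)) (euclidean_open setT) (cmap c)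
    & @smooth_map (euclidean_open (chart_img S c)) M (cinv c)].

(* [S] is a [d]-dimensional embedded submanifold of [M] when this is a
   manifold.  Two choices of the charts are smoothly compatible; the junk chart
   is only used at points around which there is no chart. *)
Definition sub_mfd M (S : set M) (d : nat) : premanifold R :=
  @Premanifold R M S d (fun x =>
    match pselect (exists c : chart R M d, is_sub_chart S c /\ cdom c x) with
    | left ex_c => projT1 (cid ex_c)
    | right _ => Chart set0 (cst 0) (cst x)
    end).

Definition fibre_product M1 M2 L (f : M1 -> L) (g : M2 -> L) : premanifold R :=
  @sub_mfd (prod_mfd M1 M2)
    [set p : M1 * M2 | [/\ carrier p.1, carrier p.2 & f p.1 = g p.2]]
    (mdim M1 + mdim M2 - mdim L)%N.

Definition dform M (k : nat) : Type := M -> ('I_k -> tangent M) -> R.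

HB.instance Definition _ M k := GRing.Zmodule.copy (dform M k)
  (M -> ('I_k -> 'rV[R]_(mdim M)) -> R).

Definition eq_dform M k (a b : dform M k) : Prop :=
  forall x : M, carrier x -> forall v, a x v = b x v.

Definition pullback M N (f : M -> N) k (a : dform N k) : dform M k :=
  fun x v => a (f x) (fun i => tmap f x (v i)).

Definition dform_in_chart M k (a : dform M k) (x : M) :
    dform (euclidean_open (coord_img x)) k :=
  @pullback (euclidean_open (coord_img x)) M (cinv (chart_at x)) k a.

Record is_dform M k (a : dform M k) : Prop := IsDForm {
  dform_multilinear : forall x : M, carrier x ->
    forall (v : 'I_k -> tangent M) i (r : R) (u w : tangent M),
      a x (dfwith v i (r *: u + w)) =
      r * a x (dfwith v i u) + a x (dfwith v i w);
  dform_alternating : forall x : M, carrier x ->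
    forall (v : 'I_k -> tangent M) i j, i != j -> v i = v j -> a x v = 0;
  dform_smooth : forall x : M, carrier x -> forall v : 'I_k -> 'rV[R]_(mdim M),
    smooth_on (coord_img x) (fun u => dform_in_chart a (x := x) u v : R^o) }.

(* In a chart, for constant vector fields v_0, ..., v_k,
     da(v_0, ..., v_k) = sum_i (-1)^i v_i (a(v_0, ..., ^v_i, ..., v_k)). *)
Definition ext_d M k (a : dform M k) : dform M k.+1 := fun x v =>
  \sum_(i < k.+1) (-1) ^+ i *
    'D_(v i) (fun u : 'rV[R]_(mdim M) =>
                dform_in_chart a (x := x) u (fun j => v (lift i j)) : R^o)
             (coord_pt x).

Definition vec2 (V : Type) (u v : V) : 'I_2 -> V :=
  fun i => if val i == 0%N then u else v.

Definition in_ker M (a : dform M 2) (x : M) (v : tangent M) : Prop :=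
  forall w, a x (vec2 v w) = 0.

End Maps.

Section Groups.
Variable R : realType.

Record pre_lie_group := PreLieGroup {
  gmfd :> premanifold R;
  gmul : gmfd -> gmfd -> gmfd;
  gone : gmfd;
  ginv : gmfd -> gmfd }.

Record is_lie_group (K : pre_lie_group) : Prop := IsLieGroup {
  lg_manifold : is_manifold K;
  lg_mul_smooth :
    @smooth_map R (prod_mfd K K) K (fun p : K * K => gmul p.1 p.2);
  lg_inv_smooth : smooth_map (@ginv K);
  lg_one : carrier (gone K);
  lg_mulA : forall a b c : K, carrier a -> carrier b -> carrier c ->
    gmul a (gmul b c) = gmul (gmul a b) c;
  lg_mul1g : forall a : K, carrier a -> gmul (gone K) a = a;
  lg_mulg1 : forall a : K, carrier a -> gmul a (gone K) = a;
  lg_mulVg : forall a : K, carrier a -> gmul (ginv a) a = gone K;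
  lg_mulgV : forall a : K, carrier a -> gmul a (ginv a) = gone K }.

Record pre_shifted_group := PreShiftedGroup {
  sgroup :> pre_lie_group;
  sOmega : dform (prod_mfd sgroup sgroup) 2;
  sTheta : dform sgroup 3 }.

Definition delta2 (K : pre_lie_group) (Omega : dform (prod_mfd K K) 2) :
    dform (prod_mfd (prod_mfd K K) K) 2 :=
  let K2 := prod_mfd K K in
  let K3 := prod_mfd (prod_mfd K K) K in
    @pullback R K3 K2 (fun k : K * K * K => (k.1.2, k.2)) 2 Omega
  - @pullback R K3 K2 (fun k : K * K * K => (gmul k.1.1 k.1.2, k.2)) 2 Omega
  + @pullback R K3 K2 (fun k : K * K * K => (k.1.1, gmul k.1.2 k.2)) 2 Omega
  - @pullback R K3 K2 (fun k : K * K * K => (k.1.1, k.1.2)) 2 Omega.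

Definition delta1 (K : pre_lie_group) (j : nat) (a : dform K j) :
    dform (prod_mfd K K) j :=
    @pullback R (prod_mfd K K) K (fun k : K * K => k.1) j a
  + @pullback R (prod_mfd K K) K (fun k : K * K => k.2) j a
  - @pullback R (prod_mfd K K) K (fun k : K * K => gmul k.1 k.2) j a.

(* [row_mx u v] is the tangent vector (u, v) of the product *)
Definition shifted_pairing (K : pre_shifted_group) (u v : tangent K) : R :=
  - sOmega (gone K, gone K) (vec2 (row_mx u 0) (row_mx 0 v))
  + sOmega (gone K, gone K) (vec2 (row_mx 0 u) (row_mx v 0)).

Record is_shifted_symplectic (K : pre_shifted_group) : Prop :=
  IsShiftedSymplectic {
  ss_lie_group : is_lie_group K;
  ss_Omega_form : is_dform (@sOmega K);
  ss_Theta_form : is_dform (@sTheta K);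
  ss_Omega_normalized_r :
    eq_dform (@pullback R K (prod_mfd K K) (fun k => (gone K, k)) 2 (@sOmega K)) 0;
  ss_Omega_normalized_l :
    eq_dform (@pullback R K (prod_mfd K K) (fun k => (k, gone K)) 2 (@sOmega K)) 0;
  ss_delta_Omega : eq_dform (delta2 (@sOmega K)) 0;
  ss_delta_Theta : eq_dform (delta1 (@sTheta K)) (- ext_d (@sOmega K));
  ss_Theta_closed : eq_dform (ext_d (@sTheta K)) 0;
  ss_nondegenerate :
    forall u : tangent K, (forall v, shifted_pairing u v = 0) -> u = 0 }.

Definition shifted_opp (K : pre_shifted_group) : pre_shifted_group :=
  @PreShiftedGroup K (- @sOmega K) (- @sTheta K).

Definition prod_group (K L : pre_lie_group) : pre_lie_group :=
  @PreLieGroup (prod_mfd K L)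
    (fun p q : K * L => (gmul p.1 q.1, gmul p.2 q.2))
    (gone K, gone L)
    (fun p : K * L => (ginv p.1, ginv p.2)).

Definition shifted_prod (K L : pre_shifted_group) : pre_shifted_group :=
  let KL := prod_group K L in
  @PreShiftedGroup KL
    (@pullback R (prod_mfd KL KL) (prod_mfd K K)
       (fun p : (K * L) * (K * L) => (p.1.1, p.2.1)) 2 (@sOmega K)
     + @pullback R (prod_mfd KL KL) (prod_mfd L L)
       (fun p : (K * L) * (K * L) => (p.1.2, p.2.2)) 2 (@sOmega L))
    (@pullback R KL K (fun p : K * L => p.1) 3 (@sTheta K)
     + @pullback R KL L (fun p : K * L => p.2) 3 (@sTheta L)).

End Groups.

Section Groupoids.
Variable R : realType.

Record pre_groupoid := PreGroupoid {
  arr : premanifold R;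
  obj : premanifold R;
  src : arr -> obj;
  tgt : arr -> obj;
  mult : arr -> arr -> arr;
  idn : obj -> arr;
  inverse : arr -> arr }.

Definition composable (G : pre_groupoid) : premanifold R :=
  fibre_product (@src G) (@tgt G).

Record is_lie_groupoid (G : pre_groupoid) : Prop := IsLieGroupoid {
  gd_arr_manifold : is_manifold (arr G);
  gd_obj_manifold : is_manifold (obj G);
  gd_src : submersion (@src G);
  gd_tgt : submersion (@tgt G);
  gd_mult_smooth : @smooth_map R (composable G) (arr G)
    (fun p : arr G * arr G => mult p.1 p.2);
  gd_idn_smooth : smooth_map (@idn G);
  gd_inverse_smooth : smooth_map (@inverse G);
  gd_src_idn : forall x : obj G, carrier x -> src (idn x) = x;
  gd_tgt_idn : forall x : obj G, carrier x -> tgt (idn x) = x;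
  gd_src_mult : forall g h : arr G, carrier g -> carrier h -> src g = tgt h ->
    src (mult g h) = src h;
  gd_tgt_mult : forall g h : arr G, carrier g -> carrier h -> src g = tgt h ->
    tgt (mult g h) = tgt g;
  gd_multA : forall f g h : arr G, carrier f -> carrier g -> carrier h ->
    src f = tgt g -> src g = tgt h -> mult f (mult g h) = mult (mult f g) h;
  gd_idn_mult : forall g : arr G, carrier g -> mult (idn (tgt g)) g = g;
  gd_mult_idn : forall g : arr G, carrier g -> mult g (idn (src g)) = g;
  gd_src_inverse : forall g : arr G, carrier g -> src (inverse g) = tgt g;
  gd_tgt_inverse : forall g : arr G, carrier g -> tgt (inverse g) = src g;
  gd_inverse_mult : forall g : arr G, carrier g ->
    mult (inverse g) g = idn (src g);
  gd_mult_inverse : forall g : arr G, carrier g ->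
    mult g (inverse g) = idn (tgt g) }.

(* [K] is regarded as a Lie groupoid over a point *)
Record is_groupoid_morphism (G : pre_groupoid) (K : pre_lie_group R)
    (Phi : arr G -> K) : Prop := IsGroupoidMorphism {
  gm_smooth : smooth_map Phi;
  gm_mult : forall g h : arr G, carrier g -> carrier h -> src g = tgt h ->
    Phi (mult g h) = gmul (Phi g) (Phi h);
  gm_idn : forall x : obj G, carrier x -> Phi (idn x) = gone K }.

Record is_lagrangian (K : pre_shifted_group R) (G : pre_groupoid)
    (Phi : arr G -> K) (sigma : dform (arr G) 2) (eta : dform (obj G) 3) : Prop :=
  IsLagrangian {
  lag_groupoid : is_lie_groupoid G;
  lag_morphism : is_groupoid_morphism Phi;
  lag_sigma_form : is_dform sigma;
  lag_eta_form : is_dform eta;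
  lag_idn_sigma : eq_dform (pullback (@idn G) sigma) 0;
  lag_eta_closed : eq_dform (ext_d eta) 0;
  lag_delta_sigma :
    let G2 := composable G in
    eq_dform
      (  @pullback R G2 (arr G) (fun p : arr G * arr G => p.1) 2 sigma
       + @pullback R G2 (arr G) (fun p : arr G * arr G => p.2) 2 sigma
       - @pullback R G2 (arr G) (fun p : arr G * arr G => mult p.1 p.2) 2 sigma)
      (@pullback R G2 (prod_mfd K K)
         (fun p : arr G * arr G => (Phi p.1, Phi p.2)) 2 (@sOmega R K));
  lag_delta_eta :
    eq_dform (pullback (@src G) eta - pullback (@tgt G) eta - ext_d sigma)
            (pullback Phi (@sTheta R K));
  lag_dim : (mdim (arr G))%:R - 2 * (mdim (obj G))%:R = (mdim K)%:R / 2 :> rat;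
  lag_kernel : forall (h : arr G), carrier h -> forall v : tangent (arr G),
    in_ker sigma h v -> tmap Phi h v = 0 ->
    tmap (@src G) h v = 0 -> tmap (@tgt G) h v = 0 -> v = 0 }.

Definition fibre_groupoid (G1 G2 : pre_groupoid) (K : premanifold R)
    (Phi : arr G1 -> K) (Psi : arr G2 -> K) : pre_groupoid :=
  @PreGroupoid (fibre_product Phi Psi) (prod_mfd (obj G1) (obj G2))
    (fun p : arr G1 * arr G2 => (src p.1, src p.2))
    (fun p : arr G1 * arr G2 => (tgt p.1, tgt p.2))
    (fun p q : arr G1 * arr G2 => (mult p.1 q.1, mult p.2 q.2))
    (fun x : obj G1 * obj G2 => (idn x.1, idn x.2))
    (fun p : arr G1 * arr G2 => (inverse p.1, inverse p.2)).

End Groupoids.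

(* Main.v *)
From HB Require Import structures.
Require Import Defs.
From mathcomp Require Import all_boot all_order all_algebra.
From mathcomp Require Import all_classical all_reals all_analysis.
From mathcomp Require Import perm ring lra zify.

(* At a unit, multiplicativity of sigma turns the pairing of T Phi(a) and
   T Phi(b), for a, b tangent to the source fibres and a also to the target
   fibres, into -sigma(a, T epsilon T t(b)).  Let a = (a1, a2) be in the kernel
   to be shown trivial, at a unit of the fibre product; then a1 and a2 have a
   common image u in the Lie algebra of K and vanishing images in those of K1
   and K2.  As sigma1(a1, -) and sigma2(a2, -) vanish on unit vectors, u is
   orthogonal to the images of ker T s under T Phi and T Psi.  By transversality,
   in the form where the vectors are taken tangent to the source fibres, these
   span the Lie algebra of K, so u = 0 by nondegeneracy; then a1 and a2 are in
   the kernels of the two given lagrangian morphisms, hence a = 0.  Right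
   translation reduces the kernel condition at an arbitrary arrow to the units.
   The identities between forms are pulled back along the projections, where the
   contributions of K and of its opposite cancel.  The same restricted
   transversality makes the source map of the fibre product a submersion.
   Smoothness of the fibre product itself rests on the inverse function
   theorem. *)

(** The charts of a fibre product are obtained by choice, so nothing explicit is known of its
    tangent vectors in coordinates. They are handled only through their two projections, which are
    jointly injective ([fibre_tangent_inj]) and reach every pair of vectors with equal images
    ([fibre_tangent_ex]). The differential of a groupoid multiplication is treated likewise, and the
    rules for products of vectors come from differentiating identities between smooth maps.

    The kernel condition is moved to the units because there the two forms can be separated: the
    objects of the fibre product are all of N1 x N2, so unit vectors of the two factors vary
    independently, whereas general vectors tangent to the arrows are coupled through K.

    [ext_d] is given by a formula in one chart per point. The equations on eta and d sigma can be
    pulled back only once this formula is known to be natural, and naturality rests on the symmetry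
    of second derivatives; this is why the C^k calculus starts from the mean value theorem. *)

Set Implicit Arguments.
Unset Strict Implicit.
Unset Printing Implicit Defensive.

Import Order.TTheory GRing.Theory Num.Theory.
Import numFieldNormedType.Exports.

Local Open Scope classical_set_scope.
Local Open Scope ring_scope.

(** * Maps of class C^k *)

Section Differentials.
Variables (R : realType) (V W : normedModType R).
Implicit Types (f g : V -> W) (x : V).

(** Differentiability in epsilon form with a prescribed differential; this is the form in which the
    local inverse of a map can be shown differentiable. *)
Lemma differentiable_normP f x (L : {linear V -> W}) : continuous L ->
  (forall e : R, 0 < e ->
     \forall h \near (0 : V), `|f (h + x) - f x - L h| <= e * `|h|) ->
  differentiable f x /\ 'd f x = L :> (V -> W).
Proof.
move=> cL fL; have fE : f \o shift x = cst (f x) + L +o_ 0 id.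
  apply/eqaddoP => e e0; near=> h.
  rewrite [X in `|X|](_ : _ = f (h + x) - f x - L h); first by near: h; exact: fL.
  by rewrite !fctE /= opprD addrA.
have dE := diff_unique cL fE; split=> //; apply/diff_locallyP.
by rewrite dE.
Unshelve. all: by end_near. Qed.

Lemma differentiable_norm f x : differentiable f x -> forall e : R, 0 < e ->
  \forall h \near (0 : V), `|f (h + x) - f x - 'd f x h| <= e * `|h|.
Proof.
move=> /diff_locallyP[_ /eqaddoP fE] e e0; near=> h.
rewrite [X in `|X|](_ : _ = (f \o shift x - (cst (f x) + 'd f x)) h).
  by near: h; exact: fE.
by rewrite !fctE /= opprD addrA.
Unshelve. all: by end_near. Qed.

Lemma near_eq_differentiable f g x : (\forall y \near x, f y = g y) ->
  differentiable f x -> differentiable g x.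
Proof.
move=> fg df; apply: (proj1 (differentiable_normP (L := 'd f x) _ _)).
  exact: diff_continuous.
move=> e e0; have := differentiable_norm df e0.
rewrite -(nbhs_singleton fg).
have fg' : \forall h \near (0 : V), f (h + x) = g (h + x).
  by have := fg; rewrite (near_shift 0 x) /= subr0.
by apply: filterS2 fg' => h ->.
Qed.

End Differentials.

Section CkOn.
Variables (R : realType) (n : nat) (W : normedModType R).
Implicit Types (U V : set 'rV[R]_n) (f g : 'rV[R]_n -> W) (k : nat).

(** Openness turns equality on [U] into equality near each of its points, which is what derivatives
    see. *)
Lemma Ck_on_eq k U f g : open U -> (forall x, U x -> f x = g x) ->
  Ck_on k U f -> Ck_on k U g.
Proof.
move=> oU; have nU (a b : 'rV[R]_n -> W) x : U x -> (forall x, U x -> a x = b x) ->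
    \forall y \near x, a y = b y.
  by move=> Ux ab; apply: filterS ab _; exact: open_nbhs_nbhs.
elim: k f g => [|k IH] f g fg /=.
  move=> cf x Ux; have := cf x Ux; rewrite /prop_for /continuous_at -(fg x Ux).
  have nfg := nU g f x Ux (fun y Uy => esym (fg y Uy)).
  by move=> c A /c; apply: (@filterS2 _ _ (nbhs_filter x) _ _ _ _ nfg) => y /= ->.
move=> [df Df]; split=> [x Ux|v].
  by apply: near_eq_differentiable (df x Ux); exact: nU.
by apply: IH (Df v) => x Ux; apply: near_eq_derive; exact: nU.
Qed.

Lemma Ck_on_sub k U V f : V `<=` U -> Ck_on k U f -> Ck_on k V f.
Proof.
move=> VU; elim: k f => [|k IH] f /=; first by move=> cf x /VU; exact: cf.
by move=> [df Df]; split=> [x /VU/df//|v]; exact: IH.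
Qed.

(** Continuity and differentiability are taken at points of [U] but in the whole space, so all that
    is asked of [V] is to contain the point. *)
Lemma Ck_on_local k U f :
  (forall x, U x -> exists2 V, V x & Ck_on k V f) -> Ck_on k U f.
Proof.
elim: k f => [|k IH] f Uf /=.
  by move=> x /Uf[V Vx]; exact.
split=> [x /Uf[V Vx [dV _]]|v]; first exact: dV.
by apply: IH => x /Uf[V Vx [_ DV]]; exists V => //; exact: DV.
Qed.

Lemma Ck_on_pred k U f : Ck_on k.+1 U f -> Ck_on k U f.
Proof.
elim: k f => [|k IH] f [df Df].
  by move=> x /df; exact: differentiable_continuous.
by split=> // v; exact/IH/Df.
Qed.

Lemma Ck_on_cst k U (a : W) : Ck_on k U (cst a).
Proof.
elim: k a => [|k IH] a; first by move=> x _; exact: cst_continuous.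
split=> [x _|v]; first exact: differentiable_cst.
rewrite (_ : (fun _ => _) = cst 0); first exact: IH.
by apply/funext => x; rewrite derive_cst.
Qed.

Lemma Ck_onD k U f g : open U -> Ck_on k U f -> Ck_on k U g ->
  Ck_on k U (fun x => f x + g x).
Proof.
move=> oU; elim: k f g => [|k IH] f g.
  by move=> cf cg x Ux; exact: continuousD (cf x Ux) (cg x Ux).
move=> [df Df] [dg Dg]; split=> [x Ux|v].
  exact: differentiableD (df x Ux) (dg x Ux).
apply: (Ck_on_eq oU _ (IH _ _ (Df v) (Dg v))) => x Ux.
by rewrite -deriveD//; apply: diff_derivable; [exact: df|exact: dg].
Qed.

Lemma Ck_onZ k U (a : R) f : open U -> Ck_on k U f ->
  Ck_on k U (fun x => a *: f x).
Proof.
move=> oU; elim: k f => [|k IH] f.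
  by move=> cf x Ux; apply: continuousZl_tmp; exact: cf.
move=> [df Df]; split=> [x Ux|v].
  exact: differentiableZ (df x Ux).
apply: (Ck_on_eq oU _ (IH _ (Df v))) => x Ux.
by rewrite -deriveZ//; apply: diff_derivable; exact: df.
Qed.

Lemma Ck_on_sum k U I (r : seq I) (f : I -> 'rV[R]_n -> W) : open U ->
  (forall i, Ck_on k U (f i)) -> Ck_on k U (fun x => \sum_(i <- r) f i x).
Proof.
move=> oU cf; elim: r => [|i r IH].
  by rewrite (_ : (fun _ => _) = cst 0); [exact: Ck_on_cst|apply/funext => x; rewrite big_nil].
rewrite (_ : (fun _ => _) = (fun x => f i x + \sum_(i <- r) f i x)).
  exact: Ck_onD.
by apply/funext => x; rewrite big_cons.
Qed.

End CkOn.

Section CkScalar.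
Variables (R : realType) (n : nat).
Implicit Types (U V : set 'rV[R]_n) (f g : 'rV[R]_n -> R^o) (k : nat).

Lemma Ck_onM k U f g : open U -> Ck_on k U f -> Ck_on k U g ->
  Ck_on k U (fun x => f x * g x : R^o).
Proof.
move=> oU; elim: k f g => [|k IH] f g.
  by move=> cf cg x Ux; exact: continuousM (cf x Ux) (cg x Ux).
move=> cf cg; have [df Df] := cf; have [dg Dg] := cg; split=> [x Ux|v].
  exact: differentiableM (df x Ux) (dg x Ux).
have := Ck_onD oU (IH _ _ (Ck_on_pred cf) (Dg v)) (IH _ _ (Ck_on_pred cg) (Df v)).
apply: Ck_on_eq => // x Ux.
rewrite [RHS](@deriveM _ _ f g)//; apply: diff_derivable; [exact: df|exact: dg].
Qed.

Lemma Ck_on_prod k U I (r : seq I) (f : I -> 'rV[R]_n -> R^o) : open U ->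
  (forall i, Ck_on k U (f i)) -> Ck_on k U (fun x => \prod_(i <- r) f i x : R^o).
Proof.
move=> oU cf; elim: r => [|i r IH].
  by rewrite (_ : (fun _ => _) = cst 1); [exact: Ck_on_cst|apply/funext => x; rewrite big_nil].
rewrite (_ : (fun _ => _) = (fun x => f i x * \prod_(i <- r) f i x)).
  exact: Ck_onM.
by apply/funext => x; rewrite big_cons.
Qed.

Lemma Ck_onV k U f : open U -> (forall x, U x -> f x != 0) -> Ck_on k U f ->
  Ck_on k U (fun x => (f x)^-1 : R^o).
Proof.
move=> oU f0; elim: k => [|k IH].
  by move=> cf x Ux; exact: (continuousV (f0 x Ux) (cf x Ux)).
move=> cf; have [df Df] := cf; split=> [x Ux|v].
  exact: (differentiableV (df x Ux) (f0 x Ux)).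
(* The derivative is - f^-1 f^-1 f', and f^-1 is already of class C^k by induction. *)
have cV := IH (Ck_on_pred cf).
have := Ck_onM oU (Ck_onM oU cV cV) (Ck_onZ (-1) oU (Df v)).
apply: Ck_on_eq => // x Ux.
rewrite [RHS](@deriveV _ _ f) ?f0//; last by apply: diff_derivable; exact: df.
by rewrite scaleN1r expr2 invfM mulrN scaleNr.
Qed.

End CkScalar.

Section CkComponents.
Variables (R : realType) (n m : nat).
Implicit Types (U V : set 'rV[R]_n) (f g : 'rV[R]_n -> 'rV[R]_m) (k : nat).

Lemma differentiable_rVP f x :
  differentiable f x <-> forall j, differentiable (fun y => f y 0 j : R^o) x.
Proof.
split=> [df j|df].
  by apply: (@differentiable_comp _ _ _ _ f (fun M : 'rV[R]_m => M 0 j : R^o)) => //;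
     exact: differentiable_coord.
rewrite (_ : f = \sum_j (fun y => (f y 0 j : R^o) *: delta_mx 0 j)).
  by apply: differentiable_sum => j; exact: differentiableZl.
apply/funext => y; rewrite {1}[f y]matrix_sum_delta big_ord1 fct_sumE.
by [].
Qed.

Lemma derive_coord f x v j : derivable f x v ->
  ('D_v f x) 0 j = 'D_v (fun y => f y 0 j : R^o) x.
Proof. by move=> df; rewrite derive_mx// mxE. Qed.

Lemma continuous_rVP f x : {for x, continuous f} <->
  forall j, {for x, continuous (fun y => f y 0 j : R^o)}.
Proof.
split=> [cf j|cf].
  by apply: (@continuous_comp _ _ _ f (fun M : 'rV[R]_m => M 0 j : R^o)) => //;
     exact: coord_continuous.
move=> A [P nP sPA]; rewrite nbhs_simpl /=.
have : \forall y \near x, forall j, P 0 j (f y 0 j).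
  by apply: (@filter_forall _ _ _ _ (nbhs_filter x)) => j; exact: (cf j (P 0 j) (nP 0 j)).
by apply: filterS => y Py; apply: sPA => i j; rewrite ord1.
Qed.

Lemma Ck_on_rVP k U f : open U ->
  Ck_on k U f <-> forall j, Ck_on k U (fun x => f x 0 j : R^o).
Proof.
move=> oU; elim: k f => [|k IH] f.
  by split=> [cf j x /cf/continuous_rVP//|cf x Ux]; apply/continuous_rVP => j; exact: cf.
split=> [[df Df] j|cf].
  split=> [x /df/differentiable_rVP//|v].
  have /IH/(_ j) := Df v; apply: Ck_on_eq => // x Ux.
  by rewrite derive_coord//; apply: diff_derivable; exact: df.
have df x : U x -> differentiable f x.
  by move=> Ux; apply/differentiable_rVP => j; have [+ _] := cf j; exact.
split=> // v; apply/IH => j; have [_ /(_ v)] := cf j; apply: Ck_on_eq => // x Ux.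
by rewrite derive_coord//; apply: diff_derivable; exact: df.
Qed.

End CkComponents.

Section CkComposition.
Variables (R : realType) (n m : nat).

Lemma diff_row_sum (W : normedModType R) (f : 'rV[R]_m -> W) y (v : 'rV[R]_m) :
  differentiable f y ->
  'd f y v = \sum_j v 0 j *: 'D_(delta_mx 0 j) f y.
Proof.
move=> df; rewrite {1}[v]matrix_sum_delta big_ord1 linear_sum.
by apply: eq_bigr => j _; rewrite linearZ deriveE.
Qed.

Lemma derive_comp (W : normedModType R) (f : 'rV[R]_m -> W)
    (g : 'rV[R]_n -> 'rV[R]_m) x v :
  differentiable g x -> differentiable f (g x) ->
  'D_v (f \o g) x = 'D_('D_v g x) f (g x).
Proof.
move=> dg df; rewrite !deriveE//; last exact: differentiable_comp.
by rewrite diff_comp.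
Qed.

(** Induction on [k] through the chain rule: the derivative along v is the sum over j of (D_v g)_j
    times (D_{e_j} f) o g. The induction hypothesis applies to the partial derivatives of [f], and
    scalar values allow the products. *)
Lemma Ck_on_comp_scalar k (U : set 'rV[R]_n) (V : set 'rV[R]_m)
    (f : 'rV[R]_m -> R^o) (g : 'rV[R]_n -> 'rV[R]_m) :
  open U -> (forall x, U x -> V (g x)) ->
  Ck_on k V f -> Ck_on k U g -> Ck_on k U (f \o g).
Proof.
move=> oU UV; elim: k f => [|k IH] f.
  move=> cf cg x Ux; apply: continuous_comp; [exact: cg|exact/cf/UV].
move=> [df Df] cg; have [dg Dg] := cg; split=> [x Ux|v].
  by apply: differentiable_comp; [exact: dg|exact/df/UV].
have Dj j := IH _ (Df (delta_mx 0 j)) (Ck_on_pred cg).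
have cgv j : Ck_on k U (fun x => ('D_v g x) 0 j : R^o).
  by have /Ck_on_rVP := Dg v; apply.
have := Ck_on_sum (index_enum 'I_m) oU (fun j => Ck_onM oU (cgv j) (Dj j)).
apply: Ck_on_eq => // x Ux.
rewrite derive_comp; [|exact: dg|exact/df/UV].
by rewrite (deriveE _ (df _ (UV _ Ux))) diff_row_sum//; exact: (df _ (UV _ Ux)).
Qed.

Lemma Ck_on_comp l k (U : set 'rV[R]_n) (V : set 'rV[R]_m)
    (f : 'rV[R]_m -> 'rV[R]_l) (g : 'rV[R]_n -> 'rV[R]_m) :
  open U -> open V -> (forall x, U x -> V (g x)) ->
  Ck_on k V f -> Ck_on k U g -> Ck_on k U (f \o g).
Proof.
move=> oU oV UV /(Ck_on_rVP k f oV) cf cg; apply/Ck_on_rVP => // j.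
exact: (Ck_on_comp_scalar oU UV (cf j) cg).
Qed.

Lemma smooth_on_linear (L : {linear 'rV[R]_n -> 'rV[R]_m}) (U : set 'rV[R]_n) :
  continuous L -> smooth_on U L.
Proof.
move=> cL [|k] /=; first by move=> x _; exact: cL.
split=> [x _|v]; first exact: linear_differentiable.
rewrite (_ : (fun _ => _) = cst (L v)); first exact: Ck_on_cst.
apply/funext => x; rewrite deriveE; last exact: linear_differentiable.
by rewrite diff_lin.
Qed.

Lemma continuous_mulmxr (A : 'M[R]_(n, m)) : continuous (fun u : 'rV[R]_n => u *m A).
Proof.
move=> u; apply: differentiable_continuous; apply/differentiable_rVP => j.
rewrite (_ : (fun _ => _) = \sum_i (A i j *: (fun y : 'rV[R]_n => y 0 i : R^o))).
  by apply: differentiable_sum => i; apply: differentiableZ; exact: differentiable_coord.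
by apply/funext => y; rewrite mxE fct_sumE; apply: eq_bigr => i _; rewrite mulrC.
Qed.

End CkComposition.

(** Removes the two factors [h] from a second difference computed in two ways, in
    [mixed_derivatives_meet]. *)
Lemma mulf2_inj (F : idomainType) (h p q a b : F) : h != 0 ->
  p = h * (h * a) -> q = h * (h * b) -> p = q -> a = b.
Proof. by move=> h0 -> -> /(mulfI h0)/(mulfI h0). Qed.

Lemma subrBAC (G : zmodType) (a b c d : G) : a - b - (c - d) = a - c - (b - d).
Proof. by rewrite !opprD !opprK -!addrA; congr (_ + _); rewrite addrCA. Qed.

(** * Mean values and symmetry of second derivatives *)

Section MeanValue.
Variables (R : realType) (V : normedModType R).
Implicit Types (f : V -> R^o) (x y v w : V).

Lemma is_derive_line (W : normedModType R) (f : V -> W) y w (t : R) :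
  differentiable f (y + t *: w) ->
  is_derive t 1 (fun s : R => f (y + s *: w)) ('D_w f (y + t *: w)).
Proof.
move=> df.
have dl : is_diff t (fun s : R => y + s *: w) (fun s => s *: w).
  by apply: is_diff_eq; apply/funext => s; rewrite !fctE add0r.
have dl' : differentiable (fun s : R => y + s *: w) t by [].
have dc : differentiable (f \o (fun s : R => y + s *: w)) t.
  exact: differentiable_comp.
apply: DeriveDef; first exact: diff_derivable.
rewrite (deriveE _ dc) diff_comp// deriveE//=.
by congr ('d f _ _); rewrite diff_val scale1r.
Qed.

Lemma mean_value_line f y w (h : R) : 0 <= h ->
  (forall t, 0 <= t <= h -> differentiable f (y + t *: w)) ->
  exists2 t, 0 <= t <= h & f (y + h *: w) - f y = h * 'D_w f (y + t *: w).
Proof.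
move=> h0 df.
have [||c] := @MVT_segment R (fun s => f (y + s *: w))
    (fun t => 'D_w f (y + t *: w)) 0 h h0.
- move=> t; rewrite in_itv /= => /andP[t0 th].
  by apply: is_derive_line; apply: df; rewrite !ltW.
- apply: derivable_within_continuous => t; rewrite in_itv /= => th.
  by have [] := is_derive_line (df t th).
rewrite in_itv /= => ch; rewrite scale0r addr0 subr0 mulrC => E.
by exists c.
Qed.

Lemma near_parallelogram x v w (P : set V) : nbhs x P ->
  exists2 r : R, 0 < r & forall s t, 0 <= s <= r -> 0 <= t <= r ->
    P (x + s *: v + t *: w).
Proof.
(* The summand 1 keeps [c] positive when both vectors are 0 and makes the final estimate strict. *)
move=> /nbhs_ballP[e /= e0 eP]; pose c := `|v| + `|w| + 1.
have c0 : 0 < c by rewrite ltr_wpDl// addr_ge0.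
exists (e / c); first by rewrite divr_gt0.
move=> s t /andP[s0 se] /andP[t0 te]; apply: eP.
rewrite -ball_normE /= -addrA opprD addNKr normrN.
apply: le_lt_trans (ler_normD _ _) _; rewrite !normrZ !ger0_norm//.
apply: (@le_lt_trans _ _ (e / c * (`|v| + `|w|))).
  by rewrite mulrDr lerD// ler_wpM2r.
by rewrite mulrAC ltr_pdivrMr// ltr_pM2l// /c ltrDl.
Qed.

(** Mean value theorem along [v] for the increment [g] of [f] along [w], then along [w] for the
    derivative D_v f. *)
Lemma second_difference f x v w (h : R) : 0 <= h ->
  (forall s t, 0 <= s <= h -> 0 <= t <= h ->
     differentiable f (x + s *: v + t *: w) /\
     differentiable (fun z => 'D_v f z : R^o) (x + s *: v + t *: w)) ->
  exists s t, [/\ 0 <= s <= h, 0 <= t <= h &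
    f (x + h *: v + h *: w) - f (x + h *: v) - (f (x + h *: w) - f x) =
    h * (h * 'D_w (fun z => 'D_v f z : R^o) (x + s *: v + t *: w))].
Proof.
move=> h0 df; have h00 : 0 <= (0 : R) <= h by rewrite lexx.
have hh : 0 <= h <= h by rewrite h0 lexx.
pose g z := f (z + h *: w) - f z : R^o.
have dT s : 0 <= s <= h -> differentiable (fun z => f (z + h *: w)) (x + s *: v).
  move=> sh; apply: (@differentiable_comp _ _ _ _ (fun z => z + h *: w) f).
    by apply: differentiableD.
  by have [] := df s h sh hh.
have dI s : 0 <= s <= h -> differentiable f (x + s *: v).
  by move=> sh; have [+ _] := df s 0 sh h00; rewrite scale0r addr0.
have dg s : 0 <= s <= h -> differentiable g (x + s *: v).
  by move=> sh; apply: differentiableB; [exact: dT|exact: dI].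
have [s sh gE] := mean_value_line h0 dg.
have [t th DE] := mean_value_line h0 (fun t th => (df s t sh th).2).
exists s, t; split=> //; rewrite -DE.
transitivity (g (x + h *: v) - g x).
  by [].
rewrite gE; congr (_ * _).
rewrite deriveE; last exact: dg.
have -> : g = (fun z => f (z + h *: w)) - f by [].
rewrite diffB; [|exact: dT|exact: dI].
rewrite !deriveE; [|exact: dI|by have [] := df s h sh hh].
congr (_ - _).
rewrite (_ : (fun z => f (z + h *: w)) = f \o (fun z => z + h *: w))//.
have dt : is_diff (x + s *: v) (fun z => z + h *: w) id.
  by apply: is_diff_eq; apply/funext => z; rewrite !fctE addr0.
rewrite diff_comp//; last by have [] := df s h sh hh.
by rewrite /= diff_val.
Qed.

(** The second difference of [f] is symmetric in [v] and [w]; evaluating it by [second_difference]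
    in both orders equates the two mixed derivatives at two nearby points. *)
Lemma mixed_derivatives_meet f x v w (h : R) : 0 < h ->
  (forall s t, 0 <= s <= h -> 0 <= t <= h ->
     differentiable f (x + s *: v + t *: w) /\
     differentiable (fun z => 'D_v f z : R^o) (x + s *: v + t *: w)) ->
  (forall s t, 0 <= s <= h -> 0 <= t <= h ->
     differentiable f (x + s *: w + t *: v) /\
     differentiable (fun z => 'D_w f z : R^o) (x + s *: w + t *: v)) ->
  exists s t s' t', [/\ 0 <= s <= h /\ 0 <= t <= h, 0 <= s' <= h /\ 0 <= t' <= h &
    'D_w (fun z => 'D_v f z : R^o) (x + s *: v + t *: w) =
    'D_v (fun z => 'D_w f z : R^o) (x + s' *: w + t' *: v)].
Proof.
move=> h0 dvw dwv.
have [s [t [sh th E]]] := second_difference (ltW h0) dvw.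
have [s' [t' [s'h t'h E']]] := second_difference (ltW h0) dwv.
exists s, t, s', t'; split; [by split|by split|].
have h0' := lt0r_neq0 h0.
apply: (mulf2_inj h0' E E').
have -> : x + h *: w + h *: v = x + h *: v + h *: w by exact: addrAC.
generalize (f (x + h *: v + h *: w)) (f (x + h *: v)) (f (x + h *: w)) (f x) => a b c d.
exact: subrBAC.
Qed.

End MeanValue.

Lemma dist_half (R : realFieldType) (e a b c d : R) :
  `|a - c| <= e / 2 -> `|b - d| <= e / 2 -> d = c -> `|a - b| <= e.
Proof.
move=> ac bd dc; rewrite -(subrKA c) (splitr e) (le_trans (ler_normD _ _))//.
by rewrite lerD// -dc distrC.
Qed.

(** By continuity, in a small parallelogram each mixed derivative is within [e / 2] of its value at
    [x]; the two agree at some pair of points there, so their values at [x] differ by at most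
    [e]. *)
Lemma derive_commute (R : realType) n (U : set 'rV[R]_n) (f : 'rV[R]_n -> R^o) x v w :
  open U -> U x -> Ck_on 2 U f ->
  'D_v (fun z => 'D_w f z : R^o) x = 'D_w (fun z => 'D_v f z : R^o) x.
Proof.
move=> oU Ux [df Df]; apply/eqP; rewrite -subr_eq0 -normr_eq0; apply/eqP/le_anti.
rewrite normr_ge0 andbT; apply/ler_addgt0Pl => e e0; rewrite addr0.
have cD a b : {for x, continuous (fun z => 'D_a (fun z => 'D_b f z : R^o) z : R^o)}.
  by have [_ /(_ a) cD] := Df b; exact: cD.
have nD a b : \forall y \near x, `|'D_a (fun z => 'D_b f z : R^o) x -
     'D_a (fun z => 'D_b f z : R^o) y| < e / 2.
  by have /cvgrPdist_lt := cD a b; apply; rewrite divr_gt0.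
have nU : nbhs x U by exact: open_nbhs_nbhs.
have nP := @filterI _ _ (nbhs_filter x) _ _ (@filterI _ _ (nbhs_filter x) _ _ nU (nD v w)) (nD w v).
have [r r0 rP] := near_parallelogram v w nP.
have [r' r'0 r'P] := near_parallelogram w v nP.
pose h := Num.min r r'; have h0 : 0 < h by rewrite lt_min r0 r'0.
have hr s : 0 <= s <= h -> 0 <= s <= r.
  by case/andP => -> sh; rewrite (le_trans sh)// ge_min lexx.
have hr' s : 0 <= s <= h -> 0 <= s <= r'.
  by case/andP => -> sh; rewrite (le_trans sh)// ge_min lexx orbT.
have [||s [t [s' [t' [[sh th] [s'h t'h] EE]]]]] := mixed_derivatives_meet (f := f) (x := x) (v := v) (w := w) h0.
- move=> s t /hr sr /hr tr; have [[Uy _] _] := rP s t sr tr.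
  by split; [exact: df|have [dD _] := Df v; exact: dD].
- move=> s' t' /hr' sr /hr' tr; have [[Uy _] _] := r'P s' t' sr tr.
  by split; [exact: df|have [dD _] := Df w; exact: dD].
have [[_ _] /ltW b1] := rP s t (hr _ sh) (hr _ th).
have [[_ /ltW b2] _] := r'P s' t' (hr' _ s'h) (hr' _ t'h).
exact: dist_half b2 b1 EE.
Qed.

(** * The inverse function theorem *)

Section RowNorm.
Variables (R : realType) (n : nat).
Implicit Types x y : 'rV[R]_n.

Lemma rV_norm_le x (e : R) : 0 <= e -> (forall j, `|x 0 j| <= e) -> `|x| <= e.
Proof.
move=> e0 xe; rewrite [leLHS]/Num.Def.normr/= mx_normrE; apply: bigmax_le => // -[i j] _ /=.
by rewrite ord1.
Qed.

Lemma rV_coord_le x j : `|x 0 j| <= `|x|.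
Proof.
rewrite [leRHS]/Num.Def.normr/= mx_normrE.
exact: (le_bigmax _ (fun ij : 'I_1 * 'I_n => `|x ij.1 ij.2|) (0, j)).
Qed.

End RowNorm.

Section Lipschitz.
Variables (R : realType) (n : nat).

Lemma ball_segment (a x y : 'rV[R]_n) (r t : R) : 0 <= t <= 1 ->
  ball a r x -> ball a r y -> ball a r (y + t *: (x - y)).
Proof.
move=> /andP[t0 t1]; rewrite -!ball_normE /= => xr yr.
have -> : a - (y + t *: (x - y)) = (1 - t) *: (a - y) + t *: (a - x).
  by apply/rowP => j; rewrite !mxE; ring.
apply: le_lt_trans (ler_normD _ _) _; rewrite !normrZ (ger0_norm t0) ger0_norm ?subr_ge0//.
have [->|tn0] := eqVneq t 0; first by rewrite mul0r addr0 subr0 mul1r.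
have -> : r = (1 - t) * r + t * r by rewrite -mulrDl subrK mul1r.
apply: ler_ltD; first by rewrite ler_wpM2l ?subr_ge0// ltW.
by rewrite ltr_pM2l// lt_neqAle eq_sym tn0.
Qed.

(** The norm is the maximum of the coordinates, so the mean value theorem is applied to each
    coordinate of [f]; the factor [n%:R] comes from summing the bound [c] over the [n] partial
    derivatives. *)
Lemma lipschitz_ball m (f : 'rV[R]_n -> 'rV[R]_m) a (r c : R) : 0 <= c ->
  (forall x, ball a r x -> differentiable f x) ->
  (forall x i j, ball a r x -> `|('D_(delta_mx 0 i) f x) 0 j| <= c) ->
  forall x y, ball a r x -> ball a r y -> `|f x - f y| <= n%:R * c * `|x - y|.
Proof.
move=> c0 df Df x y xr yr; apply: rV_norm_le; first by rewrite !mulr_ge0.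
move=> j; have dj z : ball a r z -> differentiable (fun z => f z 0 j : R^o) z.
  by move=> /df/differentiable_rVP.
have seg t : 0 <= t <= 1 -> ball a r (y + t *: (x - y)).
  by move=> t01; exact: ball_segment.
have [t t01] := mean_value_line ler01 (fun t t01 => dj _ (seg t t01)).
rewrite scale1r (addrC y) subrK mul1r !mxE => ->.
have dt := df _ (seg t t01).
rewrite -derive_coord; last exact: diff_derivable.
rewrite deriveE// diff_row_sum// summxE.
apply: le_trans (ler_norm_sum _ _ _) _.
apply: (@le_trans _ _ (\sum_(i < n) c * `|x - y|)); last first.
  by rewrite sumr_const card_ord -[leLHS]mulr_natl mulrA.
apply: ler_sum => i _; rewrite mxE normrM mulrC.
by apply: ler_pM => //; [exact: Df (seg t t01)|exact: rV_coord_le].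
Qed.

End Lipschitz.

Section MatrixSmooth.
Variables (R : realType) (p : nat).

Lemma Ck_on_det n k (U : set 'rV[R]_p) (M : 'rV[R]_p -> 'M[R]_n) : open U ->
  (forall i j, Ck_on k U (fun x => M x i j : R^o)) ->
  Ck_on k U (fun x => \det (M x) : R^o).
Proof.
move=> oU cM; apply: (@Ck_on_sum _ _ _ _ _ _ (index_enum _)
   (fun (s : 'S_n) x => (-1) ^+ s * \prod_i M x i (s i) : R^o)) => // s.
apply: Ck_onM => //; first exact: Ck_on_cst.
by apply: (@Ck_on_prod _ _ _ _ _ _ (fun i x => M x i (s i) : R^o)).
Qed.

(** Cramer's rule: the entries of the inverse are signed minors divided by the determinant, and
    determinants are polynomial in the entries. *)
Lemma Ck_on_invmx n k (U : set 'rV[R]_p) (M : 'rV[R]_p -> 'M[R]_n) i j : open U ->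
  (forall x, U x -> M x \in unitmx) ->
  (forall i j, Ck_on k U (fun x => M x i j : R^o)) ->
  Ck_on k U (fun x => invmx (M x) i j : R^o).
Proof.
move=> oU uM cM.
have cV : Ck_on k U (fun x => (\det (M x))^-1 : R^o).
  apply: (@Ck_onV _ _ _ _ (fun x => \det (M x) : R^o)) => //; last exact: Ck_on_det.
  by move=> x /uM; rewrite unitmxE unitfE.
have cA : Ck_on k U (fun x => \adj (M x) i j : R^o).
  rewrite (_ : (fun _ => _) = fun x => (-1) ^+ (j + i) *
      \det (row' j (col' i (M x))) : R^o); last first.
    by apply/funext => x; rewrite mxE.
  apply: Ck_onM => //; first exact: Ck_on_cst.
  apply: (@Ck_on_det _ _ _ (fun x => row' j (col' i (M x)))) => // i' j'.
  rewrite (_ : (fun _ => _) = fun x => M x (lift j i') (lift i j') : R^o)//.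
  by apply/funext => x; rewrite !mxE.
have := Ck_onM oU cV cA; apply: Ck_on_eq => // x Ux.
by rewrite /invmx uM// [RHS]mxE.
Qed.

End MatrixSmooth.

(** Joins completeness to the normed structure of matrices, as the Banach fixed point theorem in
    [local_surjectivity] requires. *)
HB.instance Definition _ (R : realType) m n := Complete.on 'M[R]_(m, n).

Section InverseFunction.
Variables (R : realType) (n : nat) (f : 'rV[R]_n -> 'rV[R]_n).
Variables (a : 'rV[R]_n) (r : R).
Hypotheses (r_gt0 : 0 < r).
Hypothesis f_smooth : smooth_on (ball a r) f.
(** With this bound [lipschitz_ball] gives f - id the Lipschitz constant n / (2 (n + 1)), at most
    1/2. Taking [n.+1] keeps the bound positive in dimension 0. *)
Hypothesis f_near_id : forall x i j, ball a r x ->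
  `|('D_(delta_mx 0 i) (fun y => f y - y) x) 0 j| <= (2 * n.+1%:R)^-1.

Let h (x : 'rV[R]_n) : 'rV[R]_n := f x - x.
(** Half the radius, so that the closed ball on which the fixed point argument runs stays inside the
    open ball where [f] is controlled. *)
Let rho : R := r / 2.

Let df x : ball a r x -> differentiable f x.
Proof. by have [+ _] := f_smooth 1; exact. Qed.

Let dh x : ball a r x -> differentiable h x.
Proof. by move=> /df dfx; exact: differentiableB. Qed.

Let cst_le : n%:R * (2 * n.+1%:R)^-1 <= 1 / 2 :> R.
Proof.
rewrite invfM mulrCA mul1r -[leRHS]mulr1 ler_pM2l ?invr_gt0//.
by rewrite ler_pdivrMr// mul1r ler_nat.
Qed.

Let h_lip x y : ball a r x -> ball a r y -> `|h x - h y| <= 1 / 2 * `|x - y|.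
Proof.
move=> xr yr; have c0 : 0 <= (2 * n.+1%:R)^-1 :> R by rewrite invr_ge0.
by apply: le_trans (lipschitz_ball c0 dh f_near_id xr yr) _; rewrite ler_wpM2r.
Qed.

(** Since x - y = (f x - f y) - (h x - h y) and [h] is 1/2-Lipschitz. This gives both the
    injectivity of [f] and the Lipschitz bound 2 for its inverse. *)
Lemma expansive x y : ball a r x -> ball a r y -> `|x - y| <= 2 * `|f x - f y|.
Proof.
move=> xr yr; have := h_lip xr yr.
have xyE : x - y = (f x - f y) - (h x - h y).
  by apply/rowP => j; rewrite !mxE; ring.
move=> hxy; have : `|x - y| <= `|f x - f y| + 1 / 2 * `|x - y|.
  by rewrite {1}xyE (le_trans (ler_normB _ _))// lerD2l.
by rewrite -lerBlDr mul1r -[X in X - _]mul1r -mulrBl {1}(splitr 1) mul1r addrK ler_pdivrMl//.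
Qed.

(** The radius leaves room for the Lipschitz estimate: for y in [W], the map x |-> y - h x moves the
    closed ball of radius [rho] by less than rho / 2 + rho / 2 from its centre. *)
Let W := ball (f a) (rho / 2).
Let V := ball a rho `&` f @^-1` W.

Let rho_gt0 : 0 < rho. Proof. exact: divr_gt0. Qed.

Let rho_lt : rho < r. Proof. by rewrite /rho ltr_pdivrMr// mulr_natr mulr2n ltrDl. Qed.

Let ball_rho x : ball a rho x -> ball a r x.
Proof. by rewrite -!ball_normE /= => /lt_trans; apply. Qed.

Let closed_ball_r x : `|a - x| <= rho -> ball a r x.
Proof. by rewrite -!ball_normE /= => /le_lt_trans; apply. Qed.

(** The solutions of f x = y are the fixed points of x |-> y - h x, a contraction of the closed ball
    [B]. Its values lie in the open ball, hence so does the fixed point. *)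
Lemma local_surjectivity y : W y -> exists2 x, ball a rho x & f x = y.
Proof.
rewrite /W -ball_normE /= => yW.
pose B : set 'rV[R]_n := [set x | `|a - x| <= rho].
pose g x := y - h x.
have gB x : B x -> `|a - g x| < rho.
  move=> Bx; have -> : a - g x = (f a - y) - (h a - h x).
    by apply/rowP => j; rewrite !mxE; ring.
  apply: le_lt_trans (ler_normB _ _) _; rewrite (splitr rho).
  apply: ltr_leD => //; apply: le_trans (h_lip _ _) _; first exact: ballxx.
    exact: closed_ball_r.
  by rewrite mul1r mulrC ler_wpM2r.
have gBB : {homo g : x / B x >-> B x} by move=> x /gB /ltW.
pose G : {fun B >-> B} := mkfun_fun gBB.
have cG : is_contraction G.
  exists (1 / 2)%:nng; split.
    by rewrite /= ltr_pdivrMr// mul1r ltr1n.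
  move=> [x x'] [/= Bx Bx']; rewrite /= /mkfun /g.
  have -> : y - h x - (y - h x') = - (h x - h x').
    by apply/rowP => j; rewrite !mxE; ring.
  rewrite normrN.
  exact: h_lip (closed_ball_r Bx) (closed_ball_r Bx').
have cB : closed B.
  rewrite (_ : B = closed_ball a rho); first exact: closed_ball_closed.
  by rewrite closed_ballE.
have [|x Bx xE] := banach_fixed_point cG cB.
  by exists a; rewrite /B /= subrr normr0 ltW.
have xg : x = g x by exact: xE.
exists x; first by rewrite [X in a - X]xg; exact: gB.
by rewrite -[LHS](subrK x) [X in _ + X]xg /g addrC subrK.
Qed.

Definition local_inverse (y : 'rV[R]_n) : 'rV[R]_n :=
  xget a [set x | ball a rho x /\ f x = y].

Lemma local_inverseP y : W y ->
  ball a rho (local_inverse y) /\ f (local_inverse y) = y.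
Proof.
move=> /local_surjectivity[x xr xy]; rewrite /local_inverse.
by case: xgetP => [z -> //|/(_ x)]; case.
Qed.

Lemma local_inverseK x : V x -> local_inverse (f x) = x.
Proof.
move=> [xr Wx]; have [gr gE] := local_inverseP Wx.
apply/eqP; rewrite -subr_eq0 -normr_le0.
by rewrite (le_trans (expansive (ball_rho gr) (ball_rho xr)))// gE subrr normr0 mulr0.
Qed.

Lemma local_dom_open : open V.
Proof.
rewrite openE => x [xr Wx]; apply: filterI.
  by apply: open_nbhs_nbhs; split=> //; exact: ball_open.
apply: (differentiable_continuous (df (ball_rho xr))).
by apply: open_nbhs_nbhs; split=> //; exact: ball_open.
Qed.

Lemma jacobianE x u : ball a r x -> u *m 'J f x = 'D_u f x.
Proof. by move=> xr; rewrite derivemxE//; exact: df. Qed.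

(** A vector [u] killed by the Jacobian satisfies D_u h = - u, while the partial derivatives of [h]
    are small enough for |D_u h| to be at most |u| / 2. *)
Lemma jacobian_unit x : ball a r x -> 'J f x \in unitmx.
Proof.
move=> xr; rewrite -row_free_unit -kermx_eq0; apply/eqP/row_matrixP => i.
rewrite row0; apply/eqP; rewrite -normr_le0.
have : row i (kermx ('J f x)) *m 'J f x = 0.
  by rewrite -row_mul mulmx_ker row0.
set u := row _ _; rewrite jacobianE// => Du.
have Dh : 'D_u h x = - u.
  have -> : h = f - id by [].
  rewrite deriveB ?Du ?derive_id ?sub0r//; apply: diff_derivable; exact: df.
have uE : `|u| <= 1 / 2 * `|u|.
  rewrite -[leLHS]normrN -Dh deriveE; last exact: dh.
  rewrite diff_row_sum; last exact: dh.
  apply: rV_norm_le => [|j]; first by rewrite mulr_ge0.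
  rewrite summxE; apply: le_trans (ler_norm_sum _ _ _) _.
  apply: (@le_trans _ _ (\sum_(k < n) (2 * n.+1%:R)^-1 * `|u|)); last first.
    by rewrite sumr_const card_ord -[leLHS]mulr_natl mulrA ler_wpM2r.
  apply: ler_sum => k _; rewrite mxE normrM mulrC.
  by apply: ler_pM => //; [exact: f_near_id|exact: rV_coord_le].
by move: uE; move: `|u| => N; lra.
Qed.

(** For an increment [k] of [y] and the resulting increment [l] of the inverse, l - k J^-1 = - (k -
    l J) J^-1. Differentiability of [f] makes k - l J small against [l], and [expansive] bounds [l]
    by 2 |k|. *)
Lemma local_inverse_differentiable y : W y ->
  differentiable local_inverse y /\
  'd local_inverse y = mulmxr (invmx ('J f (local_inverse y))) :> (_ -> _).
Proof.
move=> Wy; have [xr xE] := local_inverseP Wy; set x := local_inverse y in xr xE *.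
have uJ := jacobian_unit (ball_rho xr); set J := 'J f x in uJ *.
have cJ := @continuous_mulmxr R _ _ (invmx J).
have [C C0 CP] := @linear_lipschitz _ _ _ (mulmxr (invmx J)) cJ.
apply: differentiable_normP => // e e0.
(* The denominator absorbs the Lipschitz constant [C] of the inverse Jacobian and the factor 2
   between [l] and [k]. *)
have e'0 : 0 < e / (2 * C) by rewrite divr_gt0// mulr_gt0.
have /nbhs_ballP[d /= d0 dP] := differentiable_norm (df (ball_rho xr)) e'0.
have nW : \forall z \near y, W z by apply: open_nbhs_nbhs; split=> //; exact: ball_open.
have nW' : \forall k \near (0 : 'rV[R]_n), W (k + y).
  by move: nW; rewrite (near_shift 0 y) /= subr0.
have nd : \forall k \near (0 : 'rV[R]_n), ball 0 (d / 2) k.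
  by apply: nbhsx_ballx; rewrite divr_gt0.
apply: filterS2 nW' nd => k Wk kd; set l := local_inverse (k + y) - x.
have [x'r x'E] := local_inverseP Wk.
have lk : `|l| <= 2 * `|k|.
  apply: le_trans (expansive (ball_rho x'r) (ball_rho xr)) _.
  by rewrite x'E xE addrK.
have ld : ball 0 d l.
  move: kd; rewrite -!ball_normE /= !sub0r !normrN => kd.
  by rewrite (le_lt_trans lk)// mulrC -ltr_pdivlMr.
have := dP l ld; rewrite subrK x'E xE addrK -deriveE; last exact: df (ball_rho xr).
rewrite -jacobianE; last exact: ball_rho. 
rewrite -/J => kl.
have -> : l - mulmxr (invmx J) k = mulmxr (invmx J) (- (k - l *m J)).
  by rewrite /= mulNmx mulmxBl opprB -mulmxA mulmxV// mulmx1.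
apply: le_trans (CP _) _; rewrite normrN -ler_pdivlMl//.
apply: (le_trans kl); apply: (@le_trans _ _ (e / (2 * C) * (2 * `|k|))).
  by rewrite ler_wpM2l// ltW.
rewrite [leLHS](_ : _ = C^-1 * (e * `|k|))//.
by field; rewrite gt_eqF.
Qed.

(** Bootstrap: the derivative of the inverse is the inverse Jacobian of [f] composed with the
    inverse itself, so if the inverse is C^k then its derivative is C^k. *)
Lemma local_inverse_smooth : smooth_on W local_inverse.
Proof.
have oW : open W by exact: ball_open.
have dg y : W y -> differentiable local_inverse y.
  by move=> /local_inverse_differentiable[].
elim=> [|k IH]; first by move=> y /dg/differentiable_continuous.
split=> // v; apply/Ck_on_rVP => // j.
pose M y := 'J f (local_inverse y).
have WB y : W y -> ball a r (local_inverse y) by move=> /local_inverseP[/ball_rho].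
have uM y : W y -> M y \in unitmx by move=> /WB/jacobian_unit.
have cM i i' : Ck_on k W (fun y => M y i i' : R^o).
  have [_ /(_ (delta_mx 0 i)) Df] := f_smooth k.+1.
  have /Ck_on_rVP/(_ i') := Ck_on_comp oW (ball_open a r) WB Df IH.
  move=> /(_ oW); apply: Ck_on_eq => // y Wy.
  by rewrite /= -jacobianE; [rewrite -rowE mxE|exact: WB].
have := Ck_on_sum (index_enum 'I_n) oW (fun i =>
   Ck_onM oW (Ck_on_cst k W (v 0 i : R^o)) (Ck_on_invmx i j oW uM cM)).
apply: Ck_on_eq => // y Wy; have [d dE] := local_inverse_differentiable Wy.
by rewrite deriveE// dE /= mxE.
Qed.

End InverseFunction.

Lemma smooth_on_id (R : realType) n (U : set 'rV[R]_n) : smooth_on U id.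
Proof. by apply: (@smooth_on_linear _ _ _ idfun) => x. Qed.

Lemma inverse_function_id (R : realType) n (f : 'rV[R]_n -> 'rV[R]_n) U a :
  open U -> U a -> smooth_on U f -> (forall v, 'D_v f a = v) ->
  exists V W g, [/\ open V, V a, V `<=` U, open W & smooth_on W g] /\
    [/\ forall x, V x -> W (f x), forall y, W y -> V (g y),
        forall x, V x -> g (f x) = x & forall y, W y -> f (g y) = y].
Proof.
move=> oU Ua sf Df; pose h y := f y - y.
have sh : smooth_on U h.
  move=> k; have := Ck_onD oU (sf k) (Ck_onZ (-1) oU (@smooth_on_id _ _ U k)).
  by apply: Ck_on_eq => // x _; rewrite /h scaleN1r.
have Dh v : 'D_v h a = 0.
  have -> : h = f - id by [].
  have [df _] := sf 1.
  rewrite deriveB ?Df ?derive_id ?subrr//; apply: diff_derivable; exact: df.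
have c0 : 0 < (2 * n.+1%:R)^-1 :> R by rewrite invr_gt0 mulr_gt0.
have nD : \forall x \near a, forall i j,
    `|('D_(delta_mx 0 i) h x) 0 j| <= (2 * n.+1%:R)^-1.
  apply: (@filter_forall _ _ _ _ (nbhs_filter a)) => i.
  apply: (@filter_forall _ _ _ _ (nbhs_filter a)) => j.
  have [_ /(_ (delta_mx 0 i))/= cD] := sh 1.
  have /continuous_rVP/(_ j)/cvgrPdist_lt/(_ _ c0) := cD _ Ua.
  apply: (@filterS _ _ (nbhs_filter a)) => x; rewrite Dh mxE sub0r normrN.
  exact: ltW.
have nU : \forall x \near a, U x by exact: open_nbhs_nbhs.
have /nbhs_ballP[r /= r0 rP] := @filterI _ _ (nbhs_filter a) _ _ nU nD.
have sfr : smooth_on (ball a r) f.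
  by move=> k; apply: Ck_on_sub (sf k) => x /rP[].
have near x i j (xr : ball a r x) := (rP x xr).2 i j.
exists (ball a (r / 2) `&` f @^-1` ball (f a) (r / 2 / 2)), (ball (f a) (r / 2 / 2)),
  (local_inverse f a r); split; split.
- exact: local_dom_open.
- by split; apply: ballxx; rewrite !divr_gt0.
- move=> x [xr _]; suff /rP[] : ball a r x by [].
  by move: xr; rewrite -!ball_normE /= => /lt_le_trans; apply; move: r0; lra.
- exact: ball_open.
- exact: local_inverse_smooth.
- by move=> x [].
- move=> y yW; have [gr gE] := local_inverseP r0 sfr near yW.
  by split=> //=; rewrite gE.
- exact: local_inverseK.
- by move=> y yW; have [] := local_inverseP r0 sfr near yW.
Qed.

Lemma smooth_on_mulmxr (R : realType) n m (A : 'M[R]_(n, m)) U :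
  smooth_on U (fun u : 'rV[R]_n => u *m A).
Proof. by apply: (@smooth_on_linear _ _ _ (mulmxr A)); exact: continuous_mulmxr. Qed.

Lemma derive_mulmxr (R : realType) n m (A : 'M[R]_(n, m)) (u v : 'rV[R]_n) :
  'D_v (mulmxr A) u = v *m A.
Proof.
have cA := @continuous_mulmxr R _ _ A.
by rewrite deriveE ?diff_lin//; exact: linear_differentiable.
Qed.

Lemma open_preimage (T1 T2 : topologicalType) (f : T1 -> T2) (A : set T2) :
  continuous f -> open A -> open (f @^-1` A).
Proof. by move=> /continuousP cf /cf. Qed.

(** The dimensions [m] and [n] are kept formally different because [submersion_chart] has target
    dimension l + (m - l), equal to m only by a proof. Composing with [B] reduces to a map of one
    space with identity derivative. *)
Theorem inverse_function (R : realType) m n (f : 'rV[R]_m -> 'rV[R]_n)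
    (A : 'M[R]_(m, n)) (B : 'M[R]_(n, m)) U a :
  open U -> U a -> smooth_on U f -> A *m B = 1%:M -> B *m A = 1%:M ->
  (forall v, 'D_v f a = v *m A) ->
  exists V W g, [/\ open V, V a, V `<=` U, open W & smooth_on W g] /\
    [/\ forall x, V x -> W (f x), forall y, W y -> V (g y),
        forall x, V x -> g (f x) = x & forall y, W y -> f (g y) = y].
Proof.
move=> oU Ua sf AB BA Df; pose f' (y : 'rV[R]_n) := f (y *m B).
have abK : a *m A *m B = a by rewrite -mulmxA AB mulmx1.
pose U' := (mulmxr B) @^-1` U.
have oU' : open U' by apply: open_preimage => //; exact: continuous_mulmxr.
have U'a : U' (a *m A) by rewrite /U' /= abK.
have sf' : smooth_on U' f'.
  move=> k; apply: (@Ck_on_comp _ _ _ _ k U' U f (mulmxr B)) => //.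
  exact: smooth_on_mulmxr.
have Df' v : 'D_v f' (a *m A) = v.
  have [df _] := sf 1.
  have -> : f' = f \o mulmxr B by [].
  rewrite derive_comp; last by rewrite /= abK; exact: df.
    by rewrite derive_mulmxr /= abK Df -mulmxA BA mulmx1.
  by apply: linear_differentiable; exact: continuous_mulmxr.
have [V' [W [g [[oV' V'a V'U' oW sg] [fW gV gK fK]]]]] :=
  inverse_function_id oU' U'a sf' Df'.
have xK (x : 'rV[R]_m) : x *m A *m B = x by rewrite -mulmxA AB mulmx1.
exists (mulmxr A @^-1` V'), W, (fun y => g y *m B); split; split=> //.
- by apply: open_preimage => //; exact: continuous_mulmxr.
- by move=> x /V'U'; rewrite /U' /= xK.
- move=> k; apply: (@Ck_on_comp _ _ _ _ k W setT (mulmxr B) g) => //.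
  exact: openT. exact: smooth_on_mulmxr.
- by move=> x /fW; rewrite /f' /= xK.
- by move=> y /gV; rewrite /= -mulmxA BA mulmx1.
- by move=> x V'x; have := gK _ V'x; rewrite /f' /= xK => ->; exact: xK.
Qed.

Section RowBlocks.
Variables (R : realType) (p n m : nat).
Implicit Types U : set 'rV[R]_p.

Lemma Ck_on_row_mx k U (f : 'rV[R]_p -> 'rV[R]_n) (g : 'rV[R]_p -> 'rV[R]_m) :
  open U -> Ck_on k U f -> Ck_on k U g -> Ck_on k U (fun x => row_mx (f x) (g x)).
Proof.
move=> oU /(Ck_on_rVP k f oU) cf /(Ck_on_rVP k g oU) cg; apply/Ck_on_rVP => // j.
case: (split_ordP j) => i ->.
  by rewrite (_ : (fun _ => _) = (fun x => f x 0 i : R^o))//; apply/funext => x; rewrite row_mxEl.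
by rewrite (_ : (fun _ => _) = (fun x => g x 0 i : R^o))//; apply/funext => x; rewrite row_mxEr.
Qed.

Lemma derive_row_mx (f : 'rV[R]_p -> 'rV[R]_n) (g : 'rV[R]_p -> 'rV[R]_m) x v :
  derivable f x v -> derivable g x v ->
  'D_v (fun x => row_mx (f x) (g x)) x = row_mx ('D_v f x) ('D_v g x).
Proof.
move=> df dg; have df' i : derivable (fun x => f x 0 i : R^o) x v.
  by have /derivable_mxP := df; apply.
have dg' i : derivable (fun x => g x 0 i : R^o) x v.
  by have /derivable_mxP := dg; apply.
have dfg : derivable (fun x => row_mx (f x) (g x)) x v.
  apply/derivable_mxP => i j; rewrite ord1; case: (split_ordP j) => j' ->.
    by rewrite (_ : (fun _ => _) = (fun x => f x 0 j' : R^o))//; apply/funext => y; rewrite row_mxEl.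
  by rewrite (_ : (fun _ => _) = (fun x => g x 0 j' : R^o))//; apply/funext => y; rewrite row_mxEr.
apply/rowP => j; rewrite derive_coord//; case: (split_ordP j) => i ->.
  rewrite row_mxEl derive_coord//; congr ('D_v _ x).
  by apply/funext => y; rewrite row_mxEl.
rewrite row_mxEr derive_coord//; congr ('D_v _ x).
by apply/funext => y; rewrite row_mxEr.
Qed.

End RowBlocks.

(** * Local normal form of submersions *)

Section SubmersionChart.
Variables (R : realType).

(** Completes [A] to an invertible matrix. Gaussian elimination writes [A] as L times a truncated
    identity times E; the missing columns of that identity, multiplied by L, serve as [P]. *)
Lemma row_full_complement m l (A : 'M[R]_(m, l)) : row_full A ->
  exists (P : 'M[R]_(m, m - l)) (Q : 'M[R]_(l + (m - l), m)),
    row_mx A P *m Q = 1%:M /\ Q *m row_mx A P = 1%:M.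
Proof.
move=> fA; have rA : \rank A = l by exact/eqP.
have lm : (l <= m)%N by rewrite -rA rank_leq_row.
have lmE : (l + (m - l))%N = m by rewrite subnKC.
(* [N] and [N'] act as identity matrices between the formally distinct sizes [m] and
   [l + (m - l)]. *)
pose N := pid_mx m : 'M[R]_(m, l + (m - l)).
pose N' := pid_mx m : 'M[R]_(l + (m - l), m).
have NN' : N *m N' = 1%:M by rewrite mul_pid_mx lmE !minnn pid_mx_1.
have N'N : N' *m N = 1%:M.
  rewrite mul_pid_mx !minnn; apply/matrixP => i j; rewrite !mxE.
  suff -> : (i < m)%N by rewrite andbT.
  by rewrite -[X in (_ < X)%N]lmE ltn_ord.
have lN : lsubmx N = pid_mx l.
  apply/matrixP => i j; rewrite !mxE /= (ltn_ord i) andbT.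
  by have [ij|//] := eqVneq (i : nat) j; rewrite ij ltn_ord.
pose L := col_ebase A; pose E := row_ebase A.
have uL : L \in unitmx by exact: col_ebase_unit.
have uE : E \in unitmx by exact: row_ebase_unit.
pose D := block_mx E 0 0 (1%:M : 'M[R]_(m - l)).
pose D' := block_mx (invmx E) 0 0 (1%:M : 'M[R]_(m - l)).
have DD' : D *m D' = 1%:M.
  by rewrite mulmx_block !mulmx0 !mul0mx !addr0 add0r mulmx1 mulmxV// -scalar_mx_block.
have D'D : D' *m D = 1%:M.
  by rewrite mulmx_block !mulmx0 !mul0mx !addr0 add0r mulmx1 mulVmx// -scalar_mx_block.
exists (L *m rsubmx N), (D' *m N' *m invmx L).
have -> : row_mx A (L *m rsubmx N) = L *m N *m D.
  rewrite -(mulmx_ebase A) -/L -/E rA -lN -[in RHS](hsubmxK N) mul_mx_row.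
  by rewrite mul_row_block !mulmx0 addr0 add0r mulmx1.
split.
  by rewrite !mulmxA -(mulmxA _ D) DD' mulmx1 -(mulmxA L) NN' mulmx1 mulmxV.
by rewrite !mulmxA -(mulmxA _ (invmx L)) mulVmx// mulmx1 -(mulmxA D') N'N mulmx1 D'D.
Qed.

(** Adjoining to [F] linear coordinates x |-> x P that complete its derivative gives a map with
    invertible derivative. In the resulting coordinates [F] is the projection onto the first [l] of
    them. *)
Theorem submersion_chart m l (F : 'rV[R]_m -> 'rV[R]_l) U a :
  open U -> U a -> smooth_on U F -> (forall w, exists v, 'D_v F a = w) ->
  exists V W (G : 'rV[R]_m -> 'rV[R]_(l + (m - l))) H,
    [/\ [/\ open V, V a & V `<=` U], open W, smooth_on V G & smooth_on W H] /\
    [/\ forall x, V x -> W (G x), forall y, W y -> V (H y),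
        forall x, V x -> H (G x) = x, forall y, W y -> G (H y) = y &
        forall x, lsubmx (G x) = F x].
Proof.
move=> oU Ua sF DF; have dF : differentiable F a by have [df _] := sF 1; exact: df.
pose A := 'J F a; have AE v : v *m A = 'D_v F a by rewrite derivemxE.
have fA : row_full A.
  rewrite -sub1mx; apply/row_subP => i; have [v vE] := DF (row i 1%:M).
  by rewrite -vE -AE submxMl.
have [P [Q [AQ QA]]] := row_full_complement fA.
pose G x := row_mx (F x) (x *m P).
have sG : smooth_on U G by move=> k; apply: Ck_on_row_mx => //; exact: smooth_on_mulmxr.
have DG v : 'D_v G a = v *m row_mx A P.
  have dP : differentiable (mulmxr P) a.
    by apply: linear_differentiable; exact: continuous_mulmxr.
  rewrite derive_row_mx; [|exact: diff_derivable|exact: diff_derivable].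
  by rewrite derive_mulmxr mul_mx_row AE.
have [V [W [H [[oV Va VU oW sH] [GW HV GK HK]]]]] := inverse_function oU Ua sG AQ QA DG.
exists V, W, G, H; split; split=> //.
  by move=> k; apply: Ck_on_sub (sG k).
by move=> x; rewrite row_mxKl.
Qed.

End SubmersionChart.

(** * Smooth maps in charts *)

Section Topology.
Variables (T1 T2 : topologicalType).
Implicit Types (f : T1 -> T2) (A : set T1).

Lemma within_continuousP A f : {within A, continuous f} <->
  forall x, A x -> forall B, nbhs (f x) B ->
    exists2 Q, open_nbhs x Q & forall y, A y -> Q y -> B (f y).
Proof.
split=> [cf x Ax B nB|H].
  have := (subspace_continuousP _ _).1 cf x Ax B nB.
  rewrite nbhs_simpl /= /within /= nbhsE.
  by case=> Q Ox OB; exists Q => // y Ay Oy; exact: OB.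
apply/subspace_continuousP => x Ax B nB; rewrite nbhs_simpl /=.
have [Q Ox OB] := H x Ax B nB; rewrite /within /= nbhsE; exists Q => // y Oy Ay; exact: OB.
Qed.

Lemma open_preimage_in A f (B : set T2) : open A ->
  {within A, continuous f} -> open B -> open (A `&` f @^-1` B).
Proof.
move=> oA /within_continuousP cf oB; rewrite openE => x [Ax Bfx].
have [|Q Ox OB] := cf x Ax B; first exact: open_nbhs_nbhs.
apply: (@filterS2 _ _ (nbhs_filter x) A Q) => [y Ay Oy||].
- by split=> //; exact: OB.
- exact: open_nbhs_nbhs.
- exact: open_nbhs_nbhs.
Qed.

(** Charts are continuous only within the carrier, while chart domains are open in the ambient
    space. The union of all open sets whose trace on [A] goes into [B] provides the ambient set. *)
Lemma open_trace A f (B : set T2) : {within A, continuous f} -> open B ->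
  exists2 Q, open Q & forall x, A x -> Q x <-> B (f x).
Proof.
move=> /within_continuousP cf oB.
exists (\bigcup_(Q in [set Q | open Q /\ forall y, A y -> Q y -> B (f y)]) Q).
  by apply: bigcup_open => Q [].
move=> x Ax; split=> [[Q [_ +] Ox]|Bfx]; first exact.
have [|Q [oO Ox] OB] := cf x Ax B; first exact: open_nbhs_nbhs.
by exists Q.
Qed.

End Topology.

Lemma smooth_within (R : realType) n m (U : set 'rV[R]_n) (f : 'rV[R]_n -> 'rV[R]_m) :
  smooth_on U f -> {within U, continuous f}.
Proof.
move=> sf; apply/within_continuousP => x Ux B nB.
have := sf 0 x Ux B nB; rewrite nbhs_simpl /= nbhsE => -[Q Ox OB].
by exists Q => // y _ /OB.
Qed.

Lemma open_smooth_preimage (R : realType) n m (U : set 'rV[R]_n)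
    (f : 'rV[R]_n -> 'rV[R]_m) V :
  open U -> smooth_on U f -> open V -> open (U `&` f @^-1` V).
Proof. by move=> oU /smooth_within cf; exact: open_preimage_in. Qed.

Lemma smooth_on_sub (R : realType) n (W : normedModType R) (U V : set 'rV[R]_n)
    (f : 'rV[R]_n -> W) : V `<=` U -> smooth_on U f -> smooth_on V f.
Proof. by move=> VU sf k; apply: Ck_on_sub (sf k). Qed.

Lemma smooth_on_eq (R : realType) n (W : normedModType R) (U : set 'rV[R]_n)
    (f g : 'rV[R]_n -> W) :
  open U -> (forall x, U x -> f x = g x) -> smooth_on U f -> smooth_on U g.
Proof. by move=> oU fg sf k; apply: Ck_on_eq (sf k). Qed.

Lemma smooth_on_local (R : realType) n (W : normedModType R) (U : set 'rV[R]_n)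
    (f : 'rV[R]_n -> W) :
  (forall x, U x -> exists2 V, V x & smooth_on V f) -> smooth_on U f.
Proof. by move=> fU k; apply: Ck_on_local => x /fU[V Vx /(_ k)]; exists V. Qed.

Lemma smooth_on_comp (R : realType) n m l (U : set 'rV[R]_n) (V : set 'rV[R]_m)
    (f : 'rV[R]_m -> 'rV[R]_l) (g : 'rV[R]_n -> 'rV[R]_m) :
  open U -> open V -> (forall x, U x -> V (g x)) ->
  smooth_on V f -> smooth_on U g -> smooth_on U (f \o g).
Proof. by move=> oU oV UV sf sg k; exact: Ck_on_comp oU oV UV (sf k) (sg k). Qed.

Lemma smooth_on_cst (R : realType) n (W : normedModType R) (U : set 'rV[R]_n)
    (a : W) : smooth_on U (cst a).
Proof. by move=> k; exact: Ck_on_cst. Qed.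

Lemma smooth_on_differentiable (R : realType) n (W : normedModType R)
    (U : set 'rV[R]_n) (f : 'rV[R]_n -> W) x :
  smooth_on U f -> U x -> differentiable f x.
Proof. by move=> sf; have [df _] := sf 1; exact: df. Qed.

Section Atlas.
Variable R : realType.
Implicit Types M N L : premanifold R.

(* [is_manifold] without its global topological axioms, which are not needed for
   the calculus and would have to be checked for every open subset *)
Record has_atlas M : Prop := HasAtlas {
  atlas_chart : forall x : M, carrier x -> is_chart (@carrier R M) (chart_at x);
  atlas_mem : forall x : M, carrier x -> cdom (chart_at x) x;
  atlas_transition : forall x y : M, carrier x -> carrier y ->
    smooth_on
      (cmap (chart_at x) @`
         (@carrier R M `&` (cdom (chart_at x) `&` cdom (chart_at y))))
      (fun u => cmap (chart_at y) (cinv (chart_at x) u)) }.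

Lemma manifold_atlas M : is_manifold M -> has_atlas M.
Proof. by case. Qed.

Section OneManifold.
Variables (M : premanifold R) (hM : has_atlas M).
Implicit Types x y : M.

Lemma open_coord_img x : carrier x -> open (coord_img x).
Proof. by move=> /(atlas_chart hM)/chart_img_open. Qed.

Lemma open_chart_dom x : carrier x -> open (cdom (chart_at x)).
Proof. by move=> /(atlas_chart hM)/chart_dom_open. Qed.

Lemma coord_imgP x u : carrier x -> coord_img x u ->
  [/\ carrier (cinv (chart_at x) u), cdom (chart_at x) (cinv (chart_at x) u) &
      cmap (chart_at x) (cinv (chart_at x) u) = u].
Proof.
move=> cx [y [cy dy] <-]; have := chart_cancel (atlas_chart hM cx) cy dy.
by move=> ->.
Qed.

Lemma cmapK x y : carrier x -> carrier y -> cdom (chart_at x) y ->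
  cinv (chart_at x) (cmap (chart_at x) y) = y.
Proof. by move=> cx; exact: chart_cancel (atlas_chart hM cx) y. Qed.

Lemma coord_img_cmap x y : carrier y -> cdom (chart_at x) y ->
  coord_img x (cmap (chart_at x) y).
Proof. by move=> cy dy; exists y. Qed.

Lemma coord_img_pt x : carrier x -> coord_img x (coord_pt x).
Proof. by move=> cx; apply: coord_img_cmap => //; exact: atlas_mem. Qed.

Lemma coord_ptK x : carrier x -> cinv (chart_at x) (coord_pt x) = x.
Proof. by move=> cx; rewrite cmapK//; exact: atlas_mem. Qed.

Lemma open_cinv_preimage x (Q : set M) : carrier x -> open Q ->
  open (coord_img x `&` cinv (chart_at x) @^-1` Q).
Proof.
move=> cx oO; apply: open_preimage_in => //; first exact: open_coord_img.
exact: chart_inv_continuous (atlas_chart hM cx).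
Qed.

Lemma open_cmap_preimage x (V : set 'rV[R]_(mdim M)) : carrier x -> open V ->
  exists2 Q : set M, open Q & forall y, carrier y ->
    Q y <-> cdom (chart_at x) y /\ V (cmap (chart_at x) y).
Proof.
move=> cx oV.
have [Q oO OP] := open_trace (chart_continuous (atlas_chart hM cx)) oV.
exists (Q `&` cdom (chart_at x)).
  by apply: openI => //; exact: chart_dom_open (atlas_chart hM cx).
by move=> y cy; split=> [[Oy dy]|[dy Vy]]; split=> //; apply/OP.
Qed.

Lemma transition_domE x y : carrier x ->
  cmap (chart_at x) @`
    (@carrier R M `&` (cdom (chart_at x) `&` cdom (chart_at y))) =
  coord_img x `&` cinv (chart_at x) @^-1` cdom (chart_at y).
Proof.
move=> cx; apply/seteqP; split=> [u [z [cz [dz dz']] <-]|u [iu du]].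
  by split; [exists z|rewrite /= cmapK].
have [cu du' uE] := coord_imgP cx iu.
by exists (cinv (chart_at x) u).
Qed.

Lemma smooth_transition x y : carrier x -> carrier y ->
  smooth_on (coord_img x `&` cinv (chart_at x) @^-1` cdom (chart_at y))
    (fun u => cmap (chart_at y) (cinv (chart_at x) u)).
Proof. by move=> cx cy; rewrite -transition_domE//; exact: atlas_transition. Qed.

End OneManifold.

Section SmoothMaps.
Variables (M N : premanifold R) (hM : has_atlas M) (hN : has_atlas N).
Implicit Types (f : M -> N) (x : M).

Lemma smooth_carrier f x : smooth_map f -> carrier x -> carrier (f x).
Proof. by move=> sf /sf[]. Qed.

Lemma smooth_map_continuous f x (Q : set N) : smooth_map f -> carrier x ->
  open Q -> Q (f x) ->
  exists2 Q' : set M, open_nbhs x Q' & forall y, carrier y -> Q' y -> Q (f y).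
Proof.
move=> sf cx oO Ofx; have [cfx [U [oU Ux UI Ud sU]]] := sf x cx.
pose V := coord_img (f x) `&` cinv (chart_at (f x)) @^-1` Q.
have oV : open V by exact: open_cinv_preimage.
have oW := open_smooth_preimage oU sU oV.
have [Q' oO' Q'P] := open_cmap_preimage hM cx oW.
have Vx : V (local_rep f x (coord_pt x)).
  rewrite /local_rep coord_ptK//; split; first exact: coord_img_pt.
  by rewrite /preimage /= coord_ptK.
exists Q'.
  by split=> //; apply/Q'P => //; split; [exact: atlas_mem|].
move=> y cy /Q'P -/(_ cy)[dy [Uy [_]]]; rewrite /preimage /local_rep /=.
have := Ud _ Uy; rewrite (cmapK hM cx cy dy) => dfy.
by rewrite cmapK//; exact: smooth_carrier.
Qed.

Lemma open_rep_dom f x (Q : set N) : smooth_map f -> carrier x -> open Q ->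
  open (coord_img x `&` (f \o cinv (chart_at x)) @^-1` Q).
Proof.
move=> sf cx oO; rewrite openE => u [iu Ou].
have [cu du _] := coord_imgP hM cx iu.
have [Q' [oO' Q'u] Q'P] := smooth_map_continuous sf cu oO Ou.
apply: (@filterS _ _ (nbhs_filter u)
  (coord_img x `&` cinv (chart_at x) @^-1` Q')); last first.
  by apply: open_nbhs_nbhs; split; [exact: open_cinv_preimage|split].
move=> w [iw Q'w]; have [cw dw _] := coord_imgP hM cx iw.
by split=> //; exact: Q'P.
Qed.

Definition rep_dom f x (y : N) : set 'rV[R]_(mdim M) :=
  coord_img x `&` (f \o cinv (chart_at x)) @^-1` cdom (chart_at y).

Lemma open_rep f x y : smooth_map f -> carrier x -> carrier y -> open (rep_dom f x y).
Proof. by move=> sf cx cy; apply: open_rep_dom => //; exact: open_chart_dom. Qed.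

Lemma rep_dom_pt f x : smooth_map f -> carrier x -> rep_dom f x (f x) (coord_pt x).
Proof.
move=> sf cx; split; first exact: coord_img_pt.
by rewrite /preimage /= coord_ptK//; apply: atlas_mem => //; exact: smooth_carrier.
Qed.

(** [smooth_map] speaks only of the charts at a point x0 and at f x0, near x0. Around each point of
    [rep_dom], transition maps on both sides carry this smoothness to the charts at [x] and [y]. *)
Lemma smooth_rep f x y : smooth_map f -> carrier x -> carrier y ->
  smooth_on (rep_dom f x y)
    (fun u => cmap (chart_at y) (f (cinv (chart_at x) u))).
Proof.
move=> sf cx cy; apply: smooth_on_local => u [iu du].
have [cu d0 uE] := coord_imgP hM cx iu; set x0 := cinv _ u in du cu d0 uE.
have [cfx [U [oU Ux UI Ud sU]]] := sf x0 cu; set y0 := f x0 in du cfx Ud sU.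
pose D := coord_img x `&` cinv (chart_at x) @^-1` cdom (chart_at x0).
have oD : open D by apply: open_cinv_preimage => //; exact: open_chart_dom.
have sD : smooth_on D _ := smooth_transition hM cx cu.
set tau := (fun u => _) in sD.
pose E := D `&` tau @^-1` U.
have oE : open E by exact: open_smooth_preimage.
have sE : smooth_on E (local_rep f x0 \o tau).
  by apply: smooth_on_comp sU _ => //; [move=> w []|apply: smooth_on_sub sD => w []].
have EP w : E w -> [/\ coord_img x w, carrier (f (cinv (chart_at x) w)),
    cdom (chart_at y0) (f (cinv (chart_at x) w)) &
    local_rep f x0 (tau w) = cmap (chart_at y0) (f (cinv (chart_at x) w))].
  move=> [[iw dw] Uw]; have [cw dw' _] := coord_imgP hM cx iw.
  have := Ud _ Uw; rewrite /local_rep /tau cmapK// => dw2.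
  by split=> //; exact: smooth_carrier.
pose F := E `&` rep_dom f x y.
have oF : open F by apply: openI => //; exact: open_rep.
exists F.
  split.
    have taux : tau u = coord_pt x0 by [].
    split; last by rewrite /preimage /= taux.
    by split=> //; exact: atlas_mem.
  by split.
pose D' := coord_img y0 `&` cinv (chart_at y0) @^-1` cdom (chart_at y).
have oD' : open D' by apply: open_cinv_preimage => //; exact: open_chart_dom.
have sD' : smooth_on D' _ := smooth_transition hN cfx cy.
have := smooth_on_comp oF oD' _ sD' (smooth_on_sub (fun _ => @proj1 _ _) sE).
have FP w : F w -> cinv (chart_at y0) (local_rep f x0 (tau w)) = f (cinv (chart_at x) w).
  by move=> [/EP[_ cw dw ->] _]; rewrite cmapK.
move=> H; apply: smooth_on_eq (H _) => // w Fw; last first.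
  have [/EP[_ cw dw wE] [_ dyw]] := Fw.
  by split; [rewrite /= wE; exact: coord_img_cmap|rewrite /preimage /= FP].
by rewrite /= FP.
Qed.

Lemma rep_differentiable f x : smooth_map f -> carrier x ->
  differentiable (local_rep f x) (coord_pt x).
Proof.
move=> sf cx; have cfx := smooth_carrier sf cx.
exact: smooth_on_differentiable (smooth_rep sf cx cfx) (rep_dom_pt sf cx).
Qed.

Lemma tmapE f x v : smooth_map f -> carrier x ->
  tmap f x v = 'D_v (local_rep f x) (coord_pt x).
Proof. by move=> sf cx; rewrite deriveE//; exact: rep_differentiable. Qed.

Lemma smooth_map_intro f :
  (forall x, carrier x -> carrier (f x) /\
     exists U, [/\ open U, U (coord_pt x), U `<=` rep_dom f x (f x) &
       smooth_on U (local_rep f x)]) ->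
  smooth_map f.
Proof.
move=> H x cx; have [cfx [U [oU Ux UD sU]]] := H x cx; split=> //.
by exists U; split=> // u /UD[].
Qed.

End SmoothMaps.

Lemma tmapD M N (f : M -> N) x v w : tmap f x (v + w) = tmap f x v + tmap f x w.
Proof. exact: linearD. Qed.

Lemma tmapB M N (f : M -> N) x v w : tmap f x (v - w) = tmap f x v - tmap f x w.
Proof. exact: linearB. Qed.

Lemma tmapZ M N (f : M -> N) x a v : tmap f x (a *: v) = a *: tmap f x v.
Proof. exact: linearZ. Qed.

Lemma tmap0 M N (f : M -> N) x : tmap f x 0 = 0.
Proof. exact: linear0. Qed.

Section Composition.
Variables (M N L : premanifold R).
Variables (hM : has_atlas M) (hN : has_atlas N) (hL : has_atlas L).
Variables (f : M -> N) (g : N -> L) (sf : smooth_map f) (sg : smooth_map g).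

Let D x := rep_dom f x (f x) `&` local_rep f x @^-1` rep_dom g (f x) (g (f x)).

Let D_open x : carrier x -> open (D x).
Proof.
move=> cx; have cfx := smooth_carrier sf cx; have cgx := smooth_carrier sg cfx.
by apply: open_smooth_preimage; [exact: open_rep|exact: smooth_rep|exact: open_rep].
Qed.

Let D_rep x u : carrier x -> D x u ->
  cinv (chart_at (f x)) (local_rep f x u) = f (cinv (chart_at x) u).
Proof.
move=> cx [[iu du] _]; have [cu _ _] := coord_imgP hM cx iu.
by rewrite /local_rep cmapK//; exact: smooth_carrier.
Qed.

Let D_pt x : carrier x -> D x (coord_pt x).
Proof.
move=> cx; split; first exact: rep_dom_pt.
rewrite /preimage /= /local_rep coord_ptK//.
by apply: rep_dom_pt => //; exact: smooth_carrier.
Qed.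

Let D_eq x u : carrier x -> D x u ->
  (local_rep g (f x) \o local_rep f x) u = local_rep (g \o f) x u.
Proof. by move=> cx Du; rewrite /= {1}/local_rep D_rep. Qed.

Lemma smooth_map_comp : smooth_map (g \o f).
Proof.
apply: smooth_map_intro => x cx; have cfx := smooth_carrier sf cx.
have cgx := smooth_carrier sg cfx; split=> //; exists (D x); split.
- exact: D_open.
- exact: D_pt.
- move=> u Du; have [[iu _] [_]] := Du; by rewrite /preimage /= D_rep.
- have := smooth_on_comp (D_open cx) (open_rep hN hL sg cfx cgx)
    (fun u => @proj2 _ _) (smooth_rep hN hL sg cfx cgx)
    (smooth_on_sub (fun u => @proj1 _ _) (smooth_rep hM hN sf cx cfx)).
  by apply: smooth_on_eq; [exact: D_open|move=> u Du; exact: D_eq].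
Qed.

Lemma tmap_comp x v : carrier x -> tmap (g \o f) x v = tmap g (f x) (tmap f x v).
Proof.
move=> cx; have cfx := smooth_carrier sf cx.
rewrite (tmapE hM hL _ smooth_map_comp cx) (tmapE hN hL _ sg cfx) (tmapE hM hN _ sf cx).
have E : \forall u \near coord_pt x, (local_rep g (f x) \o local_rep f x) u =
     local_rep (g \o f) x u.
  apply: (@filterS _ _ (nbhs_filter _) (D x)) => [u Du|]; first exact: D_eq.
  by apply: open_nbhs_nbhs; split; [exact: D_open|exact: D_pt].
rewrite -(near_eq_derive _ E) derive_comp.
- by rewrite /local_rep coord_ptK.
- exact: rep_differentiable.
- have -> : local_rep f x (coord_pt x) = coord_pt (f x) by rewrite /local_rep coord_ptK.
  exact: rep_differentiable.
Qed.

End Composition.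

End Atlas.

(** * Tangent maps and products *)

Section Subtypes.
Variables (T : topologicalType).
Implicit Types (A B : set T).

Lemma set_type_nbhsP A (x : A) (U : set A) :
  nbhs x U <-> exists2 V, open_nbhs (val x) V & forall y : A, V (val y) -> U y.
Proof.
split=> [[_ /= [[V oV <-] /= Vx] sVU]|[V [oV Vx] VU]].
  by exists V => // y Vy; exact: sVU.
by exists (val @^-1` V) => //; split => //; exists V.
Qed.

(** With ambient open sets in place of those of the subset type, passing to smaller sets and to
    products becomes direct. *)
Lemma hausdorff_subP A : hausdorff_space A <->
  forall x y, A x -> A y -> x <> y -> exists V W,
    [/\ open_nbhs x V, open_nbhs y W & forall z, A z -> V z -> ~ W z].
Proof.
split=> [hA x y Ax Ay xy|H].
  pose x' : A := exist _ x (mem_set Ax); pose y' : A := exist _ y (mem_set Ay).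
  have : ~ cluster (nbhs x') y' by move=> /hA [].
  move=> /existsNP[P /existsNP[Q /not_implyP[/set_type_nbhsP[V oV VP]]]].
  move=> /not_implyP[/set_type_nbhsP[W oW WQ] PQ].
  exists V, W; split=> // z Az Vz Wz; apply: PQ.
  by exists (exist _ z (mem_set Az)); split; [exact: VP|exact: WQ].
move=> x y xy; apply: contrapT => xy'.
have [|V [W [oV oW VW]]] := H (val x) (val y) (set_valP x) (set_valP y).
  by move=> /val_inj.
have nV : nbhs x (val @^-1` V) by apply/set_type_nbhsP; exists V.
have nW : nbhs y (val @^-1` W) by apply/set_type_nbhsP; exists W.
have [z [Vz Wz]] := xy _ _ nV nW.
exact: VW (set_valP z) Vz Wz.
Qed.

Lemma second_countable_subP A : @second_countable A <->
  exists B : set (set T), [/\ countable B, B `<=` open &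
    forall x, A x -> forall V, open_nbhs x V ->
      exists b, [/\ B b, b x & forall y, A y -> b y -> V y]].
Proof.
split=> [[B cB [oB nB]]|[B [cB oB nB]]].
  pose P (b : set A) (V : set T) := open V /\ val @^-1` V = b.
  (* [f] picks, for each open set of the subset type, an ambient open set with that trace. *)
  pose f (b : set A) := xget set0 [set V | P b V].
  have fP b : B b -> P b (f b).
    move=> /oB [V oV VE]; rewrite /f; case: xgetP => [W -> //|/(_ V)].
    by case; split.
  exists (f @` B); split.
  - exact: sub_countable (card_image_le f B) cB.
  - by move=> _ [b /fP[] + _ <-].
  - move=> x Ax V [oV Vx]; pose x' : A := exist _ x (mem_set Ax).
    have nV : nbhs x' (val @^-1` V) by apply/set_type_nbhsP; exists V.
    have [b [Bb bx] bV] := nB x' _ nV; have [ofb fbE] := fP b Bb.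
    exists (f b); split; [by exists b| |].
      by have : (val @^-1` f b) x' by rewrite fbE.
    move=> y Ay fby; have /bV// : b (exist _ y (mem_set Ay)) by rewrite -fbE.
exists (preimage val @` B); first exact: sub_countable (card_image_le _ B) cB.
split=> [_ [b /oB ob <-]|x U /set_type_nbhsP[V oV VU]].
  by exists b.
have [b [Bb bx bV]] := nB _ (set_valP x) _ oV.
exists (val @^-1` b); first by split=> //; exists b.
by move=> y by_; apply: VU; apply: bV => //; exact: set_valP.
Qed.

Lemma hausdorff_sub A B : A `<=` B -> hausdorff_space B -> hausdorff_space A.
Proof.
move=> AB /hausdorff_subP hB; apply/hausdorff_subP => x y /AB Bx /AB By xy.
have [V [W [oV oW VW]]] := hB x y Bx By xy; exists V, W; split=> // z /AB; exact: VW.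
Qed.

Lemma second_countable_sub A B : A `<=` B ->
  @second_countable B -> @second_countable A.
Proof.
move=> AB /second_countable_subP[C [cC oC nC]]; apply/second_countable_subP.
exists C; split=> // x /AB Bx V oV; have [b [Cb bx bV]] := nC x Bx V oV.
by exists b; split=> // y /AB; exact: bV.
Qed.

End Subtypes.

Section ProductTopology.
Variables (T1 T2 : topologicalType).

Lemma open_setX (A : set T1) (B : set T2) : open A -> open B -> open (A `*` B).
Proof.
move=> oA oB; rewrite openE => -[x y] [/= Ax By]; exists (A, B) => //.
by split; exact: open_nbhs_nbhs.
Qed.

Lemma open_nbhs_prod (p : T1 * T2) (V : set (T1 * T2)) : open_nbhs p V ->
  exists V1 V2, [/\ open_nbhs p.1 V1, open_nbhs p.2 V2 & V1 `*` V2 `<=` V].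
Proof.
move=> /open_nbhs_nbhs[[A B] [/= nA nB] ABV].
move: nA nB; rewrite !nbhsE => -[V1 oV1 V1A] [V2 oV2 V2B].
exists V1, V2; split=> // -[x y] [/= /V1A Ax /V2B By]; exact: ABV.
Qed.

Lemma hausdorff_setX (A : set T1) (B : set T2) :
  hausdorff_space A -> hausdorff_space B -> hausdorff_space (A `*` B).
Proof.
move=> /hausdorff_subP hA /hausdorff_subP hB; apply/hausdorff_subP.
move=> [x1 x2] [y1 y2] [/= Ax Bx] [/= Ay By] xy.
have [e1|n1] := pselect (x1 = y1).
  have [e2|n2] := pselect (x2 = y2); first by case: xy; rewrite e1 e2.
  have [V [W [[oV Vx] [oW Wy] VW]]] := hB _ _ Bx By n2.
  exists (setT `*` V), (setT `*` W); split.
  - by split=> //; apply: open_setX => //; exact: openT.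
  - by split=> //; apply: open_setX => //; exact: openT.
  - by move=> [z1 z2] [/= _ Bz] [_ /= Vz] [_ /= Wz]; exact: VW Vz Wz.
have [V [W [[oV Vx] [oW Wy] VW]]] := hA _ _ Ax Ay n1.
exists (V `*` setT), (W `*` setT); split.
- by split=> //; apply: open_setX => //; exact: openT.
- by split=> //; apply: open_setX => //; exact: openT.
- by move=> [z1 z2] [/= Az _] [/= Vz _] [/= Wz _]; exact: VW Vz Wz.
Qed.

Lemma second_countable_setX (A : set T1) (B : set T2) :
  @second_countable A -> @second_countable B -> @second_countable (A `*` B).
Proof.
move=> /second_countable_subP[C [cC oC nC]] /second_countable_subP[D [cD oD nD]].
apply/second_countable_subP.
exists ((fun CD : set T1 * set T2 => CD.1 `*` CD.2) @` (C `*` D)); split.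
- exact: sub_countable (card_image_le _ _) (countableX cC cD).
- by move=> _ [[c d] [/= /oC oc /oD od] <-]; exact: open_setX.
- move=> x [Ax Bx] V /open_nbhs_prod[V1 [V2 [oV1 oV2 VV]]].
  have [c [Cc cx cV]] := nC _ Ax _ oV1; have [d [Dd dx dV]] := nD _ Bx _ oV2.
  exists (c `*` d); split; [by exists (c, d)|by split|].
  by move=> y [Ay By] [cy dy]; apply: VV; split; [exact: cV|exact: dV].
Qed.

End ProductTopology.

Lemma nbhs_sub_open (T : topologicalType) (x : T) (A : set T) : nbhs x A ->
  exists2 B, open_nbhs x B & B `<=` A.
Proof. by rewrite nbhsE. Qed.

Section RowTopology.
Variables (R : realType) (n m : nat).

Lemma nbhs_row_mx (u : 'rV[R]_n) (v : 'rV[R]_m) B : nbhs (row_mx u v) B ->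
  exists B1 B2, [/\ open_nbhs u B1, open_nbhs v B2 &
    forall u' v', B1 u' -> B2 v' -> B (row_mx u' v')].
Proof.
move=> [P nP PB].
have n1 : \forall w \near u, forall j, P 0 (lshift m j) ((w : 'rV[R]_n) 0 j).
  apply: (@filter_forall _ _ _ _ (nbhs_filter u)) => j.
  have := nP 0 (lshift m j); rewrite row_mxEl; exact: coord_continuous.
have n2 : \forall w \near v, forall j, P 0 (rshift n j) ((w : 'rV[R]_m) 0 j).
  apply: (@filter_forall _ _ _ _ (nbhs_filter v)) => j.
  have := nP 0 (rshift n j); rewrite row_mxEr; exact: coord_continuous.
have [B1 o1 H1] := nbhs_sub_open n1; have [B2 o2 H2] := nbhs_sub_open n2.
exists B1, B2; split=> // u' v' /H1 h1 /H2 h2; apply: PB => i j.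
by rewrite ord1; case: (split_ordP j) => j' ->; rewrite ?row_mxEl ?row_mxEr.
Qed.

Lemma continuous_lsub : continuous (lsubmx : 'rV[R]_(n + m) -> 'rV[R]_n).
Proof. exact: continuous_lsubmx. Qed.

Lemma continuous_rsub : continuous (rsubmx : 'rV[R]_(n + m) -> 'rV[R]_m).
Proof. exact: continuous_rsubmx. Qed.

Lemma open_row (U : set 'rV[R]_n) (V : set 'rV[R]_m) : open U -> open V ->
  open [set u | U (lsubmx u) /\ V (rsubmx u)].
Proof.
move=> oU oV; apply: openI.
  by apply: (open_preimage (f := lsubmx)) => //; exact: continuous_lsub.
by apply: (open_preimage (f := rsubmx)) => //; exact: continuous_rsub.
Qed.

Lemma smooth_on_lsubmx U : smooth_on U (lsubmx : 'rV[R]_(n + m) -> 'rV[R]_n).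
Proof. exact: (@smooth_on_linear _ _ _ lsubmx _ continuous_lsub). Qed.

Lemma smooth_on_rsubmx U : smooth_on U (rsubmx : 'rV[R]_(n + m) -> 'rV[R]_m).
Proof. exact: (@smooth_on_linear _ _ _ rsubmx _ continuous_rsub). Qed.

Lemma derive_lsubmx (u v : 'rV[R]_(n + m)) : 'D_v lsubmx u = lsubmx v :> 'rV[R]_n.
Proof.
rewrite deriveE; last exact: differentiable_lsubmx.
by rewrite (@diff_lin _ _ _ lsubmx)//; exact: continuous_lsub.
Qed.

Lemma derive_rsubmx (u v : 'rV[R]_(n + m)) : 'D_v rsubmx u = rsubmx v :> 'rV[R]_m.
Proof.
rewrite deriveE; last exact: differentiable_rsubmx.
by rewrite (@diff_lin _ _ _ rsubmx)//; exact: continuous_rsub.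
Qed.

Lemma smooth_on_row_mx p U (f : 'rV[R]_p -> 'rV[R]_n) (g : 'rV[R]_p -> 'rV[R]_m) :
  open U -> smooth_on U f -> smooth_on U g ->
  smooth_on U (fun x => row_mx (f x) (g x)).
Proof. by move=> oU sf sg k; exact: Ck_on_row_mx. Qed.

End RowTopology.

Section Products.
Variable R : realType.
Implicit Types M N L P : premanifold R.

Lemma smooth_map_eq M N (f g : M -> N) : has_atlas M ->
  (forall x, carrier x -> f x = g x) -> smooth_map f -> smooth_map g.
Proof.
move=> hM fg sf x cx; have [cfx [U [oU Ux UI Ud sU]]] := sf x cx.
have E u : U u -> f (cinv (chart_at x) u) = g (cinv (chart_at x) u).
  by move=> /UI/(coord_imgP hM cx)[cu _ _]; exact: fg.
rewrite -fg//; split=> //; exists U; split=> // [u Uu|].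
  by rewrite -E//; exact: Ud.
apply: smooth_on_eq sU => // u Uu; by rewrite /local_rep E// fg.
Qed.

(** Replaces the local expression of [f] by a closed formula; the tangent maps of identities and
    projections are computed in this way. *)
Lemma tmap_rep M N (f : M -> N) (F : 'rV[R]_(mdim M) -> 'rV[R]_(mdim N)) x v :
  has_atlas M -> has_atlas N -> smooth_map f -> carrier x ->
  (forall u, coord_img x u -> local_rep f x u = F u) ->
  tmap f x v = 'D_v F (coord_pt x).
Proof.
move=> hM hN sf cx fF; rewrite (tmapE hM hN _ sf cx); apply: near_eq_derive.
apply: (@filterS _ _ (nbhs_filter _) (coord_img x)); first exact: fF.
by apply: open_nbhs_nbhs; split; [exact: open_coord_img|exact: coord_img_pt].
Qed.

Lemma tmap_eq M N (f g : M -> N) x v : has_atlas M -> has_atlas N ->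
  (forall x, carrier x -> f x = g x) -> smooth_map f -> carrier x ->
  tmap f x v = tmap g x v.
Proof.
move=> hM hN fg sf cx; have sg := smooth_map_eq hM fg sf.
rewrite (tmapE hM hN _ sg cx); apply: tmap_rep => // u iu.
by have [cu _ _] := coord_imgP hM cx iu; rewrite /local_rep !fg.
Qed.

Lemma smooth_map_id M : has_atlas M -> smooth_map (@id M).
Proof.
move=> hM x cx; split=> //; exists (coord_img x); split=> //.
- exact: open_coord_img.
- exact: coord_img_pt.
- by move=> u /(coord_imgP hM cx)[].
- apply: (smooth_on_eq _ _ (@smooth_on_id _ _ _)); first exact: open_coord_img.
  by move=> u /(coord_imgP hM cx)[_ _]; rewrite /local_rep => ->.
Qed.

Lemma tmap_id M x v : has_atlas M -> carrier x -> tmap (@id M) x v = v.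
Proof.
move=> hM cx; rewrite (tmap_rep (F := id) v hM hM (smooth_map_id hM) cx).
  by rewrite derive_id.
by move=> u /(coord_imgP hM cx)[_ _]; rewrite /local_rep => ->.
Qed.

Lemma smooth_map_cst M N (c : N) : has_atlas M -> has_atlas N -> carrier c ->
  smooth_map (fun _ : M => c).
Proof.
move=> hM hN cc x cx; split=> //; exists (coord_img x); split=> //.
- exact: open_coord_img.
- exact: coord_img_pt.
- by move=> u _; exact: atlas_mem.
- exact: smooth_on_cst.
Qed.

Lemma tmap_cst M N (c : N) x v : has_atlas M -> has_atlas N -> carrier c ->
  carrier x -> tmap (fun _ : M => c) x v = 0.
Proof.
move=> hM hN cc cx; rewrite (tmapE hM hN _ (smooth_map_cst hM hN cc) cx).
exact: derive_cst.
Qed.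

Section ProdAtlas.
Variables (M N : premanifold R) (hM : has_atlas M) (hN : has_atlas N).
Local Notation MN := (prod_mfd M N).

Lemma prod_coord_imgE (p : MN) : coord_img p =
  [set u | coord_img p.1 (lsubmx u) /\ coord_img p.2 (rsubmx u)].
Proof.
apply/seteqP; split=> [_ [[x y] [[/= cx cy] [/= dx dy]] <-]|u [[x [cx dx] xE] [y [cy dy] yE]]].
  by split; rewrite ?row_mxKl ?row_mxKr; [exists x|exists y].
by exists (x, y) => //; rewrite /= xE yE hsubmxK.
Qed.

Lemma prod_is_chart (p : MN) : carrier p -> is_chart (@carrier R MN) (chart_at p).
Proof.
move=> [cp1 cp2]; have c1 := atlas_chart hM cp1; have c2 := atlas_chart hN cp2.
split.
- by apply: open_setX; [exact: chart_dom_open c1|exact: chart_dom_open c2].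
- rewrite -/(coord_img p) prod_coord_imgE.
  by apply: open_row; exact: open_coord_img.
- apply/within_continuousP => -[x y] [[/= cx cy] [/= dx dy]] B.
  move=> /nbhs_row_mx[B1 [B2 [/open_nbhs_nbhs n1 /open_nbhs_nbhs n2 BB]]].
  have /within_continuousP k1 := chart_continuous c1.
  have /within_continuousP k2 := chart_continuous c2.
  have [V1 [p1 V1x] H1] := k1 x (conj cx dx) B1 n1.
  have [V2 [p2 V2x] H2] := k2 y (conj cy dy) B2 n2.
  exists (V1 `*` V2); first by split=> //; exact: open_setX.
  move=> [x' y'] [[/= cx' cy'] [/= dx' dy']] [/= Vx' Vy'].
  by apply: BB; [exact: H1|exact: H2].
- rewrite -/(coord_img p) prod_coord_imgE.
  apply/within_continuousP => u [iu1 iu2] B [[B1 B2] [/= n1 n2] BB].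
  have /within_continuousP k1 := chart_inv_continuous c1.
  have /within_continuousP k2 := chart_inv_continuous c2.
  have [V1 [p1 V1x] H1] := k1 _ iu1 B1 n1.
  have [V2 [p2 V2x] H2] := k2 _ iu2 B2 n2.
  exists [set u | V1 (lsubmx u) /\ V2 (rsubmx u)].
    by split; [exact: open_row|split].
  by move=> w [iw1 iw2] [Vw1 Vw2]; apply: BB; split; [exact: H1|exact: H2].
- move=> [x y] [/= cx cy] [/= dx dy]; rewrite row_mxKl row_mxKr.
  by rewrite (chart_cancel c1)// (chart_cancel c2).
Qed.

Lemma prod_atlas : has_atlas MN.
Proof.
split=> [p cp|p [cp1 cp2]|p q [cp1 cp2] [cq1 cq2]].
- exact: prod_is_chart.
- by split; exact: atlas_mem.
- have -> : cmap (chart_at p) @`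
      (@carrier R MN `&` (cdom (chart_at p) `&` cdom (chart_at q))) =
    [set u | (coord_img p.1 `&` cinv (chart_at p.1) @^-1` cdom (chart_at q.1)) (lsubmx u)
     /\ (coord_img p.2 `&` cinv (chart_at p.2) @^-1` cdom (chart_at q.2)) (rsubmx u)].
    rewrite -!transition_domE//.
    apply/seteqP; split=> [_ [[x y] [[/= cx cy] [[/= dx dy] [/= dx' dy']]] <-]|].
      by split; rewrite ?row_mxKl ?row_mxKr; [exists x|exists y].
    move=> u [[x [cx [dx dx']] xE] [y [cy [dy dy']] yE]].
    by exists (x, y) => //; rewrite /= xE yE hsubmxK.
  set U1 := _ `&` _; set U2 := _ `&` _.
  have o1 : open U1 by apply: open_cinv_preimage => //; exact: open_chart_dom.
  have o2 : open U2 by apply: open_cinv_preimage => //; exact: open_chart_dom.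
  have oU := open_row o1 o2.
  apply: smooth_on_row_mx => //.
    exact: (smooth_on_comp oU o1 (fun _ => @proj1 _ _) (smooth_transition hM cp1 cq1)
      (@smooth_on_lsubmx _ _ _ _)).
  exact: (smooth_on_comp oU o2 (fun _ => @proj2 _ _) (smooth_transition hN cp2 cq2)
      (@smooth_on_rsubmx _ _ _ _)).
Qed.

Lemma smooth_fst : @smooth_map R MN M (fun p : M * N => p.1).
Proof.
move=> p [cp1 cp2]; split=> //; exists (coord_img p); split=> //.
- exact: open_coord_img prod_atlas _ _.
- by apply: coord_img_pt => //; exact: prod_atlas.
- by rewrite prod_coord_imgE => u [/(coord_imgP hM cp1)[]].
- apply: (smooth_on_eq _ _ (@smooth_on_lsubmx _ _ _ _)).
    exact: open_coord_img prod_atlas _ _.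
  by rewrite prod_coord_imgE => u [/(coord_imgP hM cp1)[_ _ E] _]; rewrite /local_rep /= E.
Qed.

Lemma smooth_snd : @smooth_map R MN N (fun p : M * N => p.2).
Proof.
move=> p [cp1 cp2]; split=> //; exists (coord_img p); split=> //.
- exact: open_coord_img prod_atlas _ _.
- by apply: coord_img_pt => //; exact: prod_atlas.
- by rewrite prod_coord_imgE => u [_ /(coord_imgP hN cp2)[]].
- apply: (smooth_on_eq _ _ (@smooth_on_rsubmx _ _ _ _)).
    exact: open_coord_img prod_atlas _ _.
  by rewrite prod_coord_imgE => u [_ /(coord_imgP hN cp2)[_ _ E]]; rewrite /local_rep /= E.
Qed.

Lemma tmap_fst (p : MN) v : carrier p ->
  @tmap R MN M (fun p : M * N => p.1) p v = lsubmx v.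
Proof.
move=> cp; have [cp1 cp2] := cp.
rewrite (@tmap_rep MN M _ lsubmx _ v prod_atlas hM smooth_fst cp) ?derive_lsubmx//.
by rewrite prod_coord_imgE => u [/(coord_imgP hM cp1)[_ _ E] _]; rewrite /local_rep /= E.
Qed.

Lemma tmap_snd (p : MN) v : carrier p ->
  @tmap R MN N (fun p : M * N => p.2) p v = rsubmx v.
Proof.
move=> cp; have [cp1 cp2] := cp.
rewrite (@tmap_rep MN N _ rsubmx _ v prod_atlas hN smooth_snd cp) ?derive_rsubmx//.
by rewrite prod_coord_imgE => u [_ /(coord_imgP hN cp2)[_ _ E]]; rewrite /local_rep /= E.
Qed.

Section Pair.
Variables (P : premanifold R) (hP : has_atlas P) (f : P -> M) (g : P -> N).
Hypotheses (sf : smooth_map f) (sg : smooth_map g).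

Lemma smooth_pair : @smooth_map R P MN (fun x => (f x, g x)).
Proof.
move=> x cx; have cf := smooth_carrier sf cx; have cg := smooth_carrier sg cx.
split; first by split.
have oF := open_rep hP hM sf cx cf; have oG := open_rep hP hN sg cx cg.
exists (rep_dom f x (f x) `&` rep_dom g x (g x)); split.
- exact: openI.
- by split; exact: rep_dom_pt.
- by move=> u [[]].
- by move=> u [[_ du] [_ du']]; split.
- apply: smooth_on_row_mx; first exact: openI.
    by apply: smooth_on_sub (smooth_rep hP hM sf cx cf) => u [].
  by apply: smooth_on_sub (smooth_rep hP hN sg cx cg) => u [].
Qed.

Lemma tmap_pair x v : carrier x ->
  @tmap R P MN (fun x => (f x, g x)) x v = row_mx (tmap f x v) (tmap g x v).
Proof.
move=> cx; rewrite (tmapE hP prod_atlas _ smooth_pair cx).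
rewrite (tmapE hP hM _ sf cx) (tmapE hP hN _ sg cx) -derive_row_mx//.
  by apply: diff_derivable; exact: rep_differentiable hP hM _ _ sf cx.
by apply: diff_derivable; exact: rep_differentiable hP hN _ _ sg cx.
Qed.

End Pair.

End ProdAtlas.

Lemma prod_manifold M N : is_manifold M -> is_manifold N -> is_manifold (prod_mfd M N).
Proof.
move=> mM mN; have [c d t] := prod_atlas (manifold_atlas mM) (manifold_atlas mN).
split=> //.
  by apply: hausdorff_setX; [case: mM|case: mN].
by apply: second_countable_setX; [case: mM|case: mN].
Qed.

End Products.

(** * Embedded submanifolds and fibre products *)

Section OpenManifolds.
Variable R : realType.
Implicit Types M N : premanifold R.

Lemma euclid_coord_imgE n (V : set 'rV[R]_n) (x : euclidean_open V) : coord_img x = V.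
Proof.
by apply/seteqP; split=> [_ [y [Vy _] <-]|u Vu] //; exists u.
Qed.

Lemma euclid_atlas n (V : set 'rV[R]_n) : open V -> has_atlas (euclidean_open V).
Proof.
move=> oV; split=> // [x Vx|x y _ _]; last exact: smooth_on_id.
split=> //.
- exact: openT.
- by rewrite -/(coord_img x) euclid_coord_imgE.
- by apply: continuous_subspaceT => y; exact: cvg_id.
- by apply: continuous_subspaceT => y; exact: cvg_id.
Qed.

Lemma smooth_euclid_on n m (V : set 'rV[R]_n) (W : set 'rV[R]_m) f :
  @smooth_map R (euclidean_open V) (euclidean_open W) f -> smooth_on V f.
Proof.
move=> sf; apply: smooth_on_local => x Vx; have [_ [U [_ Ux _ _ sU]]] := sf x Vx.
by exists U.
Qed.

Lemma smooth_on_euclid n m (V : set 'rV[R]_n) (W : set 'rV[R]_m) f : open V ->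
  smooth_on V f -> (forall x, V x -> W (f x)) ->
  @smooth_map R (euclidean_open V) (euclidean_open W) f.
Proof.
move=> oV sf VW x Vx; split; first exact: VW.
exists V; split=> //; first by rewrite euclid_coord_imgE.
Qed.

Lemma smooth_euclid_sub N n (V V' : set 'rV[R]_n) f : open V' -> V' `<=` V ->
  @smooth_map R (euclidean_open V) N f -> @smooth_map R (euclidean_open V') N f.
Proof.
move=> oV' V'V sf x V'x; have [cfx [U [oU Ux UI Ud sU]]] := sf x (V'V x V'x).
split=> //; exists (U `&` V'); split.
- exact: openI.
- by split.
- by rewrite euclid_coord_imgE => u [].
- by move=> u [/Ud].
- by apply: smooth_on_sub sU => u [].
Qed.

Section OpenRestr.
Variables (M : premanifold R) (hM : has_atlas M) (Q : set M) (oQ : open Q).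

Lemma restr_coord_imgE (x : open_restr Q) : carrier x ->
  coord_img x = coord_img (x : M) `&` cinv (chart_at (x : M)) @^-1` Q.
Proof.
move=> [cx Qx]; apply/seteqP; split=> [_ [y [[cy Qy] dy] <-]|u [iu Qu]].
  by split; [exists y|rewrite /preimage /= (cmapK hM cx)].
have [cu du uE] := coord_imgP hM cx iu; exists (cinv (chart_at (x : M)) u) => //.
Qed.

Lemma restr_atlas : has_atlas (open_restr Q).
Proof.
split=> [x cx|x [cx _]|x y [cx _] [cy _]].
- have [cx' Qx] := cx; have c := atlas_chart hM cx'; split.
  + exact: chart_dom_open c.
  + rewrite [chart_img _ _](restr_coord_imgE cx).
    exact (open_cinv_preimage hM cx' oQ).
  + apply: continuous_subspaceW (chart_continuous c); by move=> y [[]].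
  + rewrite [chart_img _ _](restr_coord_imgE cx).
    by apply: continuous_subspaceW (chart_inv_continuous c); move=> y [].
  + by move=> y [cy _]; exact: chart_cancel c y cy.
- exact (atlas_mem hM cx).
- apply: smooth_on_sub (atlas_transition hM cx cy) => _ [z [[cz _] dz] <-].
  by exists z.
Qed.

Lemma smooth_restr N (f : M -> N) : smooth_map f -> @smooth_map R (open_restr Q) N f.
Proof.
move=> sf x cx; have [cx' Qx] := cx; have [cfx [U [oU Ux UI Ud sU]]] := sf x cx'.
split=> //; exists (U `&` coord_img x); split.
- by apply: openI => //; exact: open_coord_img restr_atlas _ cx.
- by split=> //; exact: coord_img_pt restr_atlas _ cx.
- by move=> u [].
- by move=> u [/Ud].
- by apply: smooth_on_sub sU => u [].
Qed.

Lemma smooth_corestr N (f : N -> M) : smooth_map f ->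
  (forall x, carrier x -> Q (f x)) -> @smooth_map R N (open_restr Q) f.
Proof. by move=> sf fQ x cx; have [cfx U] := sf x cx; split=> //; split=> //; exact: fQ. Qed.

End OpenRestr.

Section Charts.
Variables (M : premanifold R) (hM : has_atlas M).

Lemma smooth_cmap (x : M) : carrier x ->
  @smooth_map R (open_restr (cdom (chart_at x))) (euclidean_open setT) (cmap (chart_at x)).
Proof.
move=> cx y cy; have [cy' dy] := cy; split=> //.
have od := open_chart_dom hM cx; have hr := restr_atlas hM od.
exists (coord_img y); split=> //.
- exact: open_coord_img hr _ cy.
- exact: coord_img_pt hr _ cy.
- rewrite (restr_coord_imgE hM cy); exact (smooth_transition hM cy' cx).
Qed.

Lemma smooth_cinv (x : M) : carrier x ->
  @smooth_map R (euclidean_open (coord_img x)) M (cinv (chart_at x)).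
Proof.
move=> cx u iu; have [cu du uE] := coord_imgP hM cx iu; split=> //.
exists (coord_img x `&` cinv (chart_at x) @^-1` cdom (chart_at (cinv (chart_at x) u))).
split.
- exact: (open_cinv_preimage hM cx (open_chart_dom hM cu)).
- by split=> //; exact: atlas_mem.
- by rewrite euclid_coord_imgE => w [].
- by move=> w [].
- exact: smooth_transition.
Qed.

End Charts.

Lemma smooth_within_carrier M N (f : M -> N) : has_atlas M -> has_atlas N ->
  smooth_map f -> {within @carrier R M, continuous f}.
Proof.
move=> hM hN sf; apply/within_continuousP => x cx B /nbhs_sub_open[V [oV Vx] VB].
have [Q Qx QV] := smooth_map_continuous hM hN sf cx oV Vx.
by exists Q => // y cy Qy; apply: VB; exact: QV.
Qed.

End OpenManifolds.

Section Submanifolds.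
Variables (R : realType) (M : premanifold R) (hM : has_atlas M).
Variables (S : set M) (SM : S `<=` @carrier R M) (d : nat).
Hypothesis S_chart : forall p, S p ->
  exists c : chart R M d, is_sub_chart S c /\ cdom c p.
Local Notation Y := (sub_mfd S d).

Lemma sub_chartP (p : M) : S p ->
  is_sub_chart S (chart_at (p : Y)) /\ cdom (chart_at (p : Y)) p.
Proof.
move=> Sp; rewrite /=; case: pselect => [ex|]; last by case; exact: S_chart.
exact: projT2 (cid ex).
Qed.

Let sub_chart (p : M) : S p -> is_chart S (chart_at (p : Y)).
Proof. by move=> /sub_chartP[[]]. Qed.

Let open_dom (p : M) : S p -> open (cdom (chart_at (p : Y))).
Proof. by move=> /sub_chart/chart_dom_open. Qed.

Let open_img (p : M) : S p -> open (coord_img (p : Y)).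
Proof. by move=> /sub_chart/chart_img_open. Qed.

Let sub_imgP (p : M) u : S p -> coord_img (p : Y) u ->
  [/\ S (cinv (chart_at (p : Y)) u), cdom (chart_at (p : Y)) (cinv (chart_at (p : Y)) u) &
      cmap (chart_at (p : Y)) (cinv (chart_at (p : Y)) u) = u].
Proof.
move=> Sp [y [Sy dy] <-]; have := chart_cancel (sub_chart Sp) Sy dy.
by move=> ->.
Qed.

(** Transition maps factor through [M]: the inverse of one chart is smooth into [M], and the other
    chart is the restriction of a smooth map on an open subset of [M]. Charts chosen independently
    are thus compatible. *)
Lemma sub_atlas : has_atlas Y.
Proof.
split=> [p Sp|p /sub_chartP[]//|p q Sp Sq]; first exact: sub_chart.
have [[_ _ si] _] := sub_chartP Sp; have [[_ sm _] _] := sub_chartP Sq.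
set D := _ @` _.
have DE : D = coord_img (p : Y) `&` cinv (chart_at (p : Y)) @^-1` cdom (chart_at (q : Y)).
  apply/seteqP; split=> [_ [y [Sy [dy dy']] <-]|u [iu du]].
    by split; [exists y|rewrite /preimage /= (chart_cancel (sub_chart Sp))].
  have [Su du' uE] := sub_imgP Sp iu.
  by exists (cinv (chart_at (p : Y)) u).
have oD : open D.
  rewrite DE; apply: open_preimage_in; [exact: open_img| |exact: open_dom].
  exact: chart_inv_continuous (sub_chart Sp).
have si' : @smooth_map R (euclidean_open D) (@open_restr R M (cdom (chart_at (q : Y))))
    (cinv (chart_at (p : Y))).
  apply: (smooth_corestr (M := M)); last by rewrite DE => u [].
  have DI : D `<=` coord_img (p : Y) by rewrite DE => u [].
  exact (smooth_euclid_sub oD DI si).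
have hr : has_atlas (@open_restr R M (cdom (chart_at (q : Y)))) := restr_atlas hM (open_dom Sq).
exact: smooth_euclid_on (smooth_map_comp (euclid_atlas oD) hr (euclid_atlas openT) si' sm).
Qed.

Lemma sub_manifold : is_manifold M -> is_manifold Y.
Proof.
move=> mM; have [c a t] := sub_atlas; split=> //.
  by apply: hausdorff_sub SM _; case: mM.
by apply: second_countable_sub SM _; case: mM.
Qed.

Lemma smooth_sub_incl : @smooth_map R Y M id.
Proof.
apply: smooth_map_intro => // p Sp; split; first exact: SM.
have [[_ _ si] dp] := sub_chartP Sp.
have he := euclid_atlas (open_img Sp).
have ip : @carrier R (euclidean_open (coord_img (p : Y))) (coord_pt (p : Y)).
  by exists p.
have := open_rep he hM si ip (SM Sp); have := smooth_rep he hM si ip (SM Sp).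
set D := rep_dom _ _ _ => sD oD; exists D.
have DE u : D u <-> rep_dom (id : Y -> M) (p : Y) (p : M) u.
  by rewrite /D /rep_dom euclid_coord_imgE.
split=> //; last by move=> u /DE.
have pE : cinv (chart_at (p : Y)) (coord_pt (p : Y)) = p.
  exact: (chart_cancel (sub_chart Sp) Sp dp).
apply/DE; split; first by exists p.
by rewrite /preimage /= pE; apply: atlas_mem => //; exact: SM.
Qed.

Lemma smooth_sub_corestr (N : premanifold R) (f : N -> M) : has_atlas N -> smooth_map f ->
  (forall x, carrier x -> S (f x)) -> @smooth_map R N Y f.
Proof.
move=> hN sf fS x cx; split; first exact: fS.
have Sy := fS x cx; have [[_ sm _] dy] := sub_chartP Sy; set c := chart_at (f x : Y) in sm dy.
have oc : open (cdom c) by exact: open_dom.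
have [Q [oQ Qx] Qc] := smooth_map_continuous hN hM sf cx oc dy.
have hr : has_atlas (@open_restr R M (cdom c)) := restr_atlas hM oc.
have hQ := restr_atlas hN oQ.
have sfr : @smooth_map R (open_restr Q) (@open_restr R M (cdom c)) f.
  apply: (smooth_corestr (M := M) (N := open_restr Q)).
    exact (smooth_restr hN oQ sf).
  by move=> z [cz Qz]; exact: Qc.
have := smooth_map_comp hQ hr (euclid_atlas openT) sfr sm.
move=> /(_ x (conj cx Qx))[_ [U [oU Ux UI _ sU]]].
have UIx u : U u -> coord_img x u /\ Q (cinv (chart_at x) u).
  by move=> /UI; rewrite restr_coord_imgE//; exact.
exists U; split=> // u /UIx[] // iu Qu; apply: Qc => //.
by have [] := coord_imgP hN cx iu.
Qed.

(** A chart of [Y] is the restriction of a smooth map on an open subset of [M]; by the chain rule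
    the tangent map of the latter is a left inverse of that of the inclusion. *)
Lemma tmap_sub_incl_inj (p : M) v w : S p ->
  @tmap R Y M id p v = @tmap R Y M id p w -> v = w.
Proof.
move=> Sp; have [[_ sm _] dp] := sub_chartP Sp; set c := chart_at (p : Y) in sm dp.
have oc : open (cdom c) by exact: open_dom.
have hr : has_atlas (@open_restr R M (cdom c)) := restr_atlas hM oc.
have hY := restr_atlas sub_atlas oc.
have si : @smooth_map R (@open_restr R Y (cdom c)) (@open_restr R M (cdom c)) id.
  apply: (smooth_corestr (M := M) (N := @open_restr R Y (cdom c))); last by move=> z [].
  exact (@smooth_restr R Y sub_atlas _ oc M id smooth_sub_incl).
have he := euclid_atlas (@openT 'rV[R]_d).
have cp : @carrier R (@open_restr R Y (cdom c)) p by split.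
have K u : @tmap R (@open_restr R M (cdom c)) (euclidean_open setT) (cmap c) p
    (@tmap R Y M id p u) = u.
  have := tmap_comp hY hr he si sm u cp.
  rewrite (@tmap_rep _ (@open_restr R Y (cdom c)) (euclidean_open setT) (cmap c \o id) id p u
    hY he (smooth_map_comp hY hr he si sm) cp).
    by rewrite derive_id => {2}->.
  move=> u'; rewrite (restr_coord_imgE sub_atlas cp) => -[iu _].
  by have [_ _ E] := sub_imgP Sp iu.
by move=> vw; rewrite -(K v) vw K.
Qed.

End Submanifolds.

Section LevelSets.
Variables (R : realType) (M : premanifold R) (hM : has_atlas M).
Variables (S : set M) (SM : S `<=` @carrier R M).

(** In the coordinates of [submersion_chart], [S] is where the first [l] coordinates vanish; the
    remaining ones form the chart, and putting zeros in front of them gives its inverse. *)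
Lemma level_set_sub_chart (p : M) l (F : 'rV[R]_(mdim M) -> 'rV[R]_l) U :
  S p -> open U -> U (coord_pt p) -> U `<=` coord_img p -> smooth_on U F ->
  (forall w, exists v, 'D_v F (coord_pt p) = w) ->
  (forall u, U u -> S (cinv (chart_at p) u) <-> F u = 0) ->
  exists c : chart R M (mdim M - l), is_sub_chart S c /\ cdom c p.
Proof.
move=> Sp oU Up UI sF DF SF; have cp := SM Sp.
have [V [W [G [H [[[oV Vp VU] oW sG sH] [GW HV GK HK GF]]]]]] :=
  submersion_chart oU Up sF DF.
have [Q oQ QP] := open_cmap_preimage hM cp oV.
pose c := Chart Q (fun x => rsubmx (G (cmap (chart_at p) x)))
  (fun z => cinv (chart_at p) (H (row_mx 0 z))) : chart R M (mdim M - l).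
pose I : set 'rV[R]_(mdim M - l) := [set z | W (row_mx 0 z)].
have srow : smooth_on setT (fun z : 'rV[R]_(mdim M - l) => row_mx (0 : 'rV[R]_l) z).
  apply: smooth_on_row_mx; [exact: openT|exact: smooth_on_cst|exact: smooth_on_id].
have oI : open I.
  have := open_smooth_preimage openT srow oW; by rewrite setTI.
have HI z : I z -> [/\ S (cinv c z), Q (cinv c z), V (H (row_mx 0 z)) &
    cmap (chart_at p) (cinv c z) = H (row_mx 0 z)].
  move=> Iz; have Vz := HV _ Iz; have Uz := VU _ Vz.
  have [cz dz zE] := coord_imgP hM cp (UI _ Uz).
  split=> //; last by apply/QP => //; rewrite zE.
  by apply/SF => //; rewrite -GF HK// row_mxKl.
have GS x : S x -> Q x -> G (cmap (chart_at p) x) = row_mx 0 (cmap c x).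
  move=> Sx /QP -/(_ (SM Sx))[dx Vx]; rewrite -[LHS]hsubmxK GF; congr row_mx.
  by apply/SF; [exact: VU|rewrite cmapK//; exact: SM].
have imgE : chart_img S c = I.
  apply/seteqP; split=> [_ [x [Sx Qx] <-]|z Iz].
    rewrite /I /= -/(cmap c x) -GS//; apply: GW.
    by have [] := (QP x (SM Sx)).1 Qx.
  have [Sz Qz Vz zE] := HI z Iz; exists (cinv c z) => //.
  by rewrite [LHS]/(cmap c _) /= -/(cinv c z) zE HK// row_mxKr.
have sc : @smooth_map R (open_restr Q) (euclidean_open setT) (cmap c).
  have sm := smooth_cmap hM cp.
  have Qd : @smooth_map R (open_restr Q) (euclidean_open V) (cmap (chart_at p)).
    have sm' : @smooth_map R (open_restr Q) (euclidean_open setT) (cmap (chart_at p)).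
      move=> x [cx Qx]; have [dx Vx] := (QP x cx).1 Qx.
      have [_ [U' [oU' Ux UI' Ud sU]]] := sm x (conj cx dx).
      have cx' : @carrier R (open_restr Q) x by [].
      have iQ := @coord_img_pt _ _ (restr_atlas hM oQ) _ cx'.
      split=> //; exists (U' `&` coord_img (x : open_restr Q)); split=> //.
      - by apply: openI => //; exact (open_coord_img (restr_atlas hM oQ) cx').
      - by apply: smooth_on_sub sU => u [].
    move=> x cx; have [_ H'] := sm' x cx; split=> //.
    by have [dx Vx] := (QP x cx.1).1 cx.2.
  have sGe : @smooth_map R (euclidean_open V) (euclidean_open setT) (fun u => rsubmx (G u)).
    apply: smooth_on_euclid => //.
    exact: (smooth_on_comp oV openT _ (@smooth_on_rsubmx _ _ _ _) sG).
  exact (smooth_map_comp (restr_atlas hM oQ) (euclid_atlas oV) (euclid_atlas openT) Qd sGe).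
have si : @smooth_map R (euclidean_open (chart_img S c)) M (cinv c).
  rewrite imgE.
  have sHe : @smooth_map R (euclidean_open I) (euclidean_open (coord_img p))
      (fun z => H (row_mx 0 z)).
    apply: smooth_on_euclid => //; last by move=> z Iz; exact/UI/VU/HV.
    exact: (smooth_on_comp oI oW _ sH (smooth_on_sub (@subsetT _ _) srow)).
  exact (smooth_map_comp (euclid_atlas oI) (euclid_atlas (open_coord_img hM cp)) hM
    sHe (smooth_cinv hM cp)).
exists c; split; last by apply/QP => //; split; [exact: atlas_mem|].
split=> //; split.
- exact: oQ.
- by rewrite imgE.
- have := smooth_within_carrier (restr_atlas hM oQ) (euclid_atlas openT) sc.
  by apply: continuous_subspaceW => x [/SM].
- rewrite imgE in si *.
  exact: smooth_within_carrier (euclid_atlas oI) hM si.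
- move=> x Sx Qx; have [dx Vx] := (QP x (SM Sx)).1 Qx.
  by rewrite [LHS]/= -/(cmap c x) -GS// GK// cmapK//; exact: SM.
Qed.

End LevelSets.

Section KernelDimension.
Variables (R : fieldType) (m l : nat).

(** The row space of [A] lies in the kernel of [B], and both have dimension m - l. *)
Lemma kernel_by_dimension (A : 'M[R]_(m - l, m)) (B : 'M[R]_(m, l)) (u : 'rV[R]_m) :
  row_free A -> row_full B -> A *m B = 0 -> u *m B = 0 -> exists v, v *m A = u.
Proof.
move=> fA fB /sub_kermxP AB /sub_kermxP uB.
have rk : \rank (kermx B) = (m - l)%N by rewrite mxrank_ker (eqP fB).
have /eqmxP AK : (A == kermx B)%MS by rewrite -(mxrank_leqif_eq AB) (eqP fA) rk.
have /submxP[v ->] : (u <= A)%MS by rewrite AK.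
by exists v.
Qed.

End KernelDimension.

(** * Fibre products of transverse maps and their tangent spaces *)

Section FibreProducts.
Variables (R : realType) (M1 M2 L : premanifold R).
Variables (h1 : has_atlas M1) (h2 : has_atlas M2) (hL : has_atlas L).
Variables (f : M1 -> L) (g : M2 -> L) (sf : smooth_map f) (sg : smooth_map g).
Hypothesis fg : transverse f g.
Local Notation M := (prod_mfd M1 M2).
Local Notation Y := (fibre_product f g).
Local Notation S := [set p : M1 * M2 | [/\ carrier p.1, carrier p.2 & f p.1 = g p.2]].

Let hM : has_atlas M. Proof. exact: prod_atlas. Qed.

Let SM : S `<=` @carrier R M. Proof. by move=> p []. Qed.

(** Changing the sign of the second vector turns the sum in [transverse] into a difference, which is
    the derivative of the equation f = g. *)
Lemma transverse_surj p w : S p ->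
  exists v : tangent M, tmap f p.1 (lsubmx v) - tmap g p.2 (rsubmx v) = w.
Proof.
move=> [c1 c2 E]; have [v1 [v2 <-]] := fg c1 c2 E w.
exists (row_mx v1 (- v2)); rewrite row_mxKl row_mxKr; congr (_ + _).
by rewrite -[in LHS](sub0r v2) tmapB tmap0 sub0r opprK.
Qed.

(** Near [p], reading [f] and [g] in one chart of [L] makes the fibre product the zero set of the
    difference of their coordinates; transversality says that this difference is a submersion at
    [p]. *)
Lemma fibre_product_chart (p : M) : S p ->
  exists c : chart R M (mdim M1 + mdim M2 - mdim L), @is_sub_chart R M S _ c /\ cdom c p.
Proof.
move=> Sp; have [c1 c2 E] := Sp; have cy := smooth_carrier sf c1.
pose Fl (u : 'rV[R]_(mdim M1)) := cmap (chart_at (f p.1)) (f (cinv (chart_at p.1) u)).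
pose Fr (u : 'rV[R]_(mdim M2)) := cmap (chart_at (f p.1)) (g (cinv (chart_at p.2) u)).
pose F (u : 'rV[R]_(mdim M)) := Fl (lsubmx u) - Fr (rsubmx u).
pose U := [set u : 'rV[R]_(mdim M) | rep_dom f p.1 (f p.1) (lsubmx u) /\
  rep_dom g p.2 (f p.1) (rsubmx u)].
have o1 := open_rep h1 hL sf c1 cy; have o2 := open_rep h2 hL sg c2 cy.
have oU : open U by exact: open_row.
have s1 := smooth_rep h1 hL sf c1 cy; have s2 := smooth_rep h2 hL sg c2 cy.
have sF : smooth_on U F.
  have sl := smooth_on_comp oU o1 (fun _ => @proj1 _ _) s1 (@smooth_on_lsubmx _ _ _ _).
  have sr := smooth_on_comp oU o2 (fun _ => @proj2 _ _) s2 (@smooth_on_rsubmx _ _ _ _).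
  move=> k; have := Ck_onD oU (sl k) (Ck_onZ (-1) oU (sr k)).
  by apply: Ck_on_eq => // u _; rewrite scaleN1r.
have Up : U (coord_pt (p : M)).
  split; rewrite /coord_pt /= ?row_mxKl ?row_mxKr; first exact: rep_dom_pt.
  by rewrite E; exact: rep_dom_pt.
have dl : differentiable Fl (coord_pt p.1).
  by apply: smooth_on_differentiable s1 _; exact: rep_dom_pt.
have dr : differentiable Fr (coord_pt p.2).
  by apply: smooth_on_differentiable s2 _; rewrite E; exact: rep_dom_pt.
have DF v : 'D_v F (coord_pt (p : M)) = tmap f p.1 (lsubmx v) - tmap g p.2 (rsubmx v).
  have ll : differentiable (lsubmx : 'rV[R]_(mdim M) -> 'rV[R]_(mdim M1)) (coord_pt (p : M)).
    exact: differentiable_lsubmx.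
  have rr : differentiable (rsubmx : 'rV[R]_(mdim M) -> 'rV[R]_(mdim M2)) (coord_pt (p : M)).
    exact: differentiable_rsubmx.
  have lE : lsubmx (coord_pt (p : M)) = coord_pt p.1 by rewrite /coord_pt /= row_mxKl.
  have rE : rsubmx (coord_pt (p : M)) = coord_pt p.2 by rewrite /coord_pt /= row_mxKr.
  have -> : F = (Fl \o lsubmx) - (Fr \o rsubmx) by [].
  rewrite deriveB; last 2 first.
  - by apply: diff_derivable; apply: differentiable_comp => //; rewrite lE.
  - by apply: diff_derivable; apply: differentiable_comp => //; rewrite rE.
  rewrite (derive_comp _ ll); last by rewrite lE.
  rewrite (derive_comp _ rr); last by rewrite rE.
  rewrite derive_lsubmx derive_rsubmx lE rE (tmapE h1 hL _ sf c1) (tmapE h2 hL _ sg c2).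
  by rewrite /local_rep -E.
apply: (level_set_sub_chart hM SM Sp oU Up _ sF).
- by move=> u [[i1 _] [i2 _]]; rewrite prod_coord_imgE.
- by move=> w; have [v vE] := transverse_surj w Sp; exists v; rewrite DF.
- move=> u [[i1 d1] [i2 d2]].
  have [cu1 _ _] := coord_imgP h1 c1 i1; have [cu2 _ _] := coord_imgP h2 c2 i2.
  split=> [[_ _ /= uE]|/subr0_eq uE]; first by rewrite /F /Fl /Fr uE subrr.
  split=> //=; have := congr1 (cinv (chart_at (f p.1))) uE.
  by rewrite !cmapK//; exact: smooth_carrier.
Qed.

Lemma fibre_product_atlas : has_atlas Y.
Proof. exact: (sub_atlas hM fibre_product_chart). Qed.

Lemma fibre_product_manifold : is_manifold M1 -> is_manifold M2 -> is_manifold Y.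
Proof.
move=> m1 m2; apply: (sub_manifold hM SM fibre_product_chart).
exact: prod_manifold.
Qed.

Lemma smooth_fibre_incl : @smooth_map R Y M id.
Proof. exact: (smooth_sub_incl hM SM fibre_product_chart). Qed.

Lemma smooth_fibre_corestr (N : premanifold R) (k : N -> M) : has_atlas N ->
  smooth_map k -> (forall x, carrier x -> f (k x).1 = g (k x).2) ->
  @smooth_map R N Y k.
Proof.
move=> hN sk kE; apply: (smooth_sub_corestr hM fibre_product_chart hN sk).
by move=> x cx; have [ck1 ck2] := smooth_carrier sk cx; split=> //; exact: kE.
Qed.

Lemma smooth_fibre_fst : @smooth_map R Y M1 (fun p : M1 * M2 => p.1).
Proof.
exact (smooth_map_comp fibre_product_atlas hM h1 smooth_fibre_incl (smooth_fst h1 h2)).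
Qed.

Lemma smooth_fibre_snd : @smooth_map R Y M2 (fun p : M1 * M2 => p.2).
Proof.
exact (smooth_map_comp fibre_product_atlas hM h2 smooth_fibre_incl (smooth_snd h1 h2)).
Qed.

Local Notation T1 := (@tmap R Y M1 (fun p : M1 * M2 => p.1)).
Local Notation T2 := (@tmap R Y M2 (fun p : M1 * M2 => p.2)).

Let inclE p v : S p -> @tmap R Y M id p v = row_mx (T1 p v) (T2 p v).
Proof.
move=> Sp.
have e1 := tmap_comp fibre_product_atlas hM h1 smooth_fibre_incl (smooth_fst h1 h2) v Sp.
have e2 := tmap_comp fibre_product_atlas hM h2 smooth_fibre_incl (smooth_snd h1 h2) v Sp.
rewrite (tmap_fst h1 h2 _ (SM Sp)) in e1; rewrite (tmap_snd h1 h2 _ (SM Sp)) in e2.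
by rewrite -[LHS]hsubmxK; congr row_mx; rewrite -?e1 -?e2.
Qed.

Lemma fibre_tangent_inj (p : Y) v w : carrier p ->
  T1 p v = T1 p w -> T2 p v = T2 p w -> v = w.
Proof.
move=> Sp E1 E2; apply: (tmap_sub_incl_inj hM SM fibre_product_chart Sp).
by rewrite !inclE// E1 E2.
Qed.

Lemma fibre_tangentE (p : Y) v : carrier p -> tmap f p.1 (T1 p v) = tmap g p.2 (T2 p v).
Proof.
move=> Sp; have hY := fibre_product_atlas.
have e1 := tmap_comp hY h1 hL smooth_fibre_fst sf v Sp.
have e2 := tmap_comp hY h2 hL smooth_fibre_snd sg v Sp.
rewrite -e1 -e2; apply: (tmap_eq _ hY hL) => //; first by move=> x [].
exact: (smooth_map_comp hY h1 hL smooth_fibre_fst sf).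
Qed.

(** Dimension count: the tangent space of [Y] injects into the kernel of T f - T g, and this map is
    onto by transversality, so its kernel has the same dimension as [Y]. *)
Lemma fibre_tangent_ex (p : Y) v1 v2 : carrier p ->
  tmap f p.1 v1 = tmap g p.2 v2 -> exists v, T1 p v = v1 /\ T2 p v = v2.
Proof.
move=> Sp E.
pose A : 'M[R]_(mdim M1 + mdim M2 - mdim L, mdim M1 + mdim M2) :=
  lin1_mx ('d (local_rep (id : Y -> M) p) (coord_pt p)).
pose Bl : 'M[R]_(mdim M1, mdim L) := lin1_mx ('d (local_rep f p.1) (coord_pt p.1)).
pose Br : 'M[R]_(mdim M2, mdim L) := lin1_mx ('d (local_rep g p.2) (coord_pt p.2)).
have AE v : v *m A = row_mx (T1 p v) (T2 p v) by rewrite mul_rV_lin1 -inclE.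
have BE (v1' : tangent M1) (v2' : tangent M2) :
    row_mx v1' v2' *m col_mx Bl (- Br) = tmap f p.1 v1' - tmap g p.2 v2'.
  by rewrite mul_row_col mulmxN !mul_rV_lin1.
have [| | | |v vE] := @kernel_by_dimension R _ _ A (col_mx Bl (- Br)) (row_mx v1 v2).
- rewrite -kermx_eq0; apply/rowV0P => u /sub_kermxP uA.
  have uE : row_mx (T1 p u) (T2 p u) = row_mx (T1 p 0) (T2 p 0).
    by rewrite -!AE uA mul0mx.
  by have [E1 E2] := eq_row_mx uE; exact: fibre_tangent_inj Sp E1 E2.
- rewrite -sub1mx; apply/row_subP => i; have [v vE] := transverse_surj (row i 1%:M) Sp.
  by rewrite -vE -BE submxMl.
- apply/row_matrixP => i; rewrite row_mul row0 -[row i A]mul1mx.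
  by rewrite !rowE !mulmxA mul1mx AE BE fibre_tangentE// subrr.
- by rewrite BE E subrr.
by exists v; move: vE; rewrite AE => /eq_row_mx[].
Qed.

End FibreProducts.

(** * Differential forms *)

Section Alternating.
Variables (R : numFieldType) (V : lmodType R) (k : nat).
Implicit Types (B : ('I_k -> V) -> R) (v : 'I_k -> V).

Definition multilinear_form B := forall v i (r : R) (u w : V),
  B (dfwith v i (r *: u + w)) = r * B (dfwith v i u) + B (dfwith v i w).

Definition alternating_form B := forall v i j, i != j -> v i = v j -> B v = 0.

Lemma dfwith_same v i : dfwith v i (v i) = v.
Proof. by apply/funext => j; case: (dfwithP v (v i) j). Qed.

Lemma dfwithC v i j (u w : V) : i != j ->
  dfwith (dfwith v i u) j w = dfwith (dfwith v j w) i u.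
Proof.
move=> ij; apply/funext => l.
have [->|li] := eqVneq l i; first by rewrite dfwithin dfwithout 1?eq_sym// dfwithin.
have [->|lj] := eqVneq l j; first by rewrite dfwithin dfwithout ?dfwithin.
by rewrite !dfwithout// eq_sym.
Qed.

Lemma comp_dfwith (W : Type) (h : V -> W) v i u :
  (fun j => h (dfwith v i u j)) = dfwith (fun j => h (v j)) i (h u).
Proof.
apply/funext => j; have [->|ji] := eqVneq j i; first by rewrite !dfwithin.
by rewrite !dfwithout// eq_sym.
Qed.

Section Multilinear.
Variables (B : ('I_k -> V) -> R) (B_lin : multilinear_form B).

Lemma multilinear0 v i : B (dfwith v i 0) = 0.
Proof.
have := B_lin v i 1 0 0; rewrite scale1r addr0 mul1r => /eqP.
by rewrite -subr_eq0 opprD addrA subrr sub0r oppr_eq0 => /eqP.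
Qed.

Lemma multilinearD v i u w :
  B (dfwith v i (u + w)) = B (dfwith v i u) + B (dfwith v i w).
Proof. by have := B_lin v i 1 u w; rewrite scale1r mul1r. Qed.

Lemma multilinearZ v i r u : B (dfwith v i (r *: u)) = r * B (dfwith v i u).
Proof. by have := B_lin v i r u 0; rewrite addr0 multilinear0 addr0. Qed.

Lemma multilinear_sum v i I (s : seq I) (c : I -> R) (e : I -> V) :
  B (dfwith v i (\sum_(j <- s) c j *: e j)) = \sum_(j <- s) c j * B (dfwith v i (e j)).
Proof.
elim: s => [|j s IH]; first by rewrite !big_nil multilinear0.
by rewrite !big_cons multilinearD multilinearZ IH.
Qed.

Hypothesis B_alt : alternating_form B.

(** Polarisation: expand the vanishing value of [B] with v i + v j in both positions. *)
Lemma alternating_tperm v i j : i != j -> B (v \o tperm i j) = - B v.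
Proof.
move=> ij; pose b x y := B (dfwith (dfwith v i x) j y).
have bx x : b x x = 0.
  by apply: (B_alt ij); rewrite dfwithin dfwithout 1?eq_sym// dfwithin.
have bDl x x' y : b (x + x') y = b x y + b x' y.
  by rewrite /b !(dfwithC _ _ _ ij) multilinearD.
have bDr x y y' : b x (y + y') = b x y + b x y' by rewrite /b multilinearD.
have := bx (v i + v j); rewrite bDl !bDr !bx add0r addr0 => E.
have -> : B v = b (v i) (v j).
  by rewrite /b dfwith_same -[X in dfwith X j]( dfwith_same v i) dfwith_same dfwith_same.
have -> : v \o tperm i j = dfwith (dfwith v i (v j)) j (v i).
  apply/funext => l /=; case: tpermP => [->|->|/eqP li /eqP lj].
  - by rewrite dfwithout 1?eq_sym// dfwithin.
  - by rewrite dfwithin.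
  - by rewrite !dfwithout// eq_sym.
by apply/eqP; rewrite -addr_eq0 addrC; exact/eqP.
Qed.

Lemma alternating_perm v (s : {perm 'I_k}) : B (v \o s) = (-1) ^+ s * B v.
Proof.
have [ts -> tsP] := prod_tpermP s; elim: ts tsP v => [_ v|t ts IH /= /andP[tP tsP] v].
  rewrite big_nil odd_perm1 mul1r; congr B.
  by apply/funext => i; rewrite /= perm1.
rewrite big_cons odd_permM odd_tperm tP signr_addb expr1.
have -> : v \o (tperm t.1 t.2 * \prod_(u <- ts) tperm u.1 u.2)%g =
    (v \o (\prod_(u <- ts) tperm u.1 u.2)%g) \o tperm t.1 t.2.
  by apply/funext => i; rewrite /= permM.
by rewrite alternating_tperm// IH// mulN1r mulNr.
Qed.

End Multilinear.
End Alternating.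

(** Removing index a and then the b-th remaining one removes the same two indices as removing
    [bump a b] first; the conditional is the rank of a in what is then left. This lemma and the
    three that follow say that the exchange is an involution, leaves the remaining indices in place
    and changes the parity. *)
Lemma bump_bump_pred a b : bump (bump a b) (if (a <= b)%N then a else a.-1) = a.
Proof. by rewrite /bump; case: (leqP a b) => ab /=; case: leqP => /= *; lia. Qed.

Lemma bump_pred_bump a b :
  (if (bump a b <= (if (a <= b)%N then a else a.-1))%N then bump a b else (bump a b).-1) = b.
Proof. by rewrite /bump; case: (leqP a b) => ab /=; case: leqP => /= *; lia. Qed.

Lemma bump_exchange a b c :
  bump a (bump b c) = bump (bump a b) (bump (if (a <= b)%N then a else a.-1) c).
Proof.
rewrite /bump; case: (leqP a b) => ab /=.
  case: (leqP b c) => bc /=; case: (leqP a c) => ac /=; rewrite ?add0n ?add1n ?addn0;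
    case: leqP => /= *; try case: leqP => /= *; lia.
case: (leqP b c) => bc /=; case: (leqP a.-1 c) => ac /=; rewrite ?add0n ?add1n ?addn0;
  case: leqP => /= *; try case: leqP => /= *; lia.
Qed.

Lemma bump_parity a b :
  odd (a + (b + (if (a <= b)%N then a else a.-1))) = odd (bump a b).+1.
Proof. by rewrite /bump; case: (leqP a b) => ab /=; lia. Qed.

Section Koszul.
Variables (R : numFieldType) (V : lmodType R).

(** The family [r] with [h] inserted at position [j]. By [ins_perm], moving [h] to position j' is a
    permutation, of sign (-1)^(j + j'). *)
Let ins k (r : 'I_k -> V) (h : V) (j l : 'I_k.+1) : V :=
  if unlift j l is Some m then r m else h.

Let ins_perm k (r : 'I_k -> V) h (j j' : 'I_k.+1) :
  ins r h j = ins r h j' \o lift_perm j j' 1%g.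
Proof.
apply/funext => l; rewrite /ins /=; case: (unliftP j l) => [m ->|->].
  by rewrite lift_perm_lift perm1 liftK.
by rewrite lift_perm_id unlift_none.
Qed.

(** The rank of [i] once [lift i j] has been removed; [swap] then exchanges the order in which the
    two indices are removed. *)
Let co k (i : 'I_k.+2) (j : 'I_k.+1) : 'I_k.+1 := inord (if (i <= j)%N then i : nat else i.-1).

Let swap k (p : 'I_k.+2 * 'I_k.+1) := (lift p.1 p.2, co p.1 p.2).

Let coE k (i : 'I_k.+2) (j : 'I_k.+1) :
  co i j = (if (i <= j)%N then i : nat else i.-1) :> nat.
Proof.
have hi := ltn_ord i; have hj := ltn_ord j.
by rewrite /co; case: leqP => ij; rewrite inordK//; lia.
Qed.

Let swapK k : involutive (@swap k).
Proof.
move=> [i j]; rewrite /swap /=; have cE := coE i j.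
have e1 : lift (lift i j) (co i j) = i.
  apply: val_inj; rewrite /= cE; exact: bump_bump_pred.
congr pair => //; apply: val_inj; rewrite /= coE /= cE; exact: bump_pred_bump.
Qed.

(** The terms of (i, j) and of [swap (i, j)] contain the same remaining vectors and, by symmetry of
    [H], the same inserted one, at two different positions. Together with the signs (-1)^i they are
    opposite, so the sum equals its own opposite. *)
Lemma koszul_cancel k (B : ('I_k -> V) -> R) (w : 'I_k.+1 -> V)
    (H : 'I_k.+1 -> 'I_k.+1 -> V) :
  multilinear_form B -> alternating_form B -> (forall i j, H i j = H j i) ->
  \sum_(i < k.+1) (-1) ^+ i *
    \sum_(j < k) B (dfwith (fun l => w (lift i l)) j (H i (lift i j))) = 0.
Proof.
case: k B w H => [|k] B w H Blin Balt Hsym.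
  by apply: big1 => i _; rewrite big_ord0 mulr0.
pose t (p : 'I_k.+2 * 'I_k.+1) := (-1) ^+ p.1 *
  B (dfwith (fun l => w (lift p.1 l)) p.2 (H p.1 (lift p.1 p.2))).
rewrite (eq_bigr (fun i => \sum_(j < k.+1) t (i, j))); last first.
  by move=> i _; rewrite mulr_sumr.
rewrite pair_big /=; set S := \sum_(_ | _) _.
have tN p : t (swap p) = - t p.
  case: p => i j; rewrite /t /swap /=; have := swapK (i, j); rewrite /swap /= => -[e1 e2].
  rewrite e1 (Hsym _ i); set h := H i _; set i' := lift i j; set j' := co i j.
  have insE (a : 'I_k.+2) (b : 'I_k.+1) :
      dfwith (fun l => w (lift a l)) b h = ins (fun m => w (lift a (lift b m))) h b.
    apply/funext => l; rewrite /ins; case: (unliftP b l) => [m ->|->].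
      by rewrite dfwithout// neq_lift.
    by rewrite dfwithin.
  rewrite !insE.
  have -> : (fun m => w (lift i (lift j m))) = (fun m => w (lift i' (lift j' m))).
    apply/funext => m; congr w; apply: val_inj; rewrite /= /i' /j' coE /=; exact: bump_exchange.
  rewrite [in RHS](ins_perm _ _ j j') alternating_perm// odd_lift_perm odd_perm1 addbF.
  rewrite signr_addb !signr_odd mulrA mulrA -mulNr; congr (_ * _).
  rewrite /i' /= -!exprD -[RHS]mulN1r -exprS -[LHS]signr_odd -[RHS]signr_odd.
  by rewrite /j' -addnA /= coE bump_parity /= negbK.
have SN : S = - S.
  rewrite {1}/S (reindex_inj (can_inj (@swapK k))) /= -sumrN.
  by apply: eq_big => [[]//|p _]; rewrite -surjective_pairing -[RHS]tN /swap.
by apply/eqP; rewrite -[_ == 0](mulrn_eq0 _ 2) /= mulr2n {1}SN addNr.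
Qed.

End Koszul.

Section ScalarDerivatives.
Variables (R : realType) (p n : nat).
Implicit Types (c G : 'I_n -> 'rV[R]_p -> R^o).

Lemma derive_sumM c G x v :
  (forall j, differentiable (c j) x) -> (forall j, differentiable (G j) x) ->
  'D_v (fun u => \sum_j c j u * G j u : R^o) x =
  \sum_j (c j x * 'D_v (G j) x + G j x * 'D_v (c j) x).
Proof.
move=> dc dG; rewrite (_ : (fun u => _) = \sum_j (c j * G j)); last first.
  by apply/funext => u; rewrite fct_sumE.
have dcG j : derivable (c j * G j) x v.
  by apply: diff_derivable; exact: differentiableM.
rewrite derive_sum//; apply: eq_bigr => j _.
by rewrite deriveM//; apply: diff_derivable.
Qed.

Lemma derive_sumZ (a : 'I_n -> R) G x v : (forall j, differentiable (G j) x) ->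
  'D_v (fun u => \sum_j a j * G j u : R^o) x = \sum_j a j * 'D_v (G j) x.
Proof.
move=> dG; have := @derive_sumM (fun j => cst (a j)) G x v _ dG.
rewrite /= => -> //; apply: eq_bigr => j _.
by rewrite derive_cst mulr0 addr0.
Qed.

End ScalarDerivatives.

Lemma near_open_eq (R : realType) n (W : normedModType R) (U : set 'rV[R]_n)
    (f g : 'rV[R]_n -> W) x v : open U -> U x -> (forall u, U u -> f u = g u) ->
  'D_v f x = 'D_v g x.
Proof.
move=> oU Ux fg; apply: near_eq_derive.
by apply: (@filterS _ _ (nbhs_filter x) U) => //; exact: open_nbhs_nbhs.
Qed.

Section FormCalculus.
Variables (R : realType) (p n k : nat).
Variables (U : set 'rV[R]_p) (W : set 'rV[R]_n) (oU : open U) (oW : open W).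
Variable A : 'rV[R]_n -> ('I_k -> 'rV[R]_n) -> R.
Hypothesis A_lin : forall y, W y -> multilinear_form (A y).
Hypothesis A_smooth : forall v, smooth_on W (fun y => A y v : R^o).
Variable phi : 'rV[R]_p -> 'rV[R]_n.
Hypotheses (phi_smooth : smooth_on U phi) (phiW : forall u, U u -> W (phi u)).

Let e (j : 'I_n) : 'rV[R]_n := delta_mx 0 j.

Let expand y (v : 'I_k -> 'rV[R]_n) i (x : 'rV[R]_n) : W y ->
  A y (dfwith v i x) = \sum_j x 0 j * A y (dfwith v i (e j)).
Proof.
move=> Wy; rewrite {1}[x]matrix_sum_delta big_ord1.
exact: (multilinear_sum (A_lin Wy)).
Qed.

Let expand_same y (v : 'I_k -> 'rV[R]_n) i : W y ->
  A y v = \sum_j v i 0 j * A y (dfwith v i (e j)).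
Proof. by move=> Wy; rewrite -expand// dfwith_same. Qed.

Let dA y v : W y -> differentiable (fun y => A y v : R^o) y.
Proof. by move=> Wy; exact: smooth_on_differentiable (A_smooth v) Wy. Qed.

(** Leibniz rule for a form whose base point and arguments all move. Smoothness of [A] is known only
    for constant arguments, so the induction is on the number of moving ones: expanding an argument
    in the standard basis replaces it by constant vectors with scalar coefficients. *)
Lemma form_smooth_derive (w : 'I_k -> 'rV[R]_p -> 'rV[R]_n) :
  (forall i, smooth_on U (w i)) ->
  smooth_on U (fun u => A (phi u) (fun i => w i u) : R^o) /\
  forall u v, U u ->
    'D_v (fun u => A (phi u) (fun i => w i u) : R^o) u =
    'D_('D_v phi u) (fun y => A y (fun i => w i u) : R^o) (phi u) +
    \sum_i A (phi u) (dfwith (fun i => w i u) i ('D_v (w i) u)).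
Proof.
(* [C m w] says that the arguments of index at least [m] are constant; for m = k this is no
   condition. *)
pose C m (w : 'I_k -> 'rV[R]_p -> 'rV[R]_n) :=
  forall i : 'I_k, (m <= i)%N -> exists c, w i = cst c.
have [m [mk Cm]] : exists m, (m <= k)%N /\ C m w.
  by exists k; split=> // i; rewrite leqNgt ltn_ord.
elim: m w mk Cm => [|m IH] w mk Cw sw.
  have [c wc] : exists c, w = fun i => cst (c i).
    exists (fun i => projT1 (cid (Cw i isT))); apply/funext => i.
    exact: projT2 (cid (Cw i isT)).
  have dp u : U u -> differentiable phi u by exact: smooth_on_differentiable phi_smooth.
  rewrite wc; split=> [l|u v Uu].
    exact (Ck_on_comp_scalar oU phiW (A_smooth c l) (phi_smooth l)).
  rewrite big1 ?addr0; last first.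
    by move=> i _; rewrite derive_cst (multilinear0 (A_lin (phiW Uu))).
  rewrite -derive_comp; [by []|exact: dp|].
  exact/dA/phiW.
pose i0 : 'I_k := Ordinal mk.
pose w' j := dfwith w i0 (cst (e j)).
have sw' j i : smooth_on U (w' j i).
  rewrite /w'; have [->|ii0] := eqVneq i i0; first by rewrite dfwithin; exact: smooth_on_cst.
  by rewrite dfwithout 1?eq_sym.
have Cw' j : C m (w' j).
  move=> i mi; rewrite /w'; have [->|ii0] := eqVneq i i0.
    by rewrite dfwithin; exists (e j).
  rewrite dfwithout 1?eq_sym//; apply: Cw.
  by rewrite ltn_neqAle mi andbT; apply: contraNneq ii0 => mE; apply/eqP/val_inj.
have IHj j := IH (w' j) (ltnW mk) (Cw' j) (sw' j).
have w'E j u : (fun i => w' j i u) = dfwith (fun i => w i u) i0 (e j).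
  exact: (comp_dfwith (fun f : 'rV[R]_p -> 'rV[R]_n => f u)).
pose c j u : R^o := w i0 u 0 j.
pose G j u : R^o := A (phi u) (fun i => w' j i u).
have FE u : U u -> A (phi u) (fun i => w i u) = \sum_j c j u * G j u.
  move=> Uu; rewrite (expand_same _ i0 (phiW Uu)); apply: eq_bigr => j _.
  by rewrite /G w'E.
have sc j : smooth_on U (c j).
  by move=> l; have /Ck_on_rVP := sw i0 l; apply.
have sG j : smooth_on U (G j) by have [] := IHj j.
split=> [l|u v Uu].
  apply: (Ck_on_eq oU (f := fun u => \sum_j c j u * G j u : R^o)).
    by move=> u Uu; rewrite FE.
  apply: (@Ck_on_sum _ _ _ _ _ _ (index_enum 'I_n) (fun j u => c j u * G j u : R^o)) => // j.
  exact: Ck_onM oU (sc j l) (sG j l).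
have dc j : differentiable (c j) u by exact: smooth_on_differentiable (sc j) Uu.
have dG j : differentiable (G j) u by exact: smooth_on_differentiable (sG j) Uu.
rewrite (near_open_eq v oU Uu FE) derive_sumM// big_split /=.
have WP := phiW Uu; set P := phi u in WP *.
set w0 := fun i => w i u; set psi := 'D_v phi u.
have E1 : \sum_j G j u * 'D_v (c j) u = A P (dfwith w0 i0 ('D_v (w i0) u)).
  rewrite (expand _ i0 _ WP); apply: eq_bigr => j _.
  rewrite /G w'E mulrC; congr (_ * _); rewrite derive_coord//.
  by apply: diff_derivable; exact: smooth_on_differentiable (sw i0) Uu.
have E2 : 'D_psi (fun y => A y w0 : R^o) P =
    \sum_j w0 i0 0 j * 'D_psi (fun y => A y (dfwith w0 i0 (e j)) : R^o) P.
  rewrite -(@derive_sumZ _ _ _ (fun j => w0 i0 0 j) (fun j y => A y (dfwith w0 i0 (e j)))).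
    by apply: near_open_eq oW WP _ => y Wy; exact: expand_same.
  by move=> j; exact: dA.
have E3 i : i != i0 -> A P (dfwith w0 i ('D_v (w i) u)) =
    \sum_j w0 i0 0 j * A P (dfwith (fun i => w' j i u) i ('D_v (w' j i) u)).
  move=> ii0; have i0i : i0 != i by rewrite eq_sym.
  rewrite -[X in A P X](dfwith_same _ i0) (expand _ i0 _ WP).
  apply: eq_bigr => j _; rewrite dfwithout//; congr (_ * A P _).
  by rewrite w'E dfwithC// /w' dfwithout.
(* The derivatives of the coefficients give the term of index [i0]. The rest is the induction
   hypothesis for the [w' j], whose own term of index [i0] vanishes because that argument is
   constant. *)
rewrite addrC E1 E2 [in RHS](bigD1 i0)//= addrCA; congr (_ + _).
rewrite (eq_bigr _ E3) exchange_big -big_split /=; apply: eq_bigr => j _.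
rewrite -mulr_sumr -mulrDr; congr (_ * _).
have [_ ->//] := IHj j; rewrite w'E (bigD1 i0)//=; congr (_ + _).
rewrite [X in X + _](_ : _ = 0) ?add0r//.
  by rewrite /w' dfwithin derive_cst (multilinear0 (A_lin WP)).
Qed.

End FormCalculus.

Section Forms.
Variable R : realType.
Implicit Types M N L : premanifold R.

Lemma dformD M k (a b : dform M k) x v : (a + b) x v = a x v + b x v.
Proof. by []. Qed.

Lemma dformN M k (a : dform M k) x v : (- a) x v = - a x v.
Proof. by []. Qed.

Lemma pullback_comp M N L (f : M -> N) (g : N -> L) k (a : dform L k) x v :
  has_atlas M -> has_atlas N -> has_atlas L -> smooth_map f -> smooth_map g ->
  carrier x ->
  pullback (g \o f) a x v = pullback f (pullback g a) x v.
Proof.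
move=> hM hN hL sf sg cx; rewrite /pullback /=; congr (a _ _).
by apply/funext => i; exact: tmap_comp.
Qed.

Lemma pullback_eq M N (f g : M -> N) k (a : dform N k) x v :
  has_atlas M -> has_atlas N -> (forall x, carrier x -> f x = g x) ->
  smooth_map f -> carrier x -> pullback f a x v = pullback g a x v.
Proof.
move=> hM hN fg sf cx.
have E : (fun i => tmap f x (v i)) = (fun i => tmap g x (v i)).
  by apply/funext => i; exact: tmap_eq.
exact: (f_equal2 a (fg x cx) E).
Qed.

Section Pullback.
Variables (M N : premanifold R) (hM : has_atlas M) (hN : has_atlas N).
Variables (f : M -> N) (sf : smooth_map f) (k : nat) (a : dform N k).

(** On [rep_dom], [f] after the inverse chart at [x] equals the inverse chart at [y] after the
    coordinate expression of [f]; differentiate both sides. Leaving [y] free lets smoothness be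
    checked with a chart around the image of each point. *)
Lemma pullback_in_chart x y u v : carrier x -> carrier y -> rep_dom f x y u ->
  dform_in_chart (pullback f a) (x := x) u v =
  dform_in_chart a (x := y) (cmap (chart_at y) (f (cinv (chart_at x) u)))
    (fun i => 'D_(v i) (fun u => cmap (chart_at y) (f (cinv (chart_at x) u))) u).
Proof.
move=> cx cy Du; pose phi w := cmap (chart_at y) (f (cinv (chart_at x) w)).
have oD := open_rep hM hN sf cx cy; set D := rep_dom f x y in oD Du.
have hD := euclid_atlas oD; have hx := euclid_atlas (open_coord_img hM cx).
have hy := euclid_atlas (open_coord_img hN cy).
have sx := smooth_cinv hM cx; have sy := smooth_cinv hN cy.
have sxD : @smooth_map R (euclidean_open D) M (cinv (chart_at x)).
  by apply: smooth_euclid_sub sx => // w [].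
have DP w : D w -> [/\ carrier (cinv (chart_at x) w), carrier (f (cinv (chart_at x) w)) &
    cdom (chart_at y) (f (cinv (chart_at x) w))].
  by move=> [/(coord_imgP hM cx)[cw _ _] dw]; split=> //; exact: smooth_carrier.
have sphi : @smooth_map R (euclidean_open D) (euclidean_open (coord_img y)) phi.
  apply: smooth_on_euclid => //; first exact: smooth_rep.
  by move=> w /DP[_ cw dw]; exact: coord_img_cmap.
have phiK w : D w -> cinv (chart_at y) (phi w) = f (cinv (chart_at x) w).
  by move=> /DP[_ cw dw]; rewrite /phi cmapK.
have uM := DP u Du.
rewrite /dform_in_chart /pullback -/(phi u) phiK//; congr (a _ _).
apply/funext => i.
have e1 := tmap_comp hD hM hN sxD sf (v i) Du.
have e2 := tmap_comp hD hy hN sphi sy (v i) Du.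
have e3 := @tmap_eq R (euclidean_open D) N _ _ u (v i) hD hN phiK (smooth_map_comp hD hy hN sphi sy) Du.
rewrite -[LHS]e1 -[LHS]e3 [LHS]e2; congr (tmap _ _ _).
by rewrite (tmapE hD hy _ sphi Du).
Qed.

Hypothesis a_form : is_dform a.

Lemma in_chart_multilinear y u : carrier y -> coord_img y u ->
  multilinear_form (dform_in_chart a (x := y) u).
Proof.
move=> cy iu v i r x w; have [cu _ _] := coord_imgP hN cy iu.
rewrite /dform_in_chart /pullback.
have e := comp_dfwith (@tmap R (euclidean_open (coord_img y)) N (cinv (chart_at y)) u).
by rewrite !e tmapD tmapZ; exact: (dform_multilinear a_form cu).
Qed.

Lemma in_chart_alternating y u : carrier y -> coord_img y u ->
  alternating_form (dform_in_chart a (x := y) u).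
Proof.
move=> cy iu v i j ij vij; have [cu _ _] := coord_imgP hN cy iu.
by apply: (dform_alternating a_form cu ij); rewrite vij.
Qed.

Lemma rep_derive_smooth x y (v : 'rV[R]_(mdim M)) : carrier x -> carrier y ->
  smooth_on (rep_dom f x y)
    (fun u => 'D_v (fun u => cmap (chart_at y) (f (cinv (chart_at x) u))) u).
Proof.
by move=> cx cy l; have [_] := smooth_rep hM hN sf cx cy l.+1; exact.
Qed.

Lemma pullback_is_dform : is_dform (pullback f a).
Proof.
split=> [x cx v i r u w|x cx v i j ij vij|x cx v].
- have cf := smooth_carrier sf cx; rewrite /pullback.
  have e := comp_dfwith (tmap f x).
  by rewrite !e tmapD tmapZ; exact: (dform_multilinear a_form cf).
- have cf := smooth_carrier sf cx.
  by apply: (dform_alternating a_form cf ij); rewrite vij.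
- apply: smooth_on_local => u iu; have [cu du _] := coord_imgP hM cx iu.
  have cy := smooth_carrier sf cu; set y := f _ in cy.
  exists (rep_dom f x y).
    by split=> //; exact: atlas_mem.
  have oD := open_rep hM hN sf cx cy.
  apply: (smooth_on_eq oD (fun w Dw => esym (pullback_in_chart v cx cy Dw))).
  have DI w : rep_dom f x y w -> coord_img y (cmap (chart_at y) (f (cinv (chart_at x) w))).
    move=> [iw dw]; apply: coord_img_cmap dw; apply: smooth_carrier sf _.
    by have [] := coord_imgP hM cx iw.
  by have [] := @form_smooth_derive R _ _ k (rep_dom f x y) (coord_img y) oD
    (open_coord_img hN cy) (fun u v => dform_in_chart a (x := y) u v)
    (fun u => in_chart_multilinear cy) (dform_smooth a_form cy) _
    (smooth_rep hM hN sf cx cy) DI _ (fun i => rep_derive_smooth (v i) cx cy).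
Qed.

End Pullback.

Lemma derive_rV_commute n m (U : set 'rV[R]_n) (f : 'rV[R]_n -> 'rV[R]_m) x v w :
  open U -> U x -> smooth_on U f ->
  'D_v (fun z => 'D_w f z) x = 'D_w (fun z => 'D_v f z) x.
Proof.
move=> oU Ux sf; have [df Df] := sf 2.
apply/rowP => j.
have dj a b : 'D_b (fun z => 'D_a f z) x 0 j =
    'D_b (fun z => 'D_a (fun y => f y 0 j : R^o) z : R^o) x.
  have [da _] := Df a.
  rewrite derive_coord; last by apply: diff_derivable; exact: da.
  apply: near_open_eq oU Ux _ => u Uu; rewrite derive_coord//.
  by apply: diff_derivable; exact: df.
have cf : Ck_on 2 U (fun y => f y 0 j : R^o) by have /Ck_on_rVP := sf 2; apply.
exact (etrans (dj w v) (etrans (derive_commute v w oU Ux cf) (esym (dj v w)))).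
Qed.

Section ExteriorDerivative.
Variables (M N : premanifold R) (hM : has_atlas M) (hN : has_atlas N).
Variables (f : M -> N) (sf : smooth_map f) (k : nat) (a : dform N k).
Hypothesis a_form : is_dform a.

(* In charts, d(f^* a) differs from f^*(d a) by terms in the second derivatives
   of [f], which cancel by symmetry. *)
Lemma ext_d_pullback x v : carrier x ->
  ext_d (pullback f a) x v = pullback f (ext_d a) x v.
Proof.
move=> cx; have cy := smooth_carrier sf cx; set y := f x in cy.
pose phi u := cmap (chart_at y) (f (cinv (chart_at x) u)).
have oD := open_rep hM hN sf cx cy; set D := rep_dom f x y in oD.
have sphi : smooth_on D phi := smooth_rep hM hN sf cx cy.
have Dx : D (coord_pt x) by exact: rep_dom_pt.
have phix : phi (coord_pt x) = coord_pt y by rewrite /phi coord_ptK.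
have iy := coord_img_pt hN cy.
have DI w : D w -> coord_img y (phi w).
  move=> [iw dw]; apply: coord_img_cmap dw; apply: smooth_carrier sf _.
  by have [] := coord_imgP hM cx iw.
have TE w : tmap f x w = 'D_w phi (coord_pt x) by exact: tmapE.
pose A u w := dform_in_chart a (x := y) u w.
have step (i : 'I_k.+1) :
    'D_(v i) (fun u => dform_in_chart (pullback f a) (x := x) u (fun j => v (lift i j)) : R^o)
      (coord_pt x) =
    'D_(tmap f x (v i)) (fun u => A u (fun j => tmap f x (v (lift i j))) : R^o) (coord_pt y) +
    \sum_j A (coord_pt y) (dfwith (fun l => tmap f x (v (lift i l))) j
       ('D_(v i) (fun u => 'D_(v (lift i j)) phi u) (coord_pt x))).
  have e := near_open_eq (v i) oD Dx
    (fun w Dw => pullback_in_chart hM hN sf a (fun j => v (lift i j)) cx cy Dw).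
  have [_ d] := @form_smooth_derive R _ _ k D (coord_img y) oD (open_coord_img hN cy) A
    (fun u => in_chart_multilinear hN a_form cy) (dform_smooth a_form cy) phi sphi DI
    (fun j u => 'D_(v (lift i j)) phi u)
    (fun j => rep_derive_smooth hM hN sf (v (lift i j)) cx cy).
  have := d _ (v i) Dx; rewrite phix.
  have -> : (fun j => 'D_(v (lift i j)) phi (coord_pt x)) =
      (fun j => tmap f x (v (lift i j))) by apply/funext => j; rewrite TE.
  by rewrite -TE; exact: etrans.
rewrite /pullback /ext_d (eq_bigr _ (fun i _ => congr1 (fun z => _ * z) (step i))).
under eq_bigr do rewrite mulrDr.
rewrite big_split /= [X in _ + X](_ : _ = 0) ?addr0//.
apply: (@koszul_cancel _ _ k (A (coord_pt y)) (fun i => tmap f x (v i))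
  (fun i j => 'D_(v i) (fun u => 'D_(v j) phi u) (coord_pt x))).
- exact: in_chart_multilinear.
- exact: in_chart_alternating.
- by move=> i j; exact: derive_rV_commute oD Dx sphi.
Qed.

End ExteriorDerivative.

Lemma dformD_is_dform M k (a b : dform M k) : has_atlas M ->
  is_dform a -> is_dform b -> is_dform (a + b).
Proof.
move=> hM fa fb; split=> [x cx v i r u w|x cx v i j ij vij|x cx v].
- rewrite !dformD (dform_multilinear fa cx) (dform_multilinear fb cx).
  by rewrite mulrDr addrACA.
- by rewrite dformD (dform_alternating fa cx ij vij) (dform_alternating fb cx ij vij) addr0.
- move=> l; exact: Ck_onD (open_coord_img hM cx) (dform_smooth fa cx v l)
    (dform_smooth fb cx v l).
Qed.

Lemma ext_dD M k (a b : dform M k) x v : has_atlas M ->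
  is_dform a -> is_dform b -> carrier x ->
  ext_d (a + b) x v = ext_d a x v + ext_d b x v.
Proof.
move=> hM fa fb cx; rewrite /ext_d -big_split /=; apply: eq_bigr => i _.
rewrite -mulrDr; congr (_ * _).
have ix := coord_img_pt hM cx.
have da := smooth_on_differentiable (dform_smooth fa cx (fun j => v (lift i j))) ix.
have db := smooth_on_differentiable (dform_smooth fb cx (fun j => v (lift i j))) ix.
by rewrite -deriveD//; apply: diff_derivable.
Qed.

End Forms.

(** * Lie groups and Lie groupoids *)

Section TwoForms.
Variables (R : numFieldType) (V : lmodType R) (B : ('I_2 -> V) -> R).
Hypotheses (B_lin : multilinear_form B) (B_alt : alternating_form B).

Lemma comp_vec2 (W : Type) (h : V -> W) v w :
  (fun i => h (vec2 v w i)) = vec2 (h v) (h w).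
Proof. by apply/funext => i; rewrite /vec2; case: ifP. Qed.

Lemma vec2_dfwith0 (v v' w : V) : dfwith (vec2 v' w) ord0 v = vec2 v w.
Proof.
apply/funext => i; have [->|] := eqVneq i ord0; first by rewrite dfwithin.
by rewrite eq_sym => i0; rewrite dfwithout//; move: i0; case: i => -[|[|]].
Qed.

Lemma vec2_0l w : B (vec2 0 w) = 0.
Proof. by rewrite -(vec2_dfwith0 0 0); exact: multilinear0. Qed.

Lemma vec2_skew v w : B (vec2 v w) = - B (vec2 w v).
Proof.
rewrite -(@alternating_tperm _ _ _ B B_lin B_alt (vec2 w v) ord0 ord_max)//.
congr B; apply/funext => i /=; case: tpermP => [->|->|] //.
by case: i => -[|[|//]] p i0 i1; [case: i0|case: i1]; exact: val_inj.
Qed.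

Lemma vec2_0r v : B (vec2 v 0) = 0.
Proof. by rewrite vec2_skew vec2_0l oppr0. Qed.

Lemma vec2Dl v v' w : B (vec2 (v + v') w) = B (vec2 v w) + B (vec2 v' w).
Proof. rewrite -(vec2_dfwith0 (v + v') 0 w) -(vec2_dfwith0 v 0 w) -(vec2_dfwith0 v' 0 w).
exact: multilinearD. Qed.

Lemma vec2Dr v w w' : B (vec2 v (w + w')) = B (vec2 v w) + B (vec2 v w').
Proof. by rewrite vec2_skew vec2Dl opprD -!vec2_skew. Qed.

End TwoForms.

Section LieGroups.
Variables (R : realType) (K : pre_lie_group R) (hK : is_lie_group K).

Lemma group_atlas : has_atlas K.
Proof. exact: manifold_atlas (lg_manifold hK). Qed.

Local Notation mulK := (fun p : K * K => gmul p.1 p.2).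

Definition tmul (a b : K) (u v : tangent K) : tangent K :=
  @tmap R (prod_mfd K K) K mulK (a, b) (row_mx u v).

Lemma tmul_maps (N : premanifold R) (k1 k2 : N -> K) x v :
  has_atlas N -> smooth_map k1 -> smooth_map k2 -> carrier x ->
  @tmap R N K (fun x => gmul (k1 x) (k2 x)) x v =
  tmul (k1 x) (k2 x) (tmap k1 x v) (tmap k2 x v).
Proof.
move=> hN s1 s2 cx; have hKK := prod_atlas group_atlas group_atlas.
have sp := smooth_pair group_atlas group_atlas hN s1 s2.
rewrite /tmul -(tmap_pair group_atlas group_atlas hN s1 s2)//.
exact (tmap_comp hN hKK group_atlas sp (lg_mul_smooth hK) v cx).
Qed.

Lemma smooth_mul_maps (N : premanifold R) (k1 k2 : N -> K) :
  has_atlas N -> smooth_map k1 -> smooth_map k2 ->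
  @smooth_map R N K (fun x => gmul (k1 x) (k2 x)).
Proof.
move=> hN s1 s2; have hKK := prod_atlas group_atlas group_atlas.
exact (smooth_map_comp hN hKK group_atlas
  (smooth_pair group_atlas group_atlas hN s1 s2) (lg_mul_smooth hK)).
Qed.

Lemma tmul0 a b : tmul a b 0 0 = 0.
Proof. by rewrite /tmul row_mx0 tmap0. Qed.

Lemma tmulD a b u u' v v' : tmul a b (u + u') (v + v') = tmul a b u v + tmul a b u' v'.
Proof. by rewrite /tmul -add_row_mx tmapD. Qed.

Lemma group_inv_carrier (a : K) : carrier a -> carrier (ginv a).
Proof. exact: smooth_carrier (lg_inv_smooth hK). Qed.

Lemma group_inv_unique a b : carrier a -> carrier b -> gmul a b = gone K -> a = ginv b.
Proof.
move=> ca cb ab; have cb' := group_inv_carrier cb.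
by rewrite -(lg_mulg1 hK ca) -(lg_mulgV hK cb) (lg_mulA hK)// ab (lg_mul1g hK).
Qed.

(** The vector [z] is the image of [w] under right translation by the inverse of [k]: the two
    translations compose to the identity. *)
Lemma right_translation_surj k w : carrier k -> exists z, tmul (gone K) k z 0 = w.
Proof.
move=> ck; have ck' := group_inv_carrier ck; have hA := group_atlas.
have c1 := lg_one hK.
have si : @smooth_map R K K id := smooth_map_id hA.
have sc c : carrier c -> @smooth_map R K K (fun=> c) by exact: smooth_map_cst.
have sr c : carrier c -> @smooth_map R K K (fun x => gmul x c).
  by move=> cc; apply: smooth_mul_maps => //; exact: sc.
have srr : @smooth_map R K K (fun x => gmul (gmul x (ginv k)) k).
  exact (smooth_map_comp hA hA hA (sr _ ck') (sr _ ck)).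
exists (tmap (fun x => gmul x (ginv k)) k w).
have E x : carrier x -> gmul (gmul x (ginv k)) k = id x.
  by move=> cx; rewrite -(lg_mulA hK)// (lg_mulVg hK)// (lg_mulg1 hK).
have := tmap_eq w hA hA E srr ck; rewrite (tmap_id w hA ck).
rewrite (tmul_maps w hA (sr _ ck') (sc _ ck) ck) (tmap_cst w hA hA ck ck).
by rewrite (lg_mulgV hK).
Qed.

End LieGroups.

Lemma submersion_transverse (R : realType) (M N L : premanifold R) (f : M -> L) (g : N -> L) :
  submersion f -> transverse f g.
Proof.
move=> [_ fS] x y cx _ _ w; have [v vE] := fS x cx w.
by exists v, 0; rewrite tmap0 addr0.
Qed.

Section LieGroupoids.
Variables (R : realType) (G : pre_groupoid R) (hG : is_lie_groupoid G).
Local Notation C := (composable G).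
Local Notation T := (tangent (arr G)).

Lemma arr_atlas : has_atlas (arr G).
Proof. exact: manifold_atlas (gd_arr_manifold hG). Qed.

Lemma obj_atlas : has_atlas (obj G).
Proof. exact: manifold_atlas (gd_obj_manifold hG). Qed.

Let ha := arr_atlas.
Let ho := obj_atlas.

Lemma smooth_src : smooth_map (@src _ G). Proof. by case: (gd_src hG). Qed.
Lemma smooth_tgt : smooth_map (@tgt _ G). Proof. by case: (gd_tgt hG). Qed.
Let ss := smooth_src.
Let st := smooth_tgt.
Let si : smooth_map (@idn _ G) := gd_idn_smooth hG.
Let sv : smooth_map (@inverse _ G) := gd_inverse_smooth hG.

Lemma src_tgt_transverse : transverse (@src _ G) (@tgt _ G).
Proof. exact/submersion_transverse/(gd_src hG). Qed.
Let tr := src_tgt_transverse.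

Lemma composable_atlas : has_atlas C.
Proof. exact (fibre_product_atlas ha ha ho ss st tr). Qed.
Let hC := composable_atlas.

Let sm : @smooth_map R C (arr G) (fun p : arr G * arr G => mult p.1 p.2) :=
  gd_mult_smooth hG.
Let s1 : @smooth_map R C (arr G) (fun p : arr G * arr G => p.1) :=
  smooth_fibre_fst ha ha ho ss st tr.
Let s2 : @smooth_map R C (arr G) (fun p : arr G * arr G => p.2) :=
  smooth_fibre_snd ha ha ho ss st tr.

(* The differential of the multiplication; a relation, since [xi] and [eta] have
   a product only when [tmap src xi = tmap tgt eta]. *)
Definition tmult (g h : arr G) (xi eta zeta : T) : Prop :=
  exists v : tangent C,
    [/\ @tmap R C (arr G) (fun p : arr G * arr G => p.1) (g, h) v = xi,
        @tmap R C (arr G) (fun p : arr G * arr G => p.2) (g, h) v = eta &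
        @tmap R C (arr G) (fun p : arr G * arr G => mult p.1 p.2) (g, h) v = zeta].

Section TangentMultiplication.
Variables (g h : arr G) (cg : carrier g) (ch : carrier h) (gh : src g = tgt h).

Let cgh : @carrier R C (g, h). Proof. by split. Qed.

Lemma tmult_ex xi eta : tmap (@src _ G) g xi = tmap (@tgt _ G) h eta ->
  exists zeta, tmult g h xi eta zeta.
Proof.
move=> E; have [v [v1 v2]] := fibre_tangent_ex ha ha ho ss st tr cgh E.
by exists (@tmap R C (arr G) (fun p : arr G * arr G => mult p.1 p.2) (g, h) v), v.
Qed.

Lemma tmult_fun xi eta zeta zeta' :
  tmult g h xi eta zeta -> tmult g h xi eta zeta' -> zeta = zeta'.
Proof.
move=> [v [v1 v2 <-]] [w [w1 w2 <-]].
suff -> : v = w by [].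
by apply: (fibre_tangent_inj ha ha ho ss st tr cgh); rewrite ?v1 ?v2 ?w1 ?w2.
Qed.

Lemma tmult0 : tmult g h 0 0 0.
Proof. by exists 0; rewrite !tmap0. Qed.

Lemma tmult_src xi eta zeta : tmult g h xi eta zeta ->
  tmap (@src _ G) (mult g h) zeta = tmap (@src _ G) h eta.
Proof.
move=> [v [_ <- <-]].
have e1 := tmap_comp hC ha ho sm ss v cgh.
have e2 := tmap_comp hC ha ho s2 ss v cgh.
have e3 := tmap_eq v hC ho _ (smooth_map_comp hC ha ho sm ss) cgh.
apply: (etrans (esym e1)); apply: (etrans (e3 _ _)) e2 => p [c1 c2 E].
exact: gd_src_mult.
Qed.

Lemma tmult_tgt xi eta zeta : tmult g h xi eta zeta ->
  tmap (@tgt _ G) (mult g h) zeta = tmap (@tgt _ G) g xi.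
Proof.
move=> [v [<- _ <-]].
have e1 := tmap_comp hC ha ho sm st v cgh.
have e2 := tmap_comp hC ha ho s1 st v cgh.
have e3 := tmap_eq v hC ho _ (smooth_map_comp hC ha ho sm st) cgh.
apply: (etrans (esym e1)); apply: (etrans (e3 _ _)) e2 => p [c1 c2 E].
exact: gd_tgt_mult.
Qed.

End TangentMultiplication.

Section MultMaps.
Variables (N : premanifold R) (hN : has_atlas N) (k1 k2 : N -> arr G).
Hypotheses (sk1 : smooth_map k1) (sk2 : smooth_map k2).
Hypothesis k12 : forall x, carrier x -> src (k1 x) = tgt (k2 x).

Lemma smooth_composable_maps : @smooth_map R N C (fun x => (k1 x, k2 x)).
Proof.
exact (smooth_fibre_corestr ha ha ho ss st tr hN (smooth_pair ha ha hN sk1 sk2) k12).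
Qed.

Lemma smooth_mult_maps : @smooth_map R N (arr G) (fun x => mult (k1 x) (k2 x)).
Proof. exact (smooth_map_comp hN hC ha smooth_composable_maps sm). Qed.

Lemma tmult_maps x v : carrier x ->
  tmult (k1 x) (k2 x) (tmap k1 x v) (tmap k2 x v)
    (@tmap R N (arr G) (fun x => mult (k1 x) (k2 x)) x v).
Proof.
move=> cx; have sk := smooth_composable_maps.
exists (@tmap R N C (fun x => (k1 x, k2 x)) x v); split.
- exact (esym (tmap_comp hN hC ha sk s1 v cx)).
- exact (esym (tmap_comp hN hC ha sk s2 v cx)).
- exact (esym (tmap_comp hN hC ha sk sm v cx)).
Qed.

End MultMaps.

Lemma idn_carrier x : carrier x -> carrier (idn x : arr G).
Proof. exact: smooth_carrier si. Qed.

Lemma inverse_carrier (g : arr G) : carrier g -> carrier (inverse g).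
Proof. exact: smooth_carrier sv. Qed.

Lemma inverseK (g : arr G) : carrier g -> inverse (inverse g) = g.
Proof.
move=> cg; have cv := inverse_carrier cg; have cvv := inverse_carrier cv.
rewrite -(gd_mult_idn hG cvv) (gd_src_inverse hG cv) (gd_tgt_inverse hG cg).
rewrite -(gd_inverse_mult hG cg) (gd_multA hG)//; first last.
- exact: gd_src_inverse.
- by rewrite gd_src_inverse.
by rewrite (gd_inverse_mult hG cv) (gd_src_inverse hG cg) (gd_idn_mult hG).
Qed.

Lemma tsrc_idn x w : carrier x -> tmap (@src _ G) (idn x) (tmap (@idn _ G) x w) = w.
Proof.
move=> cx; have e1 := tmap_comp ho ha ho si ss w cx.
have e2 := tmap_eq w ho ho (gd_src_idn hG) (smooth_map_comp ho ha ho si ss) cx.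
by rewrite -[RHS](tmap_id w ho cx) -e2 e1.
Qed.

(** Differentiates g 1 = g. In the same way [tmult_idn_l], [tmult_inverse_r] and [tmult_cancel_r]
    differentiate 1 g = g, g g^-1 = 1 and (g h) h^-1 = g. *)
Lemma tmult_idn_r (g : arr G) xi : carrier g ->
  tmult g (idn (src g)) xi (tmap (@idn _ G) (src g) (tmap (@src _ G) g xi)) xi.
Proof.
move=> cg; have sid := smooth_map_id ha; have sis := smooth_map_comp ha ho ha ss si.
have E (x : arr G) : carrier x -> src (id x) = tgt ((@idn _ G \o @src _ G) x).
  by move=> cx /=; rewrite (gd_tgt_idn hG)//; exact: smooth_carrier ss _.
have := tmult_maps ha sid sis E xi cg; rewrite (tmap_id xi ha cg).
rewrite (tmap_comp ha ho ha ss si xi cg).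
rewrite (tmap_eq xi ha ha (gd_mult_idn hG) (smooth_mult_maps ha sid sis E) cg).
by rewrite (tmap_id xi ha cg).
Qed.

Lemma tmult_idn_l (g : arr G) xi : carrier g ->
  tmult (idn (tgt g)) g (tmap (@idn _ G) (tgt g) (tmap (@tgt _ G) g xi)) xi xi.
Proof.
move=> cg; have sid := smooth_map_id ha; have sit := smooth_map_comp ha ho ha st si.
have E (x : arr G) : carrier x -> src ((@idn _ G \o @tgt _ G) x) = tgt (id x).
  by move=> cx /=; rewrite (gd_src_idn hG)//; exact: smooth_carrier st _.
have := tmult_maps ha sit sid E xi cg; rewrite (tmap_id xi ha cg).
rewrite (tmap_comp ha ho ha st si xi cg).
rewrite (tmap_eq xi ha ha (gd_idn_mult hG) (smooth_mult_maps ha sit sid E) cg).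
by rewrite (tmap_id xi ha cg).
Qed.

Lemma tmult_inverse_r (g : arr G) xi : carrier g ->
  tmult g (inverse g) xi (tmap (@inverse _ G) g xi)
    (tmap (@idn _ G) (tgt g) (tmap (@tgt _ G) g xi)).
Proof.
move=> cg; have sid := smooth_map_id ha.
have E (x : arr G) : carrier x -> src (id x) = tgt (inverse x).
  by move=> cx; rewrite (gd_tgt_inverse hG).
have := tmult_maps ha sid sv E xi cg; rewrite (tmap_id xi ha cg).
rewrite (tmap_eq xi ha ha (gd_mult_inverse hG) (smooth_mult_maps ha sid sv E) cg).
by rewrite -(tmap_comp ha ho ha st si xi cg).
Qed.

Lemma tmult_cancel_r (g h : arr G) xi eta zeta :
  carrier g -> carrier h -> src g = tgt h -> tmult g h xi eta zeta ->
  tmult (mult g h) (inverse h) zeta (tmap (@inverse _ G) h eta) xi.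
Proof.
move=> cg ch gh [v [<- <- <-]].
have cgh : @carrier R C (g, h) by split.
have sv2 := smooth_map_comp hC ha ha s2 sv.
have E (p : C) : carrier p -> src (mult p.1 p.2) = tgt ((@inverse _ G \o (fun p : arr G * arr G => p.2)) p).
  by move=> [c1 c2 e] /=; rewrite (gd_src_mult hG)// (gd_tgt_inverse hG).
have := tmult_maps hC sm sv2 E v cgh.
rewrite (tmap_comp hC ha ha s2 sv v cgh) /=.
have E' (p : C) : carrier p ->
    mult (mult p.1 p.2) ((@inverse _ G \o (fun p : arr G * arr G => p.2)) p) = p.1.
  move=> [c1 c2 e] /=; have c2' := inverse_carrier c2.
  rewrite -(gd_multA hG)// ?(gd_tgt_inverse hG)// (gd_mult_inverse hG)// -e.
  exact: gd_mult_idn.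
by rewrite (tmap_eq v hC ha E' (smooth_mult_maps hC sm sv2 E) cgh).
Qed.

End LieGroupoids.

Section Morphisms.
Variables (R : realType) (G : pre_groupoid R) (hG : is_lie_groupoid G).
Variables (K : pre_lie_group R) (hK : is_lie_group K) (Phi : arr G -> K).
Hypothesis hPhi : is_groupoid_morphism Phi.

Let ha := arr_atlas hG.
Let ho := obj_atlas hG.
Let hk := group_atlas hK.
Let sP : smooth_map Phi := gm_smooth hPhi.

Lemma tmorphism_idn x w : carrier x -> tmap Phi (idn x) (tmap (@idn _ G) x w) = 0.
Proof.
move=> cx; have si := gd_idn_smooth hG; have e1 := tmap_comp ho ha hk si sP w cx.
have e2 := tmap_eq w ho hk (gm_idn hPhi) (smooth_map_comp ho ha hk si sP) cx.
by rewrite -e1 e2 (tmap_cst w ho hk (lg_one hK) cx).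
Qed.

Lemma tmorphism_mult (g h : arr G) xi eta zeta :
  carrier g -> carrier h -> src g = tgt h -> tmult g h xi eta zeta ->
  tmap Phi (mult g h) zeta = tmul (Phi g) (Phi h) (tmap Phi g xi) (tmap Phi h eta).
Proof.
move=> cg ch gh [v [<- <- <-]]; have hC := composable_atlas hG.
have cgh : @carrier R (composable G) (g, h) by split.
have tr := src_tgt_transverse hG.
have ss := smooth_src hG; have st := smooth_tgt hG.
have s1 := smooth_fibre_fst ha ha ho ss st tr.
have s2 := smooth_fibre_snd ha ha ho ss st tr.
have sP1 := smooth_map_comp hC ha hk s1 sP.
have sP2 := smooth_map_comp hC ha hk s2 sP.
have sm := gd_mult_smooth hG.
have e1 := tmap_comp hC ha hk sm sP v cgh.
have e2 := tmul_maps hK v hC sP1 sP2 cgh.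
rewrite (tmap_comp hC ha hk s1 sP v cgh) (tmap_comp hC ha hk s2 sP v cgh) in e2.
apply: (etrans (esym e1)); apply: etrans _ e2.
apply: (tmap_eq v hC hk _ (smooth_map_comp hC ha hk sm sP) cgh).
by move=> p [c1 c2 e]; exact: gm_mult.
Qed.

Lemma morphism_carrier g : carrier g -> carrier (Phi g).
Proof. exact: smooth_carrier sP. Qed.

Lemma morphism_inverse g : carrier g -> Phi (inverse g) = ginv (Phi g).
Proof.
move=> cg; have cv := inverse_carrier hG cg.
apply: (group_inv_unique hK); [exact: morphism_carrier|exact: morphism_carrier|].
rewrite -(gm_mult hPhi)// ?(gd_src_inverse hG)// (gd_inverse_mult hG)//.
by apply: gm_idn => //; exact: smooth_carrier (smooth_src hG) _.
Qed.

(* [c] is the right translate of [b] by [h]. *)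
Lemma tmorphism_translate h b : carrier h ->
  tmap (@src _ G) (idn (tgt h)) b = 0 ->
  exists c, tmap (@src _ G) h c = 0 /\
    tmap Phi h c = tmul (gone K) (Phi h) (tmap Phi (idn (tgt h)) b) 0.
Proof.
move=> ch b0; have ct := smooth_carrier (smooth_tgt hG) ch.
have c1 := idn_carrier hG ct; have e : src (idn (tgt h) : arr G) = tgt h by exact: gd_src_idn.
have [|c cP] := tmult_ex hG c1 ch e (xi := b) (eta := 0); first by rewrite b0 tmap0.
have := tmult_src hG c1 ch e cP; have := tmorphism_mult c1 ch e cP.
rewrite (gd_idn_mult hG)// !tmap0 (gm_idn hPhi)// => tP tS.
by exists c.
Qed.

End Morphisms.

(** * Fibre products of Lie groupoids *)

Section FibreGroupoids.
Variables (R : realType) (G1 G2 : pre_groupoid R).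
Variables (hG1 : is_lie_groupoid G1) (hG2 : is_lie_groupoid G2).
Variables (K : pre_lie_group R) (hK : is_lie_group K).
Variables (Phi : arr G1 -> K) (Psi : arr G2 -> K).
Hypotheses (hPhi : is_groupoid_morphism Phi) (hPsi : is_groupoid_morphism Psi).
Hypothesis tr : transverse Phi Psi.
Local Notation F := (@fibre_groupoid R G1 G2 K Phi Psi).

Let h1 := arr_atlas hG1.
Let h2 := arr_atlas hG2.
Let o1 := obj_atlas hG1.
Let o2 := obj_atlas hG2.
Let hk := group_atlas hK.
Let sP1 := gm_smooth hPhi.
Let sP2 := gm_smooth hPsi.

Section RestrictedTransversality.
Variables (g1 : arr G1) (g2 : arr G2).
Hypotheses (c1 : carrier g1) (c2 : carrier g2) (e12 : Phi g1 = Psi g2).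

(* Translating to the units, where vectors can be corrected by the unit map
   without changing their image, the vectors in [transverse] can be taken
   tangent to the source fibres. *)
Lemma transverse_on_source_fibres w : exists v1 v2,
  [/\ tmap (@src _ G1) g1 v1 = 0, tmap (@src _ G2) g2 v2 = 0 &
      tmap Phi g1 v1 + tmap Psi g2 v2 = w].
Proof.
have ck := morphism_carrier hPhi c1.
have [z <-] := right_translation_surj hK w ck.
have x1 := smooth_carrier (smooth_tgt hG1) c1.
have x2 := smooth_carrier (smooth_tgt hG2) c2.
have i1 := idn_carrier hG1 x1; have i2 := idn_carrier hG2 x2.
have e : Phi (idn (tgt g1)) = Psi (idn (tgt g2)) by rewrite !gm_idn.
have [z1 [z2 zE]] := tr i1 i2 e z.
pose b1 := z1 - tmap (@idn _ G1) (tgt g1) (tmap (@src _ G1) (idn (tgt g1)) z1).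
pose b2 := z2 - tmap (@idn _ G2) (tgt g2) (tmap (@src _ G2) (idn (tgt g2)) z2).
have sb1 : tmap (@src _ G1) (idn (tgt g1)) b1 = 0.
  by rewrite /b1 tmapB tsrc_idn// subrr.
have sb2 : tmap (@src _ G2) (idn (tgt g2)) b2 = 0.
  by rewrite /b2 tmapB tsrc_idn// subrr.
have [v1 [s1 p1]] := tmorphism_translate hG1 hK hPhi c1 sb1.
have [v2 [s2 p2]] := tmorphism_translate hG2 hK hPsi c2 sb2.
exists v1, v2; split=> //; rewrite p1 p2 -e12 -tmulD addr0; congr (tmul _ _ _ _).
have q1 : tmap Phi (idn (tgt g1)) b1 = tmap Phi (idn (tgt g1)) z1.
  by rewrite /b1 tmapB (tmorphism_idn hG1 hK hPhi)// subr0.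
have q2 : tmap Psi (idn (tgt g2)) b2 = tmap Psi (idn (tgt g2)) z2.
  by rewrite /b2 tmapB (tmorphism_idn hG2 hK hPsi)// subr0.
by rewrite q1 q2.
Qed.

End RestrictedTransversality.

Let hY : has_atlas (arr F) := fibre_product_atlas h1 h2 hk sP1 sP2 tr.
Let hO : has_atlas (obj F) := prod_atlas o1 o2.

Lemma smooth_fibre_arr1 : @smooth_map R (arr F) (arr G1) (fun p : arr G1 * arr G2 => p.1).
Proof. exact (smooth_fibre_fst h1 h2 hk sP1 sP2 tr). Qed.

Lemma smooth_fibre_arr2 : @smooth_map R (arr F) (arr G2) (fun p : arr G1 * arr G2 => p.2).
Proof. exact (smooth_fibre_snd h1 h2 hk sP1 sP2 tr). Qed.
Let s1 := smooth_fibre_arr1.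
Let s2 := smooth_fibre_arr2.

Let ss1 := smooth_map_comp hY h1 o1 s1 (smooth_src hG1).
Let ss2 := smooth_map_comp hY h2 o2 s2 (smooth_src hG2).
Let st1 := smooth_map_comp hY h1 o1 s1 (smooth_tgt hG1).
Let st2 := smooth_map_comp hY h2 o2 s2 (smooth_tgt hG2).

Let ssF : smooth_map (@src _ F) := smooth_pair o1 o2 hY ss1 ss2.
Let stF : smooth_map (@tgt _ F) := smooth_pair o1 o2 hY st1 st2.

Lemma tsrc_fibre (p : arr F) v : carrier p -> tmap (@src _ F) p v =
  row_mx (tmap (@src _ G1) p.1 (@tmap R (arr F) (arr G1) (fun p : arr G1 * arr G2 => p.1) p v))
         (tmap (@src _ G2) p.2 (@tmap R (arr F) (arr G2) (fun p : arr G1 * arr G2 => p.2) p v)).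
Proof.
move=> cp; have e := tmap_pair o1 o2 hY ss1 ss2 v cp.
rewrite (tmap_comp hY h1 o1 s1 (smooth_src hG1) v cp) in e.
by rewrite (tmap_comp hY h2 o2 s2 (smooth_src hG2) v cp) in e.
Qed.

Lemma ttgt_fibre (p : arr F) v : carrier p -> tmap (@tgt _ F) p v =
  row_mx (tmap (@tgt _ G1) p.1 (@tmap R (arr F) (arr G1) (fun p : arr G1 * arr G2 => p.1) p v))
         (tmap (@tgt _ G2) p.2 (@tmap R (arr F) (arr G2) (fun p : arr G1 * arr G2 => p.2) p v)).
Proof.
move=> cp; have e := tmap_pair o1 o2 hY st1 st2 v cp.
rewrite (tmap_comp hY h1 o1 s1 (smooth_tgt hG1) v cp) in e.
by rewrite (tmap_comp hY h2 o2 s2 (smooth_tgt hG2) v cp) in e.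
Qed.

(** The two components of [w] are lifted separately. The lifts may have different images in T K; the
    difference is removed by vectors tangent to the source fibres, which leaves the sources
    unchanged. *)
Lemma fibre_src_submersion : submersion (@src _ F).
Proof.
split=> [|p cp w]; first exact: ssF.
have [c1 c2 e] := cp.
have [_ /(_ _ c1 (lsubmx w))[v1 v1E]] := gd_src hG1.
have [_ /(_ _ c2 (rsubmx w))[v2 v2E]] := gd_src hG2.
have [u1 [u2 [u1E u2E uE]]] :=
  transverse_on_source_fibres c1 c2 e (tmap Psi p.2 v2 - tmap Phi p.1 v1).
have E : tmap Phi p.1 (v1 + u1) = tmap Psi p.2 (v2 - u2).
  rewrite tmapD tmapB; apply/eqP; rewrite -subr_eq0 opprB; apply/eqP.
  by rewrite -addrA (addrA (tmap Phi p.1 u1)) uE addrAC subrr sub0r subrr.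
have [v [vE1 vE2]] := fibre_tangent_ex h1 h2 hk sP1 sP2 tr cp E.
exists v; rewrite tsrc_fibre// vE1 vE2 tmapD tmapB u1E u2E v1E v2E.
by rewrite addr0 subr0 hsubmxK.
Qed.

Let smooth_idn : smooth_map (@idn _ F).
Proof.
have i1 := smooth_map_comp hO o1 h1 (smooth_fst o1 o2) (gd_idn_smooth hG1).
have i2 := smooth_map_comp hO o2 h2 (smooth_snd o1 o2) (gd_idn_smooth hG2).
apply: (smooth_fibre_corestr h1 h2 hk sP1 sP2 tr hO (smooth_pair h1 h2 hO i1 i2)).
by move=> x [x1 x2] /=; rewrite !gm_idn.
Qed.

Let smooth_inverse : smooth_map (@inverse _ F).
Proof.
have i1 := smooth_map_comp hY h1 h1 s1 (gd_inverse_smooth hG1).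
have i2 := smooth_map_comp hY h2 h2 s2 (gd_inverse_smooth hG2).
apply: (smooth_fibre_corestr h1 h2 hk sP1 sP2 tr hY (smooth_pair h1 h2 hY i1 i2)).
move=> x [x1 x2 e] /=.
by rewrite (morphism_inverse hG1 hK hPhi)// (morphism_inverse hG2 hK hPsi)// e.
Qed.

(** Differentiate tgt o inverse = src at [inverse p], whose inverse is [p]. *)
Lemma fibre_tgt_submersion : submersion (@tgt _ F).
Proof.
split=> [|p cp w]; first exact: stF.
have cv := smooth_carrier smooth_inverse cp.
have [_ /(_ _ cv w)[v vE]] := fibre_src_submersion.
have E (q : arr F) : carrier q -> (@tgt _ F \o @inverse _ F) q = src q.
  by move=> [q1 q2 _]; congr pair; [exact: (gd_tgt_inverse hG1)|exact: (gd_tgt_inverse hG2)].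
have e1 := tmap_comp hY hY hO smooth_inverse stF v cv.
have e2 := tmap_eq v hY hO E (smooth_map_comp hY hY hO smooth_inverse stF) cv.
have e3 : inverse (inverse p) = p.
  case: p cp {w cv v vE e1 e2} => p1 p2 [q1 q2 _].
  by congr pair; [exact: (inverseK hG1)|exact: (inverseK hG2)].
rewrite e3 in e1; exists (tmap (@inverse _ F) (inverse p) v).
by rewrite -vE -e2 e1.
Qed.

Let trF : transverse (@src _ F) (@tgt _ F) := submersion_transverse fibre_src_submersion.
Let hC : has_atlas (composable F) := fibre_product_atlas hY hY hO ssF stF trF.

Let t1 : @smooth_map R (composable F) (arr F) (fun q : arr F * arr F => q.1) :=
  smooth_fibre_fst hY hY hO ssF stF trF.
Let t2 : @smooth_map R (composable F) (arr F) (fun q : arr F * arr F => q.2) :=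
  smooth_fibre_snd hY hY hO ssF stF trF.

Let smooth_mult : @smooth_map R (composable F) (arr F)
  (fun q : arr F * arr F => mult q.1 q.2).
Proof.
have a1 := smooth_map_comp hC hY h1 t1 s1.
have b1 := smooth_map_comp hC hY h1 t2 s1.
have a2 := smooth_map_comp hC hY h2 t1 s2.
have b2 := smooth_map_comp hC hY h2 t2 s2.
have m1 := smooth_mult_maps hG1 hC a1 b1.
have m2 := smooth_mult_maps hG2 hC a2 b2.
have {}m1 := m1 (fun q cq => let: And3 _ _ e := cq in congr1 fst e).
have {}m2 := m2 (fun q cq => let: And3 _ _ e := cq in congr1 snd e).
apply: (smooth_fibre_corestr h1 h2 hk sP1 sP2 tr hC (smooth_pair h1 h2 hC m1 m2)).
move=> q [[x1 x2 ex] [y1 y2 ey] e] /=.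
have e1 := congr1 fst e; have e2 := congr1 snd e.
by rewrite (gm_mult hPhi)// (gm_mult hPsi)// ex ey.
Qed.

Lemma fibre_lie_groupoid : is_lie_groupoid F.
Proof.
split.
- exact: (fibre_product_manifold h1 h2 hk sP1 sP2 tr (gd_arr_manifold hG1)
    (gd_arr_manifold hG2)).
- exact: prod_manifold (gd_obj_manifold hG1) (gd_obj_manifold hG2).
- exact: fibre_src_submersion.
- exact: fibre_tgt_submersion.
- exact: smooth_mult.
- exact: smooth_idn.
- exact: smooth_inverse.
- by move=> [x1 x2] [c1 c2]; congr pair; [exact: (gd_src_idn hG1)|exact: (gd_src_idn hG2)].
- by move=> [x1 x2] [c1 c2]; congr pair; [exact: (gd_tgt_idn hG1)|exact: (gd_tgt_idn hG2)].
- move=> [x1 x2] [y1 y2] [c1 c2 _] [d1 d2 _] [e1 e2].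
  by congr pair; [exact: (gd_src_mult hG1)|exact: (gd_src_mult hG2)].
- move=> [x1 x2] [y1 y2] [c1 c2 _] [d1 d2 _] [e1 e2].
  by congr pair; [exact: (gd_tgt_mult hG1)|exact: (gd_tgt_mult hG2)].
- move=> [x1 x2] [y1 y2] [z1 z2] [a1 a2 _] [b1 b2 _] [c1 c2 _] [d1 d2] [e1 e2].
  by congr pair; [exact: (gd_multA hG1)|exact: (gd_multA hG2)].
- by move=> [x1 x2] [c1 c2 _]; congr pair; [exact: (gd_idn_mult hG1)|exact: (gd_idn_mult hG2)].
- by move=> [x1 x2] [c1 c2 _]; congr pair; [exact: (gd_mult_idn hG1)|exact: (gd_mult_idn hG2)].
- move=> [x1 x2] [c1 c2 _].
  by congr pair; [exact: (gd_src_inverse hG1)|exact: (gd_src_inverse hG2)].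
- move=> [x1 x2] [c1 c2 _].
  by congr pair; [exact: (gd_tgt_inverse hG1)|exact: (gd_tgt_inverse hG2)].
- move=> [x1 x2] [c1 c2 _].
  by congr pair; [exact: (gd_inverse_mult hG1)|exact: (gd_inverse_mult hG2)].
- move=> [x1 x2] [c1 c2 _].
  by congr pair; [exact: (gd_mult_inverse hG1)|exact: (gd_mult_inverse hG2)].
Qed.

End FibreGroupoids.

(** * Multiplicative forms *)

Lemma pullback_factor (R : realType) (M N L : premanifold R) (f : M -> N) (g : N -> L)
    (h : M -> L) k (a : dform L k) x v :
  has_atlas M -> has_atlas N -> has_atlas L -> smooth_map f -> smooth_map g ->
  (forall y, carrier y -> g (f y) = h y) -> carrier x ->
  pullback f (pullback g a) x v = pullback h a x v.
Proof.
move=> hM hN hL sf sg gf cx; rewrite -(pullback_comp a v hM hN hL sf sg cx).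
exact (pullback_eq a v hM hL gf (smooth_map_comp hM hN hL sf sg) cx).
Qed.

(** The structure maps of the fibre product commute with the projections; each such square moves one
    term of an identity between forms from a factor to the fibre product. *)
Lemma pullback_square (R : realType) (M N N' L : premanifold R) (f : M -> N) (g : N -> L)
    (f' : M -> N') (g' : N' -> L) k (a : dform L k) x v :
  has_atlas M -> has_atlas N -> has_atlas N' -> has_atlas L ->
  smooth_map f -> smooth_map g -> smooth_map f' -> smooth_map g' ->
  (forall y, carrier y -> g (f y) = g' (f' y)) -> carrier x ->
  pullback f (pullback g a) x v = pullback f' (pullback g' a) x v.
Proof.
move=> hM hN hN' hL sf sg sf' sg' E cx.
rewrite -(pullback_comp a v hM hN' hL sf' sg' cx).
exact: (pullback_factor a v hM hN hL sf sg E cx).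
Qed.

Lemma pullback_vec2 (R : realType) (M N : premanifold R) (f : M -> N) (a : dform N 2) x v w :
  pullback f a x (vec2 v w) = a (f x) (vec2 (tmap f x v) (tmap f x w)).
Proof. by rewrite /pullback comp_vec2. Qed.

Lemma prod_lie_group_atlas (R : realType) (K L : pre_lie_group R) :
  is_lie_group K -> is_lie_group L -> has_atlas (prod_group K L).
Proof. by move=> hK hL; exact (prod_atlas (group_atlas hK) (group_atlas hL)). Qed.

Lemma prod_lie_group (R : realType) (K L : pre_lie_group R) :
  is_lie_group K -> is_lie_group L -> is_lie_group (prod_group K L).
Proof.
move=> hK hL; have hk := group_atlas hK; have hl := group_atlas hL.
have hp := prod_lie_group_atlas hK hL; have hpp := prod_atlas hp hp.
have fk : @smooth_map R (prod_group K L) K fst := smooth_fst hk hl.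
have fl : @smooth_map R (prod_group K L) L snd := smooth_snd hk hl.
have f1 := smooth_fst hp hp; have f2 := smooth_snd hp hp.
split.
- exact: prod_manifold (lg_manifold hK) (lg_manifold hL).
- exact (smooth_pair hk hl hpp
    (smooth_mul_maps hK hpp (smooth_map_comp hpp hp hk f1 fk) (smooth_map_comp hpp hp hk f2 fk))
    (smooth_mul_maps hL hpp (smooth_map_comp hpp hp hl f1 fl) (smooth_map_comp hpp hp hl f2 fl))).
- exact (smooth_pair hk hl hp (smooth_map_comp hp hk hk fk (lg_inv_smooth hK))
    (smooth_map_comp hp hl hl fl (lg_inv_smooth hL))).
- by split; exact: lg_one.
- move=> [a a'] [b b'] [c c'] [ca ca'] [cb cb'] [cc cc'].
  by congr pair; exact: lg_mulA.
- by move=> [a a'] [ca ca']; congr pair; exact: lg_mul1g.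
- by move=> [a a'] [ca ca']; congr pair; exact: lg_mulg1.
- by move=> [a a'] [ca ca']; congr pair; exact: lg_mulVg.
- by move=> [a a'] [ca ca']; congr pair; exact: lg_mulgV.
Qed.

Section ProductMorphisms.
Variables (R : realType) (G : pre_groupoid R) (hG : is_lie_groupoid G).
Variables (K L : pre_lie_group R) (hK : is_lie_group K) (hL : is_lie_group L).
Variables (f : arr G -> K) (g : arr G -> L).
Hypothesis hfg : @is_groupoid_morphism R G (prod_group K L) (fun h => (f h, g h)).

Let ha := arr_atlas hG.
Let hk := group_atlas hK.
Let hl := group_atlas hL.
Let hp : has_atlas (prod_mfd K L) := prod_atlas hk hl.
Let sfg : @smooth_map R (arr G) (prod_mfd K L) (fun h => (f h, g h)) := gm_smooth hfg.

Lemma morphism_fst : is_groupoid_morphism f.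
Proof.
split.
- exact (smooth_map_comp ha hp hk sfg (smooth_fst hk hl)).
- by move=> a b ca cb ab; exact (congr1 fst (gm_mult hfg ca cb ab)).
- by move=> x cx; exact (congr1 fst (gm_idn hfg cx)).
Qed.

Lemma morphism_snd : is_groupoid_morphism g.
Proof.
split.
- exact (smooth_map_comp ha hp hl sfg (smooth_snd hk hl)).
- by move=> a b ca cb ab; exact (congr1 snd (gm_mult hfg ca cb ab)).
- by move=> x cx; exact (congr1 snd (gm_idn hfg cx)).
Qed.

Lemma tmorphism_pair h v : carrier h ->
  @tmap R (arr G) (prod_group K L) (fun h => (f h, g h)) h v =
  row_mx (tmap f h v) (tmap g h v).
Proof.
move=> ch; exact (tmap_pair hk hl ha (gm_smooth morphism_fst) (gm_smooth morphism_snd) v ch).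
Qed.

End ProductMorphisms.

Section ProductForms.
Variables (R : realType) (K L : pre_shifted_group R).
Variables (hK : is_lie_group K) (hL : is_lie_group L).
Local Notation KL := (prod_group K L).

Let hk := group_atlas hK.
Let hl := group_atlas hL.
Let hp : has_atlas KL := prod_lie_group_atlas hK hL.
Let hpp : has_atlas (prod_mfd KL KL) := prod_atlas hp hp.
Let f1 : @smooth_map R (prod_mfd KL KL) KL fst := smooth_fst hp hp.
Let f2 : @smooth_map R (prod_mfd KL KL) KL snd := smooth_snd hp hp.
Let fk : @smooth_map R KL K fst := smooth_fst hk hl.
Let fl : @smooth_map R KL L snd := smooth_snd hk hl.

Lemma smooth_pair_fst : @smooth_map R (prod_mfd KL KL) (prod_mfd K K)
  (fun p : (K * L) * (K * L) => (p.1.1, p.2.1)).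
Proof.
exact (smooth_pair hk hk hpp (smooth_map_comp hpp hp hk f1 fk)
  (smooth_map_comp hpp hp hk f2 fk)).
Qed.

Lemma smooth_pair_snd : @smooth_map R (prod_mfd KL KL) (prod_mfd L L)
  (fun p : (K * L) * (K * L) => (p.1.2, p.2.2)).
Proof.
exact (smooth_pair hl hl hpp (smooth_map_comp hpp hp hl f1 fl)
  (smooth_map_comp hpp hp hl f2 fl)).
Qed.

Lemma tmap_pair_fst (p : prod_mfd KL KL) (u u' : tangent K) (v v' : tangent L) : carrier p ->
  @tmap R (prod_mfd KL KL) (prod_mfd K K)
    (fun p : (K * L) * (K * L) => (p.1.1, p.2.1)) p
    (row_mx (row_mx u v) (row_mx u' v')) = row_mx u u'.
Proof.
move=> cp; have [c1 c2] := cp.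
set w := row_mx _ _.
have e := tmap_pair hk hk hpp (smooth_map_comp hpp hp hk f1 fk)
  (smooth_map_comp hpp hp hk f2 fk) w cp.
rewrite (tmap_comp hpp hp hk f1 fk w cp) (tmap_comp hpp hp hk f2 fk w cp) in e.
rewrite (tmap_fst hp hp w cp) (tmap_snd hp hp w cp) in e.
rewrite (tmap_fst hk hl _ c1) (tmap_fst hk hl _ c2) in e.
by rewrite /w !(row_mxKl, row_mxKr) in e.
Qed.

Lemma tmap_pair_snd (p : prod_mfd KL KL) (u u' : tangent K) (v v' : tangent L) : carrier p ->
  @tmap R (prod_mfd KL KL) (prod_mfd L L)
    (fun p : (K * L) * (K * L) => (p.1.2, p.2.2)) p
    (row_mx (row_mx u v) (row_mx u' v')) = row_mx v v'.
Proof.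
move=> cp; have [c1 c2] := cp.
set w := row_mx _ _.
have e := tmap_pair hl hl hpp (smooth_map_comp hpp hp hl f1 fl)
  (smooth_map_comp hpp hp hl f2 fl) w cp.
rewrite (tmap_comp hpp hp hl f1 fl w cp) (tmap_comp hpp hp hl f2 fl w cp) in e.
rewrite (tmap_fst hp hp w cp) (tmap_snd hp hp w cp) in e.
rewrite (tmap_snd hk hl _ c1) (tmap_snd hk hl _ c2) in e.
by rewrite /w !(row_mxKl, row_mxKr) in e.
Qed.

Lemma shifted_prod_Omega_form : is_dform (@sOmega R K) -> is_dform (@sOmega R L) ->
  is_dform (@sOmega R (shifted_prod K L)).
Proof.
move=> fK fL; apply: (dformD_is_dform hpp).
- exact: (pullback_is_dform hpp (prod_atlas hk hk) smooth_pair_fst fK).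
- exact: (pullback_is_dform hpp (prod_atlas hl hl) smooth_pair_snd fL).
Qed.

Lemma shifted_pairing_prod (u u' : tangent K) (v v' : tangent L) :
  @shifted_pairing R (shifted_prod K L) (row_mx u v) (row_mx u' v') =
  shifted_pairing u u' + shifted_pairing v v'.
Proof.
have c1 : carrier (gone KL) by split; exact: lg_one.
have cp : @carrier R (prod_mfd KL KL) (gone KL, gone KL) by [].
have E (a b c d : tangent K) (a' b' c' d' : tangent L) :
    @sOmega R (shifted_prod K L) (gone KL, gone KL)
      (vec2 (row_mx (row_mx a a') (row_mx b b')) (row_mx (row_mx c c') (row_mx d d'))) =
    @sOmega R K (gone K, gone K) (vec2 (row_mx a b) (row_mx c d)) +
    @sOmega R L (gone L, gone L) (vec2 (row_mx a' b') (row_mx c' d')).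
  rewrite /= dformD /pullback !comp_vec2.
  by rewrite !(tmap_pair_fst _ _ _ _ cp) !(tmap_pair_snd _ _ _ _ cp).
have e0 : (0 : tangent KL) = row_mx 0 0 by rewrite row_mx0.
rewrite /shifted_pairing e0 !E opprD.
by rewrite addrACA.
Qed.

Lemma shifted_pairing_opp (u u' : tangent K) :
  @shifted_pairing R (shifted_opp K) u u' = - shifted_pairing u u'.
Proof. by rewrite /shifted_pairing /= !dformN opprD. Qed.

End ProductForms.

Section MorphismForms.
Variables (R : realType) (G : pre_groupoid R) (hG : is_lie_groupoid G).

Let ha := arr_atlas hG.
Let ho := obj_atlas hG.
Let hC := composable_atlas hG.
Let tr := src_tgt_transverse hG.
Let s1 : @smooth_map R (composable G) (arr G) fst :=
  smooth_fibre_fst ha ha ho (smooth_src hG) (smooth_tgt hG) tr.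
Let s2 : @smooth_map R (composable G) (arr G) snd :=
  smooth_fibre_snd ha ha ho (smooth_src hG) (smooth_tgt hG) tr.

Lemma smooth_composable_morphism (K : pre_lie_group R) (hK : is_lie_group K)
    (f : arr G -> K) : is_groupoid_morphism f ->
  @smooth_map R (composable G) (prod_mfd K K) (fun p : arr G * arr G => (f p.1, f p.2)).
Proof.
move=> hf; have hk := group_atlas hK; have sf := gm_smooth hf.
exact (smooth_pair hk hk hC (smooth_map_comp hC ha hk s1 sf) (smooth_map_comp hC ha hk s2 sf)).
Qed.

Variables (K L : pre_shifted_group R) (hK : is_lie_group K) (hL : is_lie_group L).
Variables (f : arr G -> K) (g : arr G -> L).
Hypothesis hfg : @is_groupoid_morphism R G (prod_group K L) (fun h => (f h, g h)).
Let hk := group_atlas hK.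
Let hl := group_atlas hL.
Let hp : has_atlas (prod_mfd K L) := prod_atlas hk hl.

Lemma pullback_prod_Theta h v : carrier h ->
  @pullback R (arr G) (prod_mfd K L) (fun h => (f h, g h)) 3 (sTheta (p := shifted_prod K L)) h v =
  pullback f (@sTheta R K) h v + pullback g (@sTheta R L) h v.
Proof.
move=> ch; have sfg := gm_smooth hfg.
have eK := pullback_factor (@sTheta R K) v ha hp hk sfg (smooth_fst hk hl)
  (fun y _ => erefl (f y)) ch.
have eL := pullback_factor (@sTheta R L) v ha hp hl sfg (smooth_snd hk hl)
  (fun y _ => erefl (g y)) ch.
exact (f_equal2 +%R eK eL).
Qed.

Lemma pullback_prod_Omega p v : @carrier R (composable G) p ->
  @pullback R (composable G) (prod_mfd (prod_mfd K L) (prod_mfd K L))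
    (fun p : arr G * arr G => ((f p.1, g p.1), (f p.2, g p.2))) 2
    (sOmega (p := shifted_prod K L)) p v =
  @pullback R (composable G) (prod_mfd K K) (fun p : arr G * arr G => (f p.1, f p.2)) 2
    (@sOmega R K) p v +
  @pullback R (composable G) (prod_mfd L L) (fun p : arr G * arr G => (g p.1, g p.2)) 2
    (@sOmega R L) p v.
Proof.
move=> cp; have hpL := prod_lie_group_atlas hK hL.
have sfg : @smooth_map R (composable G) (prod_mfd (prod_mfd K L) (prod_mfd K L))
    (fun p : arr G * arr G => ((f p.1, g p.1), (f p.2, g p.2))).
  have sfg := gm_smooth hfg.
  exact (smooth_pair hp hp hC (smooth_map_comp hC ha hp s1 sfg) (smooth_map_comp hC ha hp s2 sfg)).
have eK := pullback_factor (@sOmega R K) v hC (prod_atlas hp hp) (prod_atlas hk hk) sfg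
  (smooth_pair_fst hK hL) (fun (y : arr G * arr G) _ => erefl (f y.1, f y.2)) cp.
have eL := pullback_factor (@sOmega R L) v hC (prod_atlas hp hp) (prod_atlas hl hl) sfg
  (smooth_pair_snd hK hL) (fun (y : arr G * arr G) _ => erefl (g y.1, g y.2)) cp.
exact (f_equal2 +%R eK eL).
Qed.

End MorphismForms.

Lemma dformN_is_dform (R : realType) (M : premanifold R) k (a : dform M k) : has_atlas M ->
  is_dform a -> is_dform (- a).
Proof.
move=> hM fa; split=> [x cx v i r u w|x cx v i j ij vij|x cx v].
- by rewrite !dformN (dform_multilinear fa cx) opprD mulrN.
- by rewrite dformN (dform_alternating fa cx ij vij) oppr0.
- move=> l; have := Ck_onZ (-1) (open_coord_img hM cx) (dform_smooth fa cx v l).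
  by apply: Ck_on_eq => [|u _]; [exact: open_coord_img|rewrite scaleN1r].
Qed.

Section Pairing.
Variables (R : realType) (K : pre_shifted_group R).
Variables (hK : is_lie_group K) (fO : is_dform (@sOmega R K)).

Lemma Omega_lin (k l : K) : carrier k -> carrier l -> multilinear_form (@sOmega R K (k, l)).
Proof. by move=> ck cl; apply: (dform_multilinear fO). Qed.

Lemma Omega_alt (k l : K) : carrier k -> carrier l -> alternating_form (@sOmega R K (k, l)).
Proof. by move=> ck cl; apply: (dform_alternating fO). Qed.

Let c1 := lg_one hK.

Lemma shifted_pairing0l (v : tangent K) : shifted_pairing 0 v = 0.
Proof.
by rewrite /shifted_pairing row_mx0 !(vec2_0l (Omega_lin c1 c1)) oppr0 addr0.
Qed.

Lemma shifted_pairingDr (u v w : tangent K) :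
  shifted_pairing u (v + w) = shifted_pairing u v + shifted_pairing u w.
Proof.
have e1 : row_mx (0 : tangent K) (v + w) = row_mx 0 v + row_mx 0 w.
  by rewrite add_row_mx addr0.
have e2 : row_mx (v + w) (0 : tangent K) = row_mx v 0 + row_mx w 0.
  by rewrite add_row_mx addr0.
rewrite /shifted_pairing e1 e2 !(vec2Dr (Omega_lin c1 c1) (Omega_alt c1 c1)) opprD.
by rewrite addrACA.
Qed.

End Pairing.

Section MultiplicativeForms.
Variables (R : realType) (G : pre_groupoid R) (hG : is_lie_groupoid G).
Variables (K : pre_shifted_group R) (hK : is_lie_group K) (fO : is_dform (@sOmega R K)).
Variables (Phi : arr G -> K) (hPhi : is_groupoid_morphism Phi).
Variables (sigma : dform (arr G) 2) (fs : is_dform sigma).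
Let C := composable G.
Hypothesis delta_sigma : eq_dform
  (  @pullback R C (arr G) (fun p : arr G * arr G => p.1) 2 sigma
   + @pullback R C (arr G) (fun p : arr G * arr G => p.2) 2 sigma
   - @pullback R C (arr G) (fun p : arr G * arr G => mult p.1 p.2) 2 sigma)
  (@pullback R C (prod_mfd K K)
     (fun p : arr G * arr G => (Phi p.1, Phi p.2)) 2 (@sOmega R K)).

Let ha := arr_atlas hG.
Let ho := obj_atlas hG.
Let hk := group_atlas hK.

(** Multiplicativity of [sigma] expressed on products of vectors, without reference to tangent
    vectors of [composable G]. *)
Lemma delta_sigma_tmult g h xi eta zeta xi' eta' zeta' :
  carrier g -> carrier h -> src g = tgt h ->
  tmult g h xi eta zeta -> tmult g h xi' eta' zeta' ->
  sigma g (vec2 xi xi') + sigma h (vec2 eta eta') - sigma (mult g h) (vec2 zeta zeta') =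
  sOmega (Phi g, Phi h) (vec2 (row_mx (tmap Phi g xi) (tmap Phi h eta))
                              (row_mx (tmap Phi g xi') (tmap Phi h eta'))).
Proof.
move=> cg ch gh [v [<- <- <-]] [v' [<- <- <-]].
have cgh : @carrier R C (g, h) by split.
have tr := src_tgt_transverse hG.
have s1 := smooth_fibre_fst ha ha ho (smooth_src hG) (smooth_tgt hG) tr.
have s2 := smooth_fibre_snd ha ha ho (smooth_src hG) (smooth_tgt hG) tr.
have hC := composable_atlas hG; have sP := gm_smooth hPhi.
have := delta_sigma cgh (vec2 v v').
rewrite dformD dformN dformD !pullback_vec2 => e0; apply: (etrans e0).
apply: congr1; apply: congr2.
- have e := tmap_pair hk hk hC (smooth_map_comp hC ha hk s1 sP) (smooth_map_comp hC ha hk s2 sP) v cgh.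
  rewrite (tmap_comp hC ha hk s1 sP v cgh) in e.
  by rewrite (tmap_comp hC ha hk s2 sP v cgh) in e.
- have e := tmap_pair hk hk hC (smooth_map_comp hC ha hk s1 sP) (smooth_map_comp hC ha hk s2 sP) v' cgh.
  rewrite (tmap_comp hC ha hk s1 sP v' cgh) in e.
  by rewrite (tmap_comp hC ha hk s2 sP v' cgh) in e.
Qed.

Lemma sigma_lin g : carrier g -> multilinear_form (sigma g).
Proof. by move=> cg; exact (dform_multilinear fs cg). Qed.

Lemma sigma_alt g : carrier g -> alternating_form (sigma g).
Proof. by move=> cg; exact (dform_alternating fs cg). Qed.

(* The right translate [a] of [v] to the unit at [tgt h] is the product of [v]
   and 0, while [y] times its inverse is the unit vector along [tmap tgt y];
   multiplicativity of [sigma] then gives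
   [sigma (a, tmap idn (tmap tgt y)) = sigma (v, y)]. *)
Lemma kernel_from_units :
  (forall x, carrier x -> forall a : tangent (arr G),
     (forall w, sigma (idn x) (vec2 a (tmap (@idn _ G) x w)) = 0) ->
     tmap Phi (idn x) a = 0 -> tmap (@src _ G) (idn x) a = 0 ->
     tmap (@tgt _ G) (idn x) a = 0 -> a = 0) ->
  forall h : arr G, carrier h -> forall v : tangent (arr G),
    in_ker sigma h v -> tmap Phi h v = 0 ->
    tmap (@src _ G) h v = 0 -> tmap (@tgt _ G) h v = 0 -> v = 0.
Proof.
move=> unit_ker h ch v kv Pv sv tv.
have ci := inverse_carrier hG ch; have e : src h = tgt (inverse h) by rewrite gd_tgt_inverse.
have mE := gd_mult_inverse hG ch; have cx := smooth_carrier (smooth_tgt hG) ch.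
have c1 := idn_carrier hG cx; have ck := morphism_carrier hPhi ch.
have ck' := morphism_carrier hPhi ci.
have [|a av] := tmult_ex hG ch ci e (xi := v) (eta := 0); first by rewrite sv tmap0.
have a0 : a = 0.
  apply: (unit_ker (tgt h)) => //.
  - move=> w; have [_ /(_ h ch w)[y <-]] := gd_tgt hG.
    have := delta_sigma_tmult ch ci e av (tmult_inverse_r hG y ch).
    rewrite Pv tmap0 row_mx0 (vec2_0l (Omega_lin fO ck ck')) kv.
    by rewrite (vec2_0l (sigma_lin ci)) addr0 sub0r mE => /eqP; rewrite oppr_eq0 => /eqP.
  - by have := tmorphism_mult hG hK hPhi ch ci e av; rewrite mE Pv tmap0 tmul0.
  - by have := tmult_src hG ch ci e av; rewrite mE tmap0.
  - by have := tmult_tgt hG ch ci e av; rewrite mE tv.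
(* Translating back by [h] recovers [v] as the product of a = 0 and 0, and a product of vectors is
   unique. *)
have := tmult_cancel_r hG ch ci e av; rewrite a0 tmap0 mE inverseK// => v0.
apply: (tmult_fun hG c1 ch _ v0 (tmult0 _ _)).
by rewrite gd_src_idn.
Qed.

Section AtUnits.
Variables (x : obj G) (cx : carrier x).
Let c1 : carrier (idn x : arr G) := idn_carrier hG cx.
Let ck := lg_one hK.

(** At a unit, [a] is the product of [a] and 0, since T s a = 0, and [b] is the product of the unit
    vector along T t b and [b]. Multiplicativity compares sigma on the products with sigma on the
    factors, and T Phi kills the unit vector. *)
Lemma sigma_at_unit a b : tmap (@src _ G) (idn x) a = 0 ->
  sigma (idn x) (vec2 a b) =
  sigma (idn x) (vec2 a (tmap (@idn _ G) x (tmap (@tgt _ G) (idn x) b))) -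
  sOmega (gone K, gone K)
    (vec2 (row_mx (tmap Phi (idn x) a) 0) (row_mx 0 (tmap Phi (idn x) b))).
Proof.
move=> sa; have e : src (idn x) = tgt (idn x : arr G).
  by rewrite (gd_src_idn hG)// (gd_tgt_idn hG).
have ma := tmult_idn_r hG a c1; rewrite (gd_src_idn hG cx) sa tmap0 in ma.
have mb := tmult_idn_l hG b c1; rewrite (gd_tgt_idn hG cx) in mb.
have mE : mult (idn x) (idn x : arr G) = idn x.
  by have := gd_mult_idn hG c1; rewrite gd_src_idn.
have := delta_sigma_tmult c1 c1 e ma mb; rewrite mE (gm_idn hPhi cx).
rewrite (vec2_0l (sigma_lin c1)) addr0 tmap0 (tmorphism_idn hG hK hPhi _ cx) => <-.
by rewrite opprB addrC subrK.
Qed.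

(** [lag_kernel] asks for the whole kernel of [sigma], while the fibre product only gives vanishing
    on unit vectors. *)
Lemma in_ker_at_unit a : tmap (@src _ G) (idn x) a = 0 -> tmap Phi (idn x) a = 0 ->
  (forall w, sigma (idn x) (vec2 a (tmap (@idn _ G) x w)) = 0) -> in_ker sigma (idn x) a.
Proof.
move=> sa Pa ka b; rewrite sigma_at_unit// ka Pa row_mx0.
by rewrite (vec2_0l (Omega_lin fO ck ck)) subr0.
Qed.

(** Apply [sigma_at_unit] to (a, b) and to (b, a). In the second case T t a = 0 removes the unit
    term, and sigma(a, b) cancels against sigma(b, a) in the sum of the two values of Omega that
    form the pairing. *)
Lemma pairing_at_unit a b :
  tmap (@src _ G) (idn x) a = 0 -> tmap (@tgt _ G) (idn x) a = 0 ->
  tmap (@src _ G) (idn x) b = 0 ->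
  shifted_pairing (tmap Phi (idn x) a) (tmap Phi (idn x) b) =
  - sigma (idn x) (vec2 a (tmap (@idn _ G) x (tmap (@tgt _ G) (idn x) b))).
Proof.
move=> sa ta sb; rewrite /shifted_pairing.
rewrite (vec2_skew (Omega_lin fO ck ck) (Omega_alt fO ck ck) (row_mx 0 (tmap Phi (idn x) a))).
have := sigma_at_unit b sa; have := sigma_at_unit a sb.
rewrite ta tmap0 (vec2_0r (sigma_lin c1) (sigma_alt c1)) sub0r => <-.
rewrite (vec2_skew (sigma_lin c1) (sigma_alt c1) b a) => ->.
by rewrite opprB addrA addNr sub0r.
Qed.

End AtUnits.

End MultiplicativeForms.

(** * Lagrangian fibre products *)

(** The two halves of [k] add up to the [k] that the fibre product removes. The same equations give
    k <= n1 + n2, so the truncated subtraction is a true one. *)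
Lemma fibre_product_dim (n1 m1 n2 m2 k1 k2 k : nat) :
  n1%:R - 2 * m1%:R = (k1 + k)%:R / 2 :> rat ->
  n2%:R - 2 * m2%:R = (k2 + k)%:R / 2 :> rat ->
  (n1 + n2 - k)%:R - 2 * (m1 + m2)%:R = (k1 + k2)%:R / 2 :> rat.
Proof.
rewrite !natrD => e1 e2.
have p1 : 0 <= k1%:R :> rat by []. have p2 : 0 <= k2%:R :> rat by [].
have q1 : 0 <= m1%:R :> rat by []. have q2 : 0 <= m2%:R :> rat by [].
have le : (k <= n1 + n2)%N by rewrite -(ler_nat rat) natrD; lra.
by rewrite natrB// natrD; lra.
Qed.

Section Cancellation.
Variables (R : realFieldType) (a1 a2 b1 b2 c1 c2 p1 p2 q q' : R).

(** Here [q] and [- q'] stand for the contributions of K and of its opposite. The values of the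
    forms are replaced by abstract numbers, which leaves only linear arithmetic. *)
Lemma subB_cancel : a1 - b1 - c1 = p1 + q -> a2 - b2 - c2 = p2 - q' -> q = q' ->
  a1 + a2 - (b1 + b2) - (c1 + c2) = p1 + p2.
Proof. by lra. Qed.

Lemma addB_cancel : a1 + b1 - c1 = p1 + q -> a2 + b2 - c2 = p2 - q' -> q = q' ->
  a1 + a2 + (b1 + b2) - (c1 + c2) = p1 + p2.
Proof. by lra. Qed.

End Cancellation.

Section FibreLagrangian.
Variables (R : realType) (K K1 K2 : pre_shifted_group R).
Hypotheses (hK : is_shifted_symplectic K) (hK1 : is_shifted_symplectic K1)
  (hK2 : is_shifted_symplectic K2).
Variables (H1 H2 : pre_groupoid R).
Variables (Phi1 : arr H1 -> K1) (Phi : arr H1 -> K).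
Variables (sigma1 : dform (arr H1) 2) (eta1 : dform (obj H1) 3).
Variables (Psi2 : arr H2 -> K2) (Psi : arr H2 -> K).
Variables (sigma2 : dform (arr H2) 2) (eta2 : dform (obj H2) 3).
Hypothesis lag1 : @is_lagrangian R (shifted_prod K1 K) H1
  (fun h => (Phi1 h, Phi h)) sigma1 eta1.
Hypothesis lag2 : @is_lagrangian R (shifted_prod K2 (shifted_opp K)) H2
  (fun h => (Psi2 h, Psi h)) sigma2 eta2.
Hypothesis tr : transverse Phi Psi.

Let F := fibre_groupoid Phi Psi.
Let G1 := lag_groupoid lag1.
Let G2 := lag_groupoid lag2.
Let L := ss_lie_group hK.
Let L1 := ss_lie_group hK1.
Let L2 := ss_lie_group hK2.
Let mor1 := lag_morphism lag1.
Let mor2 := lag_morphism lag2.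
Let mPhi1 : is_groupoid_morphism Phi1 := morphism_fst G1 L1 L mor1.
Let mPhi : is_groupoid_morphism Phi := morphism_snd G1 L1 L mor1.
Let mPsi2 : is_groupoid_morphism Psi2 := morphism_fst G2 L2 L mor2.
(** The annotation reads [Psi] as a morphism into [K], the Lie group underlying [shifted_opp K]. *)
Let mPsi : @is_groupoid_morphism R H2 K Psi := morphism_snd G2 L2 L mor2.
Let GF : is_lie_groupoid F := fibre_lie_groupoid G1 G2 L mPhi mPsi tr.

Let h1 := arr_atlas G1.
Let h2 := arr_atlas G2.
Let o1 := obj_atlas G1.
Let o2 := obj_atlas G2.
Let k := group_atlas L.
Let k1 := group_atlas L1.
Let k2 := group_atlas L2.
Let hF : has_atlas (arr F) := arr_atlas GF.
Let oF : has_atlas (obj F) := obj_atlas GF.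

Let pr1 : arr F -> arr H1 := fun p : arr H1 * arr H2 => p.1.
Let pr2 : arr F -> arr H2 := fun p : arr H1 * arr H2 => p.2.
Let qr1 : obj F -> obj H1 := fun x : obj H1 * obj H2 => x.1.
Let qr2 : obj F -> obj H2 := fun x : obj H1 * obj H2 => x.2.
Let spr1 : smooth_map pr1 := smooth_fibre_arr1 G1 G2 L mPhi mPsi tr.
Let spr2 : smooth_map pr2 := smooth_fibre_arr2 G1 G2 L mPhi mPsi tr.
Let sqr1 : smooth_map qr1 := smooth_fst o1 o2.
Let sqr2 : smooth_map qr2 := smooth_snd o1 o2.

Let sigmaF : dform (arr F) 2 := pullback pr1 sigma1 + pullback pr2 sigma2.
Let etaF : dform (obj F) 3 := pullback qr1 eta1 + pullback qr2 eta2.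
Let PhiF : arr F -> prod_group K1 K2 := fun p : arr H1 * arr H2 => (Phi1 p.1, Psi2 p.2).

Let fs1 := lag_sigma_form lag1.
Let fs2 := lag_sigma_form lag2.
Let fe1 := lag_eta_form lag1.
Let fe2 := lag_eta_form lag2.
Let fp1 : is_dform (pullback pr1 sigma1) := pullback_is_dform hF h1 spr1 fs1.
Let fp2 : is_dform (pullback pr2 sigma2) := pullback_is_dform hF h2 spr2 fs2.
Let fq1 : is_dform (pullback qr1 eta1) := pullback_is_dform oF o1 sqr1 fe1.
Let fq2 : is_dform (pullback qr2 eta2) := pullback_is_dform oF o2 sqr2 fe2.

Let sPhi1 := smooth_map_comp hF h1 k1 spr1 (gm_smooth mPhi1).
Let sPsi2 := smooth_map_comp hF h2 k2 spr2 (gm_smooth mPsi2).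

Lemma fibre_morphism : is_groupoid_morphism PhiF.
Proof.
split.
- exact (smooth_pair k1 k2 hF sPhi1 sPsi2).
- move=> p q [p1 p2 ep] [q1 q2 eq] e.
  have e1 := congr1 fst e; have e2 := congr1 snd e.
  by congr pair; [exact: gm_mult|exact: gm_mult].
- by move=> x [x1 x2]; congr pair; [exact: gm_idn|exact: gm_idn].
Qed.

Lemma fibre_idn_sigma : eq_dform (pullback (@idn R F) sigmaF) 0.
Proof.
move=> x cx v; have [c1 c2] := cx.
have E1 := pullback_square sigma1 v oF hF o1 h1 (gd_idn_smooth GF) spr1 sqr1
  (gd_idn_smooth G1) (fun y _ => erefl (idn (qr1 y))) cx.
have E2 := pullback_square sigma2 v oF hF o2 h2 (gd_idn_smooth GF) spr2 sqr2
  (gd_idn_smooth G2) (fun y _ => erefl (idn (qr2 y))) cx.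
have Z1 := lag_idn_sigma lag1 c1 (fun i => tmap qr1 x (v i)).
have Z2 := lag_idn_sigma lag2 c2 (fun i => tmap qr2 x (v i)).
transitivity (0 + 0 : R); last exact: addr0.
exact (f_equal2 +%R (etrans E1 Z1) (etrans E2 Z2)).
Qed.

Lemma fibre_eta_closed : eq_dform (ext_d etaF) 0.
Proof.
move=> x cx v; have [c1 c2] := cx.
have E1 := ext_d_pullback oF o1 sqr1 fe1 v cx.
have E2 := ext_d_pullback oF o2 sqr2 fe2 v cx.
have Z1 := lag_eta_closed lag1 c1 (fun i => tmap qr1 x (v i)).
have Z2 := lag_eta_closed lag2 c2 (fun i => tmap qr2 x (v i)).
apply: (etrans (ext_dD v oF fq1 fq2 cx)).
transitivity (0 + 0 : R); last exact: addr0.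
exact (f_equal2 +%R (etrans E1 Z1) (etrans E2 Z2)).
Qed.

Lemma fibre_delta_eta : eq_dform
  (pullback (@src R F) etaF - pullback (@tgt R F) etaF - ext_d sigmaF)
  (pullback PhiF (@sTheta R (shifted_prod K1 K2))).
Proof.
move=> p cp v; have [c1 c2 e] := cp.
pose v1 i := tmap pr1 p (v i); pose v2 i := tmap pr2 p (v i).
have D1 := etrans (lag_delta_eta lag1 c1 v1) (pullback_prod_Theta G1 L1 L mor1 v1 c1).
have D2 := etrans (lag_delta_eta lag2 c2 v2)
  (@pullback_prod_Theta R H2 G2 K2 (shifted_opp K) L2 L Psi2 Psi mor2 p.2 v2 c2).
have S1 := pullback_square eta1 v hF oF h1 o1 (smooth_src GF) sqr1 spr1
  (smooth_src G1) (fun y _ => erefl (src (pr1 y))) cp.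
have S2 := pullback_square eta2 v hF oF h2 o2 (smooth_src GF) sqr2 spr2
  (smooth_src G2) (fun y _ => erefl (src (pr2 y))) cp.
have T1 := pullback_square eta1 v hF oF h1 o1 (smooth_tgt GF) sqr1 spr1
  (smooth_tgt G1) (fun y _ => erefl (tgt (pr1 y))) cp.
have T2 := pullback_square eta2 v hF oF h2 o2 (smooth_tgt GF) sqr2 spr2
  (smooth_tgt G2) (fun y _ => erefl (tgt (pr2 y))) cp.
have X1 := ext_d_pullback hF h1 spr1 fs1 v cp.
have X2 := ext_d_pullback hF h2 spr2 fs2 v cp.
have X := etrans (ext_dD v hF fp1 fp2 cp) (f_equal2 +%R X1 X2).
have P1 := pullback_comp (@sTheta R K1) v hF h1 k1 spr1 (gm_smooth mPhi1) cp.
have P2 := pullback_comp (@sTheta R K2) v hF h2 k2 spr2 (gm_smooth mPsi2) cp.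
have P := etrans (pullback_prod_Theta GF L1 L2 fibre_morphism v cp) (f_equal2 +%R P1 P2).
(* Phi o pr1 = Psi o pr2 on the fibre product, so the terms of [K], which enter [D1] and [D2] with
   opposite signs, are equal up to that sign. *)
have Q := pullback_square (@sTheta R K) v hF h1 h2 k spr1 (gm_smooth mPhi) spr2
  (gm_smooth mPsi) (fun y (cy : carrier y) => let: And3 _ _ e := cy in e) cp.
have S := f_equal2 +%R S1 S2; have T := f_equal2 +%R T1 T2.
apply: (etrans (f_equal2 (fun a b : R => a - b) (f_equal2 (fun a b : R => a - b) S T) X)).
apply: (etrans _ (esym P)).
exact (subB_cancel D1 D2 Q).
Qed.

Let hC := composable_atlas GF.
Let C1 := composable_atlas G1.
Let C2 := composable_atlas G2.

Lemma fibre_delta_sigma :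
  let C := composable F in
  eq_dform
    (  @pullback R C (arr F) (fun p : arr F * arr F => p.1) 2 sigmaF
     + @pullback R C (arr F) (fun p : arr F * arr F => p.2) 2 sigmaF
     - @pullback R C (arr F) (fun p : arr F * arr F => mult p.1 p.2) 2 sigmaF)
    (@pullback R C (prod_mfd (prod_mfd K1 K2) (prod_mfd K1 K2))
       (fun p : arr F * arr F => (PhiF p.1, PhiF p.2)) 2 (@sOmega R (shifted_prod K1 K2))).
Proof.
move=> C p cp v.
have trF := src_tgt_transverse GF.
have tr1 := src_tgt_transverse G1.
have tr2 := src_tgt_transverse G2.
have f1 := smooth_fibre_fst hF hF oF (smooth_src GF) (smooth_tgt GF) trF.
have f2 := smooth_fibre_snd hF hF oF (smooth_src GF) (smooth_tgt GF) trF.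
have g1 := smooth_fibre_fst h1 h1 o1 (smooth_src G1) (smooth_tgt G1) tr1.
have g2 := smooth_fibre_snd h1 h1 o1 (smooth_src G1) (smooth_tgt G1) tr1.
have l1 := smooth_fibre_fst h2 h2 o2 (smooth_src G2) (smooth_tgt G2) tr2.
have l2 := smooth_fibre_snd h2 h2 o2 (smooth_src G2) (smooth_tgt G2) tr2.
(* The identities for sigma1 and sigma2 live on the composable pairs of [H1] and [H2]; [w1] and [w2]
   pull them back to those of [F]. *)
pose w1 : composable F -> composable H1 := fun q : arr F * arr F => (pr1 q.1, pr1 q.2).
pose w2 : composable F -> composable H2 := fun q : arr F * arr F => (pr2 q.1, pr2 q.2).
have sw1 : smooth_map w1 := smooth_composable_maps G1 hC
  (smooth_map_comp hC hF h1 f1 spr1) (smooth_map_comp hC hF h1 f2 spr1)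
  (fun q cq => let: And3 _ _ e := cq in congr1 fst e).
have sw2 : smooth_map w2 := smooth_composable_maps G2 hC
  (smooth_map_comp hC hF h2 f1 spr2) (smooth_map_comp hC hF h2 f2 spr2)
  (fun q cq => let: And3 _ _ e := cq in congr1 snd e).
pose v1 i := tmap w1 p (v i); pose v2 i := tmap w2 p (v i).
have c1 := smooth_carrier sw1 cp; have c2 := smooth_carrier sw2 cp.
have D1 := etrans (lag_delta_sigma lag1 c1 v1) (pullback_prod_Omega G1 L1 L mor1 v1 c1).
have D2 := etrans (lag_delta_sigma lag2 c2 v2)
  (@pullback_prod_Omega R H2 G2 K2 (shifted_opp K) L2 L Psi2 Psi mor2 _ v2 c2).
have A1 := pullback_square sigma1 v hC hF C1 h1 f1 spr1 sw1 g1
  (fun (y : arr F * arr F) _ => erefl (pr1 y.1)) cp.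
have A2 := pullback_square sigma2 v hC hF C2 h2 f1 spr2 sw2 l1
  (fun (y : arr F * arr F) _ => erefl (pr2 y.1)) cp.
have B1 := pullback_square sigma1 v hC hF C1 h1 f2 spr1 sw1 g2
  (fun (y : arr F * arr F) _ => erefl (pr1 y.2)) cp.
have B2 := pullback_square sigma2 v hC hF C2 h2 f2 spr2 sw2 l2
  (fun (y : arr F * arr F) _ => erefl (pr2 y.2)) cp.
have M1 := pullback_square sigma1 v hC hF C1 h1 (gd_mult_smooth GF) spr1 sw1 (gd_mult_smooth G1)
  (fun (y : arr F * arr F) _ => erefl (mult (pr1 y.1) (pr1 y.2))) cp.
have M2 := pullback_square sigma2 v hC hF C2 h2 (gd_mult_smooth GF) spr2 sw2 (gd_mult_smooth G2)
  (fun (y : arr F * arr F) _ => erefl (mult (pr2 y.1) (pr2 y.2))) cp.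
have q1 := smooth_composable_morphism G1 L1 mPhi1.
have q2 := smooth_composable_morphism G2 L2 mPsi2.
have r1 := smooth_composable_morphism G1 L mPhi.
have r2 := smooth_composable_morphism G2 L mPsi.
have kk := prod_atlas k k.
have P1 := pullback_comp (@sOmega R K1) v hC C1 (prod_atlas k1 k1) sw1 q1 cp.
have P2 := pullback_comp (@sOmega R K2) v hC C2 (prod_atlas k2 k2) sw2 q2 cp.
have P := etrans (pullback_prod_Omega GF L1 L2 fibre_morphism v cp) (f_equal2 +%R P1 P2).
have E (y : composable F) : carrier y ->
    (Phi (pr1 y.1), Phi (pr1 y.2)) = (Psi (pr2 y.1), Psi (pr2 y.2)).
  by move=> [[_ _ e1] [_ _ e2] _]; exact: (f_equal2 pair e1 e2).
have Q := pullback_square (@sOmega R K) v hC C1 C2 kk sw1 r1 sw2 r2 E cp.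
have A := f_equal2 +%R A1 A2; have B := f_equal2 +%R B1 B2; have M := f_equal2 +%R M1 M2.
apply: (etrans (f_equal2 (fun a b : R => a - b) (f_equal2 +%R A B) M)).
apply: (etrans _ (esym P)).
exact (addB_cancel D1 D2 Q).
Qed.


(** * The kernel condition at the units of the fibre product *)

Section UnitKernel.
Variables (x : obj F) (cx : carrier x) (a : tangent (arr F)).
Hypothesis ka : forall w, sigmaF (idn x) (vec2 a (tmap (@idn R F) x w)) = 0.
Hypothesis Pa : tmap PhiF (idn x) a = 0.
Hypothesis sa : tmap (@src R F) (idn x) a = 0.
Hypothesis ta : tmap (@tgt R F) (idn x) a = 0.

Let c : carrier (idn x : arr F) := idn_carrier GF cx.
Let a1 : tangent (arr H1) := tmap pr1 (idn x) a.
Let a2 : tangent (arr H2) := tmap pr2 (idn x) a.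
Let x1 : carrier (qr1 x) := proj1 cx.
Let x2 : carrier (qr2 x) := proj2 cx.

Let a12 : tmap Phi (idn (qr1 x)) a1 = tmap Psi (idn (qr2 x)) a2.
Proof. exact (fibre_tangentE h1 h2 k (gm_smooth mPhi) (gm_smooth mPsi) tr a c). Qed.

Let sa12 : tmap (@src R H1) (idn (qr1 x)) a1 = 0 /\ tmap (@src R H2) (idn (qr2 x)) a2 = 0.
Proof.
have := sa; rewrite (tsrc_fibre G1 G2 L mPhi mPsi tr a c) -row_mx0.
by move/eq_row_mx.
Qed.

Let ta12 : tmap (@tgt R H1) (idn (qr1 x)) a1 = 0 /\ tmap (@tgt R H2) (idn (qr2 x)) a2 = 0.
Proof.
have := ta; rewrite (ttgt_fibre G1 G2 L mPhi mPsi tr a c) -row_mx0.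
by move/eq_row_mx.
Qed.

Let Pa12 : tmap Phi1 (idn (qr1 x)) a1 = 0 /\ tmap Psi2 (idn (qr2 x)) a2 = 0.
Proof.
have e := tmap_pair k1 k2 hF sPhi1 sPsi2 a c.
rewrite (tmap_comp hF h1 k1 spr1 (gm_smooth mPhi1) a c) in e.
rewrite (tmap_comp hF h2 k2 spr2 (gm_smooth mPsi2) a c) in e.
have := etrans (esym e) Pa; rewrite -[0]row_mx0.
by move/eq_row_mx.
Qed.

(** The objects of [F] form the whole product of the two object manifolds, so [w1] and [w2] are
    independent; setting one of them to 0 separates sigma1 from sigma2. *)
Let ka_split w1 w2 :
  sigma1 (idn (qr1 x)) (vec2 a1 (tmap (@idn R H1) (qr1 x) w1)) +
  sigma2 (idn (qr2 x)) (vec2 a2 (tmap (@idn R H2) (qr2 x) w2)) = 0.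
Proof.
have si := gd_idn_smooth GF; pose w : tangent (obj F) := row_mx w1 w2.
have e := ka w; rewrite /sigmaF dformD !pullback_vec2 in e.
have q1 : tmap qr1 x w = w1 by rewrite (tmap_fst o1 o2 w cx) row_mxKl.
have q2 : tmap qr2 x w = w2 by rewrite (tmap_snd o1 o2 w cx) row_mxKr.
have e1 := tmap_comp oF hF h1 si spr1 w cx.
have e2 := tmap_comp oF hF h2 si spr2 w cx.
have d1 := tmap_comp oF o1 h1 sqr1 (gd_idn_smooth G1) w cx.
have d2 := tmap_comp oF o2 h2 sqr2 (gd_idn_smooth G2) w cx.
rewrite q1 in d1; rewrite q2 in d2.
by move: e; rewrite (etrans (esym e1) d1) (etrans (esym e2) d2).
Qed.

Let lin1 : multilinear_form (sigma1 (idn (qr1 x))).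
Proof. exact (dform_multilinear fs1 (idn_carrier G1 x1)). Qed.
Let lin2 : multilinear_form (sigma2 (idn (qr2 x))).
Proof. exact (dform_multilinear fs2 (idn_carrier G2 x2)). Qed.
Let alt1 : alternating_form (sigma1 (idn (qr1 x))).
Proof. exact (dform_alternating fs1 (idn_carrier G1 x1)). Qed.
Let alt2 : alternating_form (sigma2 (idn (qr2 x))).
Proof. exact (dform_alternating fs2 (idn_carrier G2 x2)). Qed.

Let ka1 w : sigma1 (idn (qr1 x)) (vec2 a1 (tmap (@idn R H1) (qr1 x) w)) = 0.
Proof. by have := ka_split w 0; rewrite tmap0 (vec2_0r lin2 alt2) addr0. Qed.

Let ka2 w : sigma2 (idn (qr2 x)) (vec2 a2 (tmap (@idn R H2) (qr2 x) w)) = 0.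
Proof. by have := ka_split 0 w; rewrite tmap0 (vec2_0r lin1 alt1) add0r. Qed.

Let fO1 : is_dform (@sOmega R (shifted_prod K1 K)) :=
  shifted_prod_Omega_form L1 L (ss_Omega_form hK1) (ss_Omega_form hK).
Let fO2 : is_dform (@sOmega R (shifted_prod K2 (shifted_opp K))) :=
  @shifted_prod_Omega_form R K2 (shifted_opp K) L2 L (ss_Omega_form hK2)
    (dformN_is_dform (prod_atlas k k) (ss_Omega_form hK)).
Let LK1 : is_lie_group (shifted_prod K1 K) := prod_lie_group L1 L.
Let LK2 : is_lie_group (shifted_prod K2 (shifted_opp K)) := prod_lie_group L2 L.
Let delta1 := lag_delta_sigma lag1.
Let delta2 := lag_delta_sigma lag2.

Let u := tmap Phi (idn (qr1 x)) a1.

Let u_orthogonal1 b : tmap (@src R H1) (idn (qr1 x)) b = 0 ->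
  shifted_pairing u (tmap Phi (idn (qr1 x)) b) = 0.
Proof.
move=> sb; have [sa1 _] := sa12; have [ta1 _] := ta12; have [Pa1 _] := Pa12.
have := pairing_at_unit G1 LK1 fO1 mor1 fs1 delta1 x1 sa1 ta1 sb.
rewrite (tmorphism_pair G1 L1 L mor1 a1 (idn_carrier G1 x1)).
rewrite (tmorphism_pair G1 L1 L mor1 b (idn_carrier G1 x1)) ka1 oppr0.
rewrite (shifted_pairing_prod L1 L) Pa1 (shifted_pairing0l L1 (ss_Omega_form hK1)).
by rewrite add0r.
Qed.

Let u_orthogonal2 b : tmap (@src R H2) (idn (qr2 x)) b = 0 ->
  shifted_pairing u (tmap Psi (idn (qr2 x)) b) = 0.
Proof.
move=> sb; have [_ sa2] := sa12; have [_ ta2] := ta12; have [_ Pa2] := Pa12.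
have := pairing_at_unit G2 LK2 fO2 mor2 fs2 delta2 x2 sa2 ta2 sb.
rewrite (@tmorphism_pair R H2 G2 K2 K L2 L Psi2 Psi mor2 _ a2 (idn_carrier G2 x2)).
rewrite (@tmorphism_pair R H2 G2 K2 K L2 L Psi2 Psi mor2 _ b (idn_carrier G2 x2)).
rewrite ka2 oppr0 (@shifted_pairing_prod R K2 (shifted_opp K) L2 L) Pa2.
rewrite (shifted_pairing0l L2 (ss_Omega_form hK2)) add0r shifted_pairing_opp -a12.
by move/eqP; rewrite oppr_eq0 => /eqP.
Qed.

Let u0 : u = 0.
Proof.
apply: (ss_nondegenerate hK) => z.
have i1 := idn_carrier G1 x1; have i2 := idn_carrier G2 x2.
have e : Phi (idn (qr1 x)) = Psi (idn (qr2 x)).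
  by rewrite (gm_idn mPhi x1) (gm_idn mPsi x2).
have [b1 [b2 [s1 s2 <-]]] := transverse_on_source_fibres G1 G2 L mPhi mPsi tr i1 i2 e z.
rewrite (shifted_pairingDr L (ss_Omega_form hK)) u_orthogonal1// u_orthogonal2//.
exact: addr0.
Qed.

Lemma fibre_unit_kernel : a = 0.
Proof.
have [sa1 sa2] := sa12; have [ta1 ta2] := ta12; have [Pa1 Pa2] := Pa12.
have i1 := idn_carrier G1 x1; have i2 := idn_carrier G2 x2.
have P1 : @tmap R (arr H1) (prod_mfd K1 K) (fun h => (Phi1 h, Phi h)) (idn (qr1 x)) a1 = 0.
  by rewrite (tmorphism_pair G1 L1 L mor1 a1 i1) Pa1 -/u u0 row_mx0.
have P2 : @tmap R (arr H2) (prod_mfd K2 K) (fun h => (Psi2 h, Psi h)) (idn (qr2 x)) a2 = 0.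
  by rewrite (@tmorphism_pair R H2 G2 K2 K L2 L Psi2 Psi mor2 _ a2 i2) Pa2 -a12 -/u u0 row_mx0.
have k1' := in_ker_at_unit G1 LK1 fO1 mor1 fs1 delta1 x1 sa1 P1 ka1.
have k2' := in_ker_at_unit G2 LK2 fO2 mor2 fs2 delta2 x2 sa2 P2 ka2.
have z1 := lag_kernel lag1 i1 k1' P1 sa1 ta1.
have z2 := lag_kernel lag2 i2 k2' P2 sa2 ta2.
apply: (fibre_tangent_inj h1 h2 k (gm_smooth mPhi) (gm_smooth mPsi) tr c).
- by rewrite [LHS]z1 tmap0.
- by rewrite [LHS]z2 tmap0.
Qed.

End UnitKernel.

Lemma fibre_is_lagrangian :
  @is_lagrangian R (shifted_prod K1 K2) F PhiF sigmaF etaF.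
Proof.
have sF := dformD_is_dform hF fp1 fp2.
have fO := shifted_prod_Omega_form L1 L2 (ss_Omega_form hK1) (ss_Omega_form hK2).
split.
- exact: GF.
- exact: fibre_morphism.
- exact: sF.
- exact: (dformD_is_dform oF fq1 fq2).
- exact: fibre_idn_sigma.
- exact: fibre_eta_closed.
- exact: fibre_delta_sigma.
- exact: fibre_delta_eta.
- exact: fibre_product_dim (lag_dim lag1) (lag_dim lag2).
- exact (kernel_from_units (K := shifted_prod K1 K2) GF (prod_lie_group L1 L2) fO fibre_morphism sF fibre_delta_sigma
    fibre_unit_kernel).
Qed.

End FibreLagrangian.

Theorem theorem3p23 (R : realType)
  (K K1 K2 : pre_shifted_group R)
  (hK : is_shifted_symplectic K)
  (hK1 : is_shifted_symplectic K1)
  (hK2 : is_shifted_symplectic K2)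
  (H1 H2 : pre_groupoid R)
  (Phi1 : arr H1 -> K1) (Phi : arr H1 -> K)
  (sigma1 : dform (arr H1) 2) (eta1 : dform (obj H1) 3)
  (Psi2 : arr H2 -> K2) (Psi : arr H2 -> K)
  (sigma2 : dform (arr H2) 2) (eta2 : dform (obj H2) 3)
  (lag1 : @is_lagrangian R (shifted_prod K1 K) H1
            (fun h => (Phi1 h, Phi h)) sigma1 eta1)
  (lag2 : @is_lagrangian R (shifted_prod K2 (shifted_opp K)) H2
            (fun h => (Psi2 h, Psi h)) sigma2 eta2)
  (htrans : transverse Phi Psi) :
  let F := fibre_groupoid Phi Psi in
  @is_lagrangian R (shifted_prod K1 K2) F
    (fun p : arr H1 * arr H2 => (Phi1 p.1, Psi2 p.2))
    (@pullback R (arr F) (arr H1) (fun p : arr H1 * arr H2 => p.1) 2 sigma1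
     + @pullback R (arr F) (arr H2) (fun p : arr H1 * arr H2 => p.2) 2 sigma2)
    (@pullback R (obj F) (obj H1) (fun x : obj H1 * obj H2 => x.1) 3 eta1
     + @pullback R (obj F) (obj H2) (fun x : obj H1 * obj H2 => x.2) 3 eta2).
Proof. exact (fibre_is_lagrangian hK hK1 hK2 lag1 lag2 htrans). Qed.
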